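(* Let $0<s<1$, let the angular cross section $b$ satisfy $b(\cos\theta)\,\theta^{2+2s}\to K$ as $\theta\to 0^+$ for some constant $K>0$, and let $\alpha\in(2s,2]$. Suppose $F_0\in\tilde P_\alpha(\mathbb R^3)$ is not a single Dirac mass, and let $f(t,v)$ be the unique solution in $C([0,\infty),\tilde P_\alpha)$ of the Cauchy problem for the spatially homogeneous Boltzmann equation with Maxwellian type cross section $b$ and initial datum $F_0$. Then there exists $T>0$ such that $f(t,\cdot)\in H^\infty(\mathbb R^3)$ for every $0<t\le T$. Moreover, one can take $T=\infty$ (that is, $f(t,\cdot)\in H^\infty(\mathbb R^3)$ for all $t>0$) when $F_0\in P_2(\mathbb R^3)$ and $0<s<1$, and also when $F_0\in P_1(\mathbb R^3)$ and $0<s<\tfrac12$.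
   Context: Cross section: $b(\cos\theta)\ge 0$ is measurable, with $\theta\in[0,\pi/2]$ (it is set to $0$ for $\theta\in(\pi/2,\pi]$), and $\theta\mapsto b(\cos\theta)\sin\theta$ is integrable on $[\delta,\pi/2]$ for each $\delta>0$. Equation: the spatially homogeneous Boltzmann equation of Maxwellian type is $\partial_t f=Q(f,f)$ with $$Q(g,f)(v)=\int_{\mathbb R^3}\int_{\mathbb S^2} b\Big(\frac{v-v_*}{|v-v_*|}\cdot\sigma\Big)\{g(v'_* )f(v')-g(v_* )f(v)\}\,d\sigma\,dv_*,$$ $v'=\frac{v+v_*}{2}+\frac{|v-v_*|}{2}\sigma$, $v'_*=\frac{v+v_*}{2}-\frac{|v-v_*|}{2}\sigma$. Function spaces: $P_\beta(\mathbb R^3)$ is the set of probability measures $F$ on $\mathbb R^3$ with $\int|v|^\beta dF(v)<\infty$. $\mathcal K$ is the set of characteristic functions $\psi(\xi)=\int_{\mathbb R^3}e^{-iv\cdot\xi}\,d\Psi(v)$ of probability measures $\Psi$ on $\mathbb R^3$. For $0\le\alpha\le2$, $\mathcal K^\alpha=\{\varphi\in\mathcal K:\ \|\varphi-1\|_\alpha<\infty\}$, with the distance $\|\varphi-\tilde\varphi\|_\alpha=\sup_{\xi\ne0}|\varphi(\xi)-\tilde\varphi(\xi)|/|\xi|^\alpha$. $\tilde P_\alpha=\tilde P_\alpha(\mathbb R^3)$ is the set of probability measures whose Fourier transform lies in $\mathcal K^\alpha$, with the distance transported from $\mathcal K^\alpha$. Solutions: $f\in C([0,\infty),\tilde P_\alpha)$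 (a family of probability measures, written $f(t,v)\,dv$ even if it has no density) solves the Cauchy problem with initial datum $F_0$ if its Fourier transform $\psi(t,\xi)=\int e^{-iv\cdot\xi}f(t,v)\,dv$ is a classical solution in $C([0,\infty),\mathcal K^\alpha)$ of $$\partial_t\psi(t,\xi)=\int_{\mathbb S^2}b\Big(\frac{\xi\cdot\sigma}{|\xi|}\Big)\big(\psi(t,\xi^+)\psi(t,\xi^-)-\psi(t,\xi)\psi(t,0)\big)d\sigma,\qquad \xi^\pm=\frac{\xi}{2}\pm\frac{|\xi|}{2}\sigma,$$ with $\psi(0,\xi)=\int e^{-iv\cdot\xi}dF_0(v)$. Here $\cos\theta=\frac{\xi}{|\xi|}\cdot\sigma$, the $\sigma$-integral is understood as the limit as $\epsilon\to0^+$ of the integrals over $\{\theta\ge\epsilon\}$, and the right side is $0$ at $\xi=0$. It is known that for $2s<\alpha\le2$ and any $F_0\in\tilde P_\alpha$ there is a unique such solution. $H^\infty(\mathbb R^3)=\bigcap_{k\ge0}H^k(\mathbb R^3)$; the statement $f(t,\cdot)\in H^\infty$ means the measure has a density in $H^\infty$. *)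

(* Defs.v *)
From HB Require Import structures.
From mathcomp Require Import all_boot all_order all_algebra.
From mathcomp Require Import complex.
From mathcomp Require Import all_classical all_reals all_analysis.

Set Implicit Arguments.
Unset Strict Implicit.
Unset Printing Implicit Defensive.

Import Order.TTheory GRing.Theory Num.Theory.
Import numFieldNormedType.Exports.

Local Open Scope classical_set_scope.
Local Open Scope ring_scope.
Local Open Scope complex_scope.

(* The library's norm and metric on products are sup-norms, so the Euclidean
   structure of R^3 is spelled out on coordinates. *)
Notation R3 R :=
  (measurableTypeR R * measurableTypeR R * measurableTypeR R)%type.

Section Euclidean.
Context {R : realType}.
Implicit Types v w : R3 R.

Definition dot3 v w : R := v.1.1 * w.1.1 + v.1.2 * w.1.2 + v.2 * w.2.

Definition norm3 v : R := Num.sqrt (dot3 v v).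

Definition scale3 (a : R) v : R3 R := (a * v.1.1, a * v.1.2, a * v.2).

Definition lebesgue3 : {measure set (R3 R) -> \bar R} :=
  ((@lebesgue_measure R \x @lebesgue_measure R) \x @lebesgue_measure R)%E.

End Euclidean.

Section Sphere.
Context {R : realType}.

Definition sph (p : measurableTypeR R * measurableTypeR R) : R3 R :=
  (sin p.1 * cos p.2, sin p.1 * sin p.2, cos p.1).

(* Integral of g over D `&` S^2 for the surface measure: in spherical
   coordinates (polar angle p.1, azimuth p.2) it is sin p.1 dp. *)
Definition sphere_int (D : set (R3 R)) (g : R3 R -> R) : R :=
  (\int[(@lebesgue_measure R \x @lebesgue_measure R)%E]_(p in
      [set p | 0 <= p.1 <= pi /\ 0 <= p.2 <= 2 * pi /\ D (sph p)])
    (g (sph p) * sin p.1))%R.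

Definition sphere_intC (D : set (R3 R)) (g : R3 R -> R[i]) : R[i] :=
  sphere_int D (fun sigma => complex.Re (g sigma)) +i*
  sphere_int D (fun sigma => complex.Im (g sigma)).

End Sphere.

Section Spaces.
Context {R : realType}.

Definition charf (F : probability (R3 R) R) (xi : R3 R) : R[i] :=
  (\int[F]_v cos (dot3 v xi))%R -i* (\int[F]_v sin (dot3 v xi))%R.

Definition calK : set (R3 R -> R[i]) :=
  [set phi | exists Psi : probability (R3 R) R, phi = charf Psi].

Definition distK (alpha : R) (phi phi' : R3 R -> R[i]) : \bar R :=
  ereal_sup [set (ComplexField.Normc.normc (phi xi - phi' xi)
                  / norm3 xi `^ alpha)%:E | xi in [set xi | xi != 0]].

Definition calKa (alpha : R) : set (R3 R -> R[i]) :=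
  calK `&` [set phi | (distK alpha phi (fun=> 1%R) < +oo)%E].

Definition tildeP (alpha : R) : set (probability (R3 R) R) :=
  [set F | calKa alpha (charf F)].

Definition P_ (beta : R) : set (probability (R3 R) R) :=
  [set F | (\int[F]_v (norm3 v `^ beta)%:E < +oo)%E].

(* Equality is tested on measurable sets only, since the value of a
   [probability] on the other sets carries no information. *)
Definition is_dirac (F : probability (R3 R) R) : Prop :=
  exists a : R3 R, forall A, measurable A -> F A = \d_a A.

End Spaces.

Section CrossSection.
Context {R : realType}.

Record cross_section (b : R -> R) : Prop := CrossSection {
  cross_section_ge0 : forall theta : R,
    0 <= theta <= pi / 2 -> 0 <= b (cos theta) ;
  cross_section_eq0 : forall theta : R,
    pi / 2 < theta <= pi -> b (cos theta) = 0 ;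
  cross_section_measurable : measurable_fun (`[-1, 1] : set R) b ;
  cross_section_integrable : forall delta : R, 0 < delta ->
    (@lebesgue_measure R).-integrable `[delta, pi / 2]
      (fun theta => (b (cos theta) * sin theta)%:E) }.

End CrossSection.

Section Boltzmann.
Context {R : realType}.

Definition xip (xi sigma : R3 R) : R3 R :=
  scale3 2^-1 xi + scale3 (norm3 xi / 2) sigma.

Definition xim (xi sigma : R3 R) : R3 R :=
  scale3 2^-1 xi - scale3 (norm3 xi / 2) sigma.

Definition costheta (xi sigma : R3 R) : R := dot3 xi sigma / norm3 xi.

Definition collision (b : R -> R) (psi : R3 R -> R[i]) (eps : R) (xi : R3 R)
    : R[i] :=
  sphere_intC [set sigma | eps <= acos (costheta xi sigma)]
    (fun sigma => (b (costheta xi sigma))%:C *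
       (psi (xip xi sigma) * psi (xim xi sigma) - psi xi * psi 0)).

(* l is the right-hand side of the Fourier-transformed equation at xi; limits
   in R[i] are taken on real and imaginary parts. *)
Definition collision_value (b : R -> R) (psi : R3 R -> R[i]) (xi : R3 R)
    (l : R[i]) : Prop :=
  if xi == 0 then l = 0 else
    complex.Re (collision b psi eps xi) @[eps --> 0^'+] --> complex.Re l /\
    complex.Im (collision b psi eps xi) @[eps --> 0^'+] --> complex.Im l.

(* psi \in C([0, +oo[, K^alpha) *)
Definition continuous_calKa (alpha : R) (psi : R -> R3 R -> R[i]) : Prop :=
  (forall t, 0 <= t -> calKa alpha (psi t)) /\
  (forall t0, 0 <= t0 ->
     distK alpha (psi t) (psi t0) @[t --> within [set t | 0 <= t] (nbhs t0)]
       --> 0%E).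

Definition fourier_solution (b : R -> R) (alpha : R)
    (psi0 : R3 R -> R[i]) (psi : R -> R3 R -> R[i]) : Prop :=
  [/\ continuous_calKa alpha psi,
      psi 0 = psi0 &
      forall t xi, 0 < t -> exists2 l : R[i],
        collision_value b (psi t) xi l &
        is_derive t 1 (fun u => complex.Re (psi u xi)) (complex.Re l) /\
        is_derive t 1 (fun u => complex.Im (psi u xi)) (complex.Im l)].

Definition boltzmann_solution (b : R -> R) (alpha : R)
    (F0 : probability (R3 R) R) (f : R -> probability (R3 R) R) : Prop :=
  fourier_solution b alpha (charf F0) (fun t => charf (f t)).

End Boltzmann.

Section Sobolev.
Context {R : realType}.

Definition fourier (g : R3 R -> R) (xi : R3 R) : R[i] :=
  (\int[lebesgue3]_v (g v * cos (dot3 v xi)))%R -i*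
  (\int[lebesgue3]_v (g v * sin (dot3 v xi)))%R.

(* H^k(R^3), on integrable functions, whose Fourier transform is the
   integral above; densities of probability measures are integrable. *)
Definition sobolev (k : nat) : set (R3 R -> R) :=
  [set g : R3 R -> R | [/\ lebesgue3.-integrable setT (EFin \o g),
     (\int[lebesgue3]_v (g v ^+ 2)%:E < +oo)%E &
     (\int[lebesgue3]_xi ((1 + norm3 xi ^+ 2) ^+ k *
        ComplexField.Normc.normc (fourier g xi) ^+ 2)%:E < +oo)%E]].

Definition is_density (F : probability (R3 R) R) (g : R3 R -> R) : Prop :=
  [/\ measurable_fun setT g, forall v, 0 <= g v &
      forall A, measurable A -> F A = (\int[lebesgue3]_(v in A) (g v)%:E)%E].

Definition in_Hoo (F : probability (R3 R) R) : Prop :=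
  exists2 g, is_density F g & forall k, sobolev k g.

End Sobolev.

(* Main.v *)
(* The squared modulus q(t,xi) of the characteristic function satisfies, by
   AM-GM, the differential inequality
     dq/dt <= lim_(eps -> 0) J_eps (q(xi^+) q(xi^-) - q(xi)),
   where J_eps is the truncated angular integral, and a maximum principle on
   compact sets of (t,xi) can be applied to it because
   |xi^+|, |xi^-| <= |xi|.

   Lower barrier. As F0 is not a Dirac mass, 1 - q(0,xi) >= Q(xi)/4 near 0 for
   a nonzero positive semidefinite form Q. The angular average of Q(xi^+)
   contains a multiple of |xi|^2 tr Q, so Q spreads instantly to all
   directions: 1 - q(t,xi) >= c(t) |xi|^2 near 0 with c(t) > 0 for every t > 0.

   Upper barrier. This lower bound and the singularity theta^(-2-2s) give
   J_eps (1 - q(xi^-)) >= c |xi|^(2s) for large |xi|, which beats the growth of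
   N ln |xi|; hence q(t,xi) <= (R/|xi|)^(N(t - t0)) for large |xi|, for any N.

   Inversion. q decays faster than any power, so convolving f(t) with the
   Poisson kernel prod_i e / (e^2 + v_i^2) and letting e -> 0 shows that f(t)
   has a bounded density with Fourier transform of rapid decay. *)
From HB Require Import structures.
Require Import Defs.
From mathcomp Require Import all_boot all_order all_algebra.
From mathcomp Require Import complex.
From mathcomp Require Import all_classical all_reals all_analysis.
From mathcomp Require Import measurable_realfun ring lra.

Set Implicit Arguments.
Unset Strict Implicit.
Unset Printing Implicit Defensive.

Import Order.TTheory GRing.Theory Num.Theory.
Import numFieldNormedType.Exports.

Local Open Scope classical_set_scope.
Local Open Scope ring_scope.

(** * Substitutions and weighted pushforwards *)

(** The squared modulus is the characteristic function of the difference v - w of two independent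
    variables of law [F], so 1 - q is the mean of 1 - cos((v - w).xi). Keeping only the pairs with
    |v - w| <= n bounds it below by a finite quadratic form, which vanishes for every n only if v =
    w almost surely, that is for a Dirac mass.

    Put u = (1 - cos theta)/2 = sin^2(theta/2). Then |xi^+|^2 = (1 - u)|xi|^2 and |xi^-|^2 =
    u|xi|^2. The angular measure integrates u uniformly in the cutoff, but not its square root when
    s >= 1/2. A nonradial barrier varies by order sqrt u between xi and xi^+; the lower barrier
    therefore needs the mean over four quarter turns about xi, which cancels that order. The upper
    barrier is radial and varies by order u only.

    In the upper barrier the ring theta ~ r0/|xi| puts xi^- in the ball where the lower barrier
    applies. The exponent starts from 0 at t0, where the barrier is 1 and the bound is trivial. Only
    upper bounds on truncated integrals, uniform for small eps, are passed to the limit eps -> 0. *)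

Section WeightedPushforward.
Local Open Scope ereal_scope.
Context d1 d2 (T1 : measurableType d1) (T2 : measurableType d2) (R : realType).
Variables (m : {measure set T1 -> \bar R}) (w : T1 -> R) (u : T1 -> T2).
Hypotheses (mw : measurable_fun setT w) (w0 : forall x, (0 <= w x)%R)
  (mu : measurable_fun setT u).

(** The image under [u] of the measure with density [w]. The proofs are arguments so that the
    measure structure declared below can be recovered from the term itself. *)
Definition wpush of measurable_fun setT w & (forall x, (0 <= w x)%R) &
    measurable_fun setT u : set T2 -> \bar R :=
  fun A => \int[m]_x ((w x)%:E * (\1_A (u x))%:E).

Local Notation M := (wpush mw w0 mu).

Let wpush0 : M set0 = 0.
Proof. by rewrite /wpush integral0_eq// => x _; rewrite indic0 mule0. Qed.

Let wpush_ge0 A : 0 <= M A.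
Proof. by rewrite /wpush; apply: integral_ge0 => x _; rewrite mule_ge0 ?lee_fin. Qed.

Let mpart A : measurable A ->
  measurable_fun setT (fun x => (w x)%:E * (\1_A (u x))%:E).
Proof.
move=> mA; apply: emeasurable_funM; apply/measurable_EFinP => //.
exact: (measurableT_comp (measurable_indic mA)).
Qed.

Let wpush_sigma_additive : semi_sigma_additive M.
Proof.
move=> /= F mF tF mUF; rewrite /wpush.
rewrite (_ : \int[m]_x _ = \sum_(0 <= i <oo) M (F i)).
  by apply: is_cvg_ereal_nneg_natsum_cond => n _ _; exact: wpush_ge0.
rewrite -integral_nneseries//; last 2 first.
- by move=> n; exact: mpart.
- by move=> n x _; rewrite mule_ge0 ?lee_fin.
apply: eq_integral => x _; rewrite nneseriesZl//; congr (_ * _).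
exact: indic_bigcup.
Qed.

HB.instance Definition _ := isMeasure.Build _ _ _ M
  wpush0 wpush_ge0 wpush_sigma_additive.

Import HBNNSimple.

(** Simple functions reduce the formula to indicators, where it is the definition of [wpush];
    monotone convergence does the rest on both sides. *)
Lemma ge0_integral_wpush (g : T2 -> \bar R) :
  measurable_fun setT g -> (forall y, 0 <= g y) ->
  \int[M]_y g y = \int[m]_x ((w x)%:E * g (u x)).
Proof.
move=> mg g0; pose h := nnsfun_approx measurableT mg.
transitivity (limn (fun n => \int[M]_x (h n x)%:E)).
  rewrite -monotone_convergence//.
  - apply: eq_integral => y _; apply/esym/cvg_lim => //.
    exact: cvg_nnsfun_approx.
  - by move=> n; exact/measurable_EFinP/measurable_funP.
  - by move=> n y _; rewrite lee_fin.
  - by move=> y _ k n kn; rewrite lee_fin; exact/lefP/nd_nnsfun_approx.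
transitivity (limn (fun n => \int[m]_x ((w x)%:E * (h n (u x))%:E))).
  2:{ rewrite -monotone_convergence//.
  - apply: eq_integral => y _; apply/cvg_lim => //.
    by apply: cvgeZl => //; exact: cvg_nnsfun_approx.
  - move=> n; apply: emeasurable_funM; apply/measurable_EFinP => //.
    exact: measurableT_comp.
  - by move=> n y _; rewrite mule_ge0 ?lee_fin.
  - move=> y _ k n kn; rewrite lee_wpmul2l ?lee_fin//.
    exact/lefP/nd_nnsfun_approx. }
apply/congr_lim/funext => n.
transitivity (\int[M]_x
   (\sum_(y \in range (h n)) (y * \1_(h n @^-1` [set y]) x)%:E)).
  by apply: eq_integral => t tE; rewrite /= fimfunE -fsumEFin.
rewrite ge0_integral_fsum//; last 2 first.
- by move=> r; exact/measurable_EFinP/measurable_funM.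
- by move=> r y _; rewrite nnfun_muleindic_ge0.
transitivity (\int[m]_x (\sum_(y \in range (h n))
    ((w x)%:E * (y * \1_(h n @^-1` [set y]) (u x))%:E))).
  rewrite ge0_integral_fsum//; last 2 first.
  - move=> r; apply: emeasurable_funM; apply/measurable_EFinP => //.
    by apply: measurable_funM => //; exact: (measurableT_comp (measurable_indic _)).
  - by move=> r y _; rewrite mule_ge0 ?lee_fin// -lee_fin nnfun_muleindic_ge0.
  apply: eq_fsbigr => r /[!inE] -[t _ <-].
  rewrite integralZl_indic_nnsfun// integral_indic// setIT.
  rewrite [RHS](_ : _ = \int[m]_x ((h n t)%:E *
     ((w x)%:E * (\1_(h n @^-1` [set h n t]) (u x))%:E))); last first.
    by apply: eq_integral => x _; rewrite EFinM muleCA.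
  rewrite ge0_integralZl ?lee_fin//.
  - exact: mpart.
  - by move=> x _; rewrite mule_ge0 ?lee_fin.
apply: eq_integral => x _.
rewrite -ge0_mule_fsumr; last first.
  by move=> r; exact: nnfun_muleindic_ge0.
by rewrite fsumEFin// -fimfunE.
Qed.

End WeightedPushforward.

Section MeasureUniqueness.
Local Open Scope ereal_scope.

(** Rectangles form a pi-system that generates the product sigma-algebra. *)
Lemma measure_rect_unique d1 d2 (T1 : measurableType d1)
    (T2 : measurableType d2) (R : realType)
    (m1 m2 : {measure set (T1 * T2)%type -> \bar R}) :
  m1 setT < +oo ->
  (forall A B, measurable A -> measurable B ->
     m1 (A `*` B) = m2 (A `*` B)) ->
  forall X, measurable X -> m1 X = m2 X.
Proof.
move=> moo mE X mX.
pose C : set (set (T1 * T2)) :=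
  [set C | exists A, measurable A /\ exists B, measurable B /\ C = A `*` B].
apply: (measure_unique C (fun=> setT)) => //.
- rewrite measurable_prod_measurableType //; congr (<<s _ >>).
  rewrite predeqE => Y; split => [[A mA [B mB <-]]|[A [mA [B [mB ->]]]]].
    by exists A; split => //; exists B.
  by exists A => //; exists B.
- move=> /= _ _ [X1 [mX1 [X2 [mX2 ->]]]] [Y1 [mY1 [Y2 [mY2 ->]]]].
  rewrite -setXI; exists (X1 `&` Y1); split; first exact: measurableI.
  by exists (X2 `&` Y2); split => //; exact: measurableI.
- by move=> n; exists setT; split => //; exists setT; split => //; rewrite setXTT.
- by rewrite bigcup_const.
- by move=> Y [A [mA [B [mB ->]]]]; exact: mE.
Qed.

(** Open rays are stable under intersection and generate the Borel sets, and the rays up to n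
    exhaust the line. *)
Lemma measure_ray_unique (R : realType)
    (m1 m2 : {measure set (measurableTypeR R) -> \bar R}) :
  m1 setT < +oo ->
  (forall b : R, m1 `]-oo, b[%classic = m2 `]-oo, b[%classic) ->
  forall A, measurable A -> m1 A = m2 A.
Proof.
move=> moo mE A mA.
apply: (@measure_unique _ R (measurableTypeR R) (@RGenInftyO.G R)
  (fun n => `]-oo, n%:R[%classic)) => //.
- exact: RGenInftyO.measurableE.
- move=> _ _ [x ->] [y ->]; exists (Num.min x y).
  by apply/seteqP; split => z /=; rewrite !in_itv/= lt_min => /andP.
- by move=> n; exists n%:R.
- rewrite -subTset => x _; exists (Num.truncn `|x|).+1 => //=.
  by rewrite in_itv/=; have := truncnS_gt `|x|; rewrite ltr_norml => /andP[].
- by move=> _ [b ->].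
- move=> n; rewrite (le_lt_trans _ moo)//; apply: le_measure => //; rewrite inE//.
Qed.
End MeasureUniqueness.

Section CosSubstitution.
Context {R : realType}.
Notation TR := (measurableTypeR R).
Notation mu := (@lebesgue_measure R).

Lemma lebesgue_itv (a b : R) x y : a <= b ->
  @lebesgue_measure R [set` Interval (BSide x a) (BSide y b)] = (b - a)%:E.
Proof.
rewrite lebesgue_measure_itv/= lte_fin le_eqVlt => /predU1P[->|->//].
by rewrite ltxx subrr.
Qed.

Lemma FTC_sin (a b : R) : a <= b ->
  (\int[mu]_(x in `[a, b]) (sin x)%:E = (cos a - cos b)%:E)%E.
Proof.
rewrite le_eqVlt => /predU1P[->|ab].
  by rewrite set_itv1 integral_set1 subrr.
rewrite (@continuous_FTC2 _ sin (\- cos) a b ab).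
- by rewrite /= -EFinB; congr EFin; rewrite opprK addrC.
- apply: continuous_subspaceT => x; exact: continuous_sin.
- split => //.
  + apply: cvg_at_right_filter; apply: cvgN; exact: continuous_cos.
  + apply: cvg_at_left_filter; apply: cvgN; exact: continuous_cos.
- by move=> x _; rewrite derive1E deriveN// derive_val opprK.
Qed.

Lemma measurable_sinT : @measurable_fun _ _ TR TR setT (@sin R).
Proof. by apply: continuous_measurable_fun; exact: continuous_sin. Qed.

Lemma measurable_cosT : @measurable_fun _ _ TR TR setT (@cos R).
Proof. by apply: continuous_measurable_fun; exact: continuous_cos. Qed.

(** The substitution z = cos a for a merely measurable [h]: the image of sin a da on [0, pi] under
    cos and Lebesgue measure on [-1, 1] agree on rays, hence on all Borel sets. *)
Lemma ge0_integral_cos (h : TR -> \bar R) :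
  measurable_fun setT h -> (forall x, (0 <= h x)%E) ->
  (\int[mu]_(x in `[0%R, pi]) ((sin x)%:E * h (cos x)) =
   \int[mu]_(z in `[(-1)%R, 1%R]) h z)%E.
Proof.
move=> mh h0.
pose w1 (x : TR) := sin x * \1_(`[0, pi]%classic : set TR) x.
pose w2 (x : TR) := \1_(`[-1, 1]%classic : set TR) x : R.
have mw1 : measurable_fun setT w1.
  by apply: measurable_funM; [exact: measurable_sinT|exact: measurable_indic].
have mw2 : measurable_fun setT w2 by exact: measurable_indic.
have w10 x : 0 <= w1 x.
  rewrite /w1 indicE; case: (boolP (x \in _)); rewrite ?mulr0// mulr1 inE/= in_itv/=.
  exact: sin_ge0_pi.
have w20 x : 0 <= w2 x by rewrite /w2.
pose M1 := wpush mu mw1 w10 measurable_cosT.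
pose M2 := wpush mu mw2 w20 (@measurable_id _ TR setT).
have E1 (g : TR -> \bar R) : (\int[mu]_(x in `[0%R, pi]) ((sin x)%:E * g (cos x)) =
    \int[mu]_x ((w1 x)%:E * g (cos x)))%E.
  rewrite integral_mkcond; apply: eq_integral => x _.
  rewrite patchE /w1 indicE; case: ifP => _; first by rewrite mulr1.
  by rewrite mulr0 mul0e.
have E2 (g : TR -> \bar R) : (\int[mu]_(x in `[(-1)%R, 1%R]) g x =
    \int[mu]_x ((w2 x)%:E * g x))%E.
  rewrite integral_mkcond; apply: eq_integral => x _.
  by rewrite patchE /w2 indicE; case: ifP => _; rewrite ?mul1e ?mul0e.
rewrite E1 E2 -(ge0_integral_wpush mu mw1 w10 measurable_cosT)//.
rewrite -(ge0_integral_wpush mu mw2 w20 (@measurable_id _ TR setT) mh h0).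
have M1E A : M1 A = (\int[mu]_(x in `[0%R, pi]) ((sin x)%:E * (\1_A (cos x))%:E))%E.
  by rewrite (E1 (fun x => (\1_A x)%:E)).
have M2E A : M2 A = (\int[mu]_(x in `[(-1)%R, 1%R]) (\1_A x)%:E)%E.
  by rewrite (E2 (fun x => (\1_A x)%:E)).
have sin2 : (\int[mu]_(x in `[0%R, pi]) (sin x)%:E = 2%:E)%E.
  by rewrite FTC_sin ?pi_ge0// cos0 cospi opprK.
apply: eq_measure_integral => A mA _; apply: measure_ray_unique => //.
  change (M1 setT < +oo)%E; rewrite M1E.
  under eq_integral do rewrite indicT mule1.
  rewrite sin2; exact: ltry.
move=> b; change (M1 `]-oo, b[%classic = M2 `]-oo, b[%classic).
rewrite M1E M2E integral_indic//.
have [b1|b1] := leP b (-1).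
  rewrite integral0_eq; last first.
    move=> x _; rewrite indicE memNset ?mule0//= in_itv/= => /lt_le_trans/(_ b1).
    by rewrite ltNge cos_geN1.
  rewrite (_ : _ `&` _ = set0) ?measure0//; apply/seteqP; split => // x /=.
  rewrite !in_itv/= => -[xb /andP[x1 _]].
  by have := lt_le_trans xb b1; rewrite ltNge x1.
have [b2|b2] := ltP 1 b.
  under eq_integral => x _.
    rewrite indicE mem_set ?mule1; last first.
      by rewrite /= in_itv/= (le_lt_trans (cos_le1 _)).
    over.
  rewrite sin2 setIidr; last first.
    by move=> x /=; rewrite !in_itv/= => /andP[_ /le_lt_trans]; exact.
  rewrite [RHS](_ : _ = (1 - (-1))%:E); first by congr EFin; ring.
  by apply: lebesgue_itv; lra.
have bI : -1 <= b <= 1 by rewrite (ltW b1).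
have cb : cos (acos b) = b by rewrite acosK// in_itv.
have c0 := acos_ge0 bI; have cpi := acos_lepi bI.
have -> : (\int[mu]_(x in `[0%R, pi])
    ((sin x)%:E * (\1_(`]-oo, b[%classic : set TR) (cos x))%:E) =
  \int[mu]_(x in `[0%R, pi] `&` `]acos b, +oo[) (sin x)%:E)%E.
  rewrite integral_mkcondr; apply: eq_integral => x /[!inE]/= x0.
  rewrite patchE indicE.
  have -> : (cos x \in (`]-oo, b[%classic : set TR)) =
      (x \in (`]acos b, +oo[%classic : set TR)).
    have cx : (cos x < b) = (acos b < x) by rewrite -{1}cb ltr_cos// in_itv/= c0.
    by apply/idP/idP; rewrite !inE/= !in_itv/= andbT cx.
  by case: ifP => _; rewrite ?mule1 ?mule0.
rewrite (_ : _ `&` _ = `]acos b, pi]%classic); last first.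
  apply/seteqP; split => x /=; rewrite !in_itv/= andbT.
    by move=> [/andP[_ ->] ->].
  by move=> /andP[bx ->]; rewrite bx andbT (le_trans c0 (ltW bx)).
rewrite integral_itv_obnd_cbnd; last first.
  apply/measurable_EFinP; apply: measurable_funTS; exact: measurable_sinT.
rewrite FTC_sin// cb cospi opprK.
rewrite (_ : _ `&` _ = `[-1, b[%classic); last first.
  apply/seteqP; split => x /=; rewrite !in_itv/=.
    by move=> [-> /andP[-> _]].
  by move=> /andP[-> xb]; rewrite xb (ltW (lt_le_trans xb b2)).
rewrite [RHS](_ : _ = (b - (-1))%:E); first by congr EFin; ring.
by apply: lebesgue_itv; lra.
Qed.
End CosSubstitution.

Section Affine.
Context {R : realType}.
Notation TR := (measurableTypeR R).
Notation mu := (@lebesgue_measure R).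

Lemma measurable_affine (a b : R) :
  @measurable_fun _ _ TR TR setT (fun x => a * x + b).
Proof.
by apply: continuous_measurable_fun => x; apply: cvgD; [apply: cvgM|];
  (exact: cvg_cst || exact: cvg_id).
Qed.

(** Both sides integrate [h] against a measure, and the two measures agree on half-open intervals,
    which determine Lebesgue measure. *)
Lemma ge0_integral_affine (a b : R) (h : TR -> \bar R) : a != 0 ->
  measurable_fun setT h -> (forall x, (0 <= h x)%E) ->
  (\int[mu]_x ((`|a|)%:E * h (a * x + b)%R) = \int[mu]_x h x)%E.
Proof.
move=> a0 mh h0.
have mw : @measurable_fun _ _ TR R setT (fun=> `|a|) by [].
have w0 : forall x : TR, 0 <= `|a| by [].
rewrite -(ge0_integral_wpush mu mw w0 (measurable_affine a b))//.
apply: eq_measure_integral => A mA _.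
apply/esym/lebesgue_measure_unique => // _ [[c d] _ <-].
change (@lebesgue_measure R `]c, d]%classic =
  \int[mu]_x (`|a|%:E * (\1_(`]c, d]%classic : set TR) (a * x + b)%R)%:E))%E.
rewrite ge0_integralZl ?lee_fin//; last first.
  apply/measurable_EFinP.
  exact: (measurableT_comp (measurable_indic _) (measurable_affine a b)).
have [cd|dc] := leP c d; last first.
  rewrite set_itv_ge ?bnd_simp -?leNgt ?(ltW dc)// measure0.
  by rewrite integral0_eq ?mule0// => x _; rewrite indic0.
rewrite lebesgue_itv//.
(* A negative slope turns the half-open interval around, so its preimage is closed on the left. *)
pose I : set TR := if 0 < a then `](c - b) / a, (d - b) / a]%classic
  else `[(d - b) / a, (c - b) / a[%classic.
have mI : measurable I by rewrite /I; case: ifP => _.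
transitivity (`|a|%:E * \int[mu]_x (\1_I x)%:E)%E; last first.
  congr (_ * _)%E; apply: eq_integral => x _; congr EFin; rewrite !indicE.
  congr (_%:R); congr nat_of_bool.
  suff -> : (x \in I) = (c < a * x + b <= d) by apply/idP/idP; rewrite inE/= in_itv.
  rewrite /I; have [a_gt0|] := ltP 0 a.
    have -> : (c < a * x + b <= d) = ((c - b) / a < x <= (d - b) / a).
      by rewrite ltr_pdivrMr// ler_pdivlMr// ltrBlDr lerBrDr mulrC.
    by apply/idP/idP; rewrite inE/= in_itv.
  rewrite le_eqVlt (negPf a0)/= => a_lt0.
  have -> : (c < a * x + b <= d) = ((d - b) / a <= x < (c - b) / a).
    by rewrite andbC ler_ndivrMr// ltr_ndivlMr// ltrBlDr lerBrDr mulrC.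
  by apply/idP/idP; rewrite inE/= in_itv.
rewrite integral_indic// setIT /I; have [a_gt0|] := ltP 0 a.
  rewrite [X in (_ * X)%E](_ : _ = ((d - b) / a - (c - b) / a)%:E); last first.
    by apply: lebesgue_itv; rewrite ler_pM2r ?invr_gt0// lerD2r.
  by rewrite gtr0_norm// -EFinM; congr EFin; field.
rewrite le_eqVlt (negPf a0)/= => a_lt0.
rewrite [X in (_ * X)%E](_ : _ = ((c - b) / a - (d - b) / a)%:E); last first.
  by apply: lebesgue_itv; rewrite ler_nM2r ?invr_lt0// lerD2r.
by rewrite ltr0_norm// -EFinM; congr EFin; field.
Qed.

Lemma ge0_integral_itv_affine (a b c d : R) (h : TR -> \bar R) : 0 < a ->
  measurable_fun setT h -> (forall x, (0 <= h x)%E) ->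
  (\int[mu]_(x in `[c, d]) ((a)%:E * h (a * x + b)%R) =
   \int[mu]_(x in `[(a * c + b)%R, (a * d + b)%R]) h x)%E.
Proof.
move=> a0 mh h0; rewrite integral_mkcond [RHS]integral_mkcond.
rewrite -[RHS](@ge0_integral_affine a b) ?gt_eqF//; last 2 first.
- exact/(measurable_restrictT _ _).1/measurable_funTS.
- by move=> x; rewrite patchE; case: ifP.
apply: eq_integral => x _; rewrite !patchE (gtr0_norm a0).
rewrite (_ : (x \in `[c, d]%classic) =
  (a * x + b \in (`[a * c + b, a * d + b]%classic : set R))); last first.
  by apply/idP/idP; rewrite !inE/= !in_itv/= !lerD2r !ler_pM2l.
by case: ifP => //; rewrite mule0.
Qed.

Lemma ge0_integral_itv_opp (c d : R) (h : TR -> \bar R) :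
  measurable_fun setT h -> (forall x, (0 <= h x)%E) ->
  (\int[mu]_(x in `[c, d]) h (- x)%R =
   \int[mu]_(x in `[(- d)%R, (- c)%R]) h x)%E.
Proof.
move=> mh h0; rewrite integral_mkcond [RHS]integral_mkcond.
rewrite -[RHS](@ge0_integral_affine (-1) 0) ?oppr_eq0//; last 2 first.
- exact/(measurable_restrictT _ _).1/measurable_funTS.
- by move=> x; rewrite patchE; case: ifP.
apply: eq_integral => x _; rewrite !patchE normrN1 mul1e addr0 mulN1r.
rewrite (_ : (x \in `[c, d]%classic) =
  (- x \in (`[- d, - c]%classic : set R))); last first.
  by apply/idP/idP; rewrite !inE/= !in_itv/= !lerN2 andbC.
by case: ifP.
Qed.

Lemma ge0_integral_itv_split (c d e : R) (h : TR -> \bar R) : c <= d <= e ->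
  measurable_fun setT h -> (forall x, (0 <= h x)%E) ->
  (\int[mu]_(x in `[c, e]) h x =
   \int[mu]_(x in `[c, d]) h x + \int[mu]_(x in `[d, e]) h x)%E.
Proof.
move=> /andP[cd de] mh h0.
rewrite -(integral_itv_obnd_cbnd (r := d)); last exact: measurable_funTS.
rewrite -ge0_integral_setU//=.
- congr (integral _ _ _); apply/seteqP; split => x /=; rewrite !in_itv/=.
    move=> /andP[cx xe]; have [xd|xd] := leP x d; [left|right]; lra.
  by move=> [/andP[? ?]|/andP[? ?]]; lra.
- exact: measurable_funTS.
- apply/disj_set2P; apply/seteqP; split => // x /=; rewrite !in_itv/=.
  by move=> [/andP[_ ?] /andP[? _]]; lra.
Qed.

(** The shifted interval [c, T + c] is cut at T and its last piece is moved back by one period. *)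
Lemma ge0_integral_periodic (T c : R) (h : TR -> \bar R) : 0 <= c <= T ->
  measurable_fun setT h -> (forall x, (0 <= h x)%E) ->
  (forall x, h (x + T) = h x) ->
  (\int[mu]_(x in `[0%R, T]) h (x + c)%R =
   \int[mu]_(x in `[0%R, T]) h x)%E.
Proof.
move=> /andP[c0 cT] mh h0 hT.
have shift (u v w : R) : (\int[mu]_(x in `[u, v]) h (x + w)%R =
    \int[mu]_(x in `[(u + w)%R, (v + w)%R]) h x)%E.
  have := @ge0_integral_itv_affine 1 w u v h ltr01 mh h0.
  by under eq_integral do rewrite mul1e mul1r; rewrite !mul1r.
rewrite shift add0r (@ge0_integral_itv_split c T (T + c))//; last by rewrite cT/=; lra.
rewrite (@ge0_integral_itv_split 0 c T) ?c0// addeC; congr (_ + _)%E.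
rewrite -{1}(add0r T) (addrC T c) -shift.
by apply: eq_integral => x _; rewrite hT.
Qed.

End Affine.

(** * Rotation invariance of the surface measure of the sphere *)

Section SphereMeasure.
Context {R : realType}.
Notation TR := (measurableTypeR R).
Notation mu := (@lebesgue_measure R).
Implicit Types g : R3 R -> \bar R.

Definition sph_weight (p : TR * TR) : R :=
  \1_(`[0, pi]%classic : set TR) p.1 * \1_(`[0, 2 * pi]%classic : set TR) p.2 *
  sin p.1.

Lemma sph_weight_ge0 p : 0 <= sph_weight p.
Proof.
rewrite /sph_weight !indicE; case: (boolP (p.1 \in _)); last by rewrite !mul0r.
rewrite inE/= in_itv/= => /sin_ge0_pi s0; by rewrite !mulr_ge0.
Qed.

Lemma measurable_sph_weight : measurable_fun setT sph_weight.
Proof.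
apply: measurable_funM; first apply: measurable_funM.
- exact: (measurableT_comp (measurable_indic _) measurable_fst).
- exact: (measurableT_comp (measurable_indic _) measurable_snd).
- exact: (measurableT_comp measurable_sinT measurable_fst).
Qed.

Lemma measurable_sph : measurable_fun setT (@sph R).
Proof.
apply: measurable_fun_pair; first apply: measurable_fun_pair.
- apply: (@measurable_funM _ _ R).
    exact: (measurableT_comp measurable_sinT measurable_fst).
  exact: (measurableT_comp measurable_cosT measurable_snd).
- apply: (@measurable_funM _ _ R).
    exact: (measurableT_comp measurable_sinT measurable_fst).
  exact: (measurableT_comp measurable_sinT measurable_snd).
- exact: (measurableT_comp measurable_cosT measurable_fst).
Qed.

(** The surface measure is placed on the ambient space, so that maps of that space, such as
    rotations, act on it by substitution. *)
Definition sphere_measure : {measure set (R3 R) -> \bar R} :=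
  wpush (mu \x mu)%E measurable_sph_weight sph_weight_ge0 measurable_sph.

Local Notation sg := sphere_measure.

Lemma ge0_integral_sphere_polar g :
  measurable_fun setT g -> (forall x, (0 <= g x)%E) ->
  (\int[sg]_x g x = \int[mu]_(a in `[0%R, pi]) ((sin a)%:E *
     \int[mu]_(c in `[0%R, (2 * pi)%R]) g (sph (a, c))))%E.
Proof.
move=> mg g0; rewrite /sphere_measure ge0_integral_wpush//.
rewrite (@fubini_tonelli1 _ _ _ _ _ mu mu); last 2 first.
- apply: emeasurable_funM; first by apply/measurable_EFinP; exact: measurable_sph_weight.
  exact: (measurableT_comp mg measurable_sph).
- by move=> x; rewrite mule_ge0 ?lee_fin ?sph_weight_ge0.
rewrite [RHS]integral_mkcond; apply: eq_integral => a _.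
rewrite /fubini_F patchE; case: ifPn => aI; last first.
  by rewrite integral0_eq// => c _; rewrite /sph_weight/= indicE (negPf aI) !mul0r mul0e.
rewrite [in RHS]integral_mkcond -ge0_integralZl//; last 3 first.
- apply/(measurable_restrictT _ _).1 => //; apply: measurable_funTS.
  apply: (measurableT_comp mg); apply: (measurableT_comp measurable_sph).
  exact: pair1_measurable.
- by move=> x _; rewrite patchE; case: ifP.
- by move: aI; rewrite inE/= in_itv/= lee_fin; exact: sin_ge0_pi.
apply: eq_integral => c _; rewrite patchE /sph_weight/= !indicE aI mul1r.
by case: ifP; rewrite ?mul1r// mul0r mul0e mule0.
Qed.

(** Cylindrical coordinates. By Archimedes' theorem the surface measure is dz dc in them, and
    rotations about the third axis become shifts of c. *)
Definition cyl (z c : R) : R3 R :=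
  (Num.sqrt (1 - z ^+ 2) * cos c, Num.sqrt (1 - z ^+ 2) * sin c, z).

Lemma measurable_sqrtT : @measurable_fun _ _ TR TR setT (@Num.sqrt R).
Proof. by apply: continuous_measurable_fun; exact: sqrt_continuous. Qed.

Lemma measurable_cyl : measurable_fun setT (fun p : TR * TR => cyl p.1 p.2).
Proof.
have mr : measurable_fun setT (fun p : TR * TR => Num.sqrt (1 - p.1 ^+ 2) : R).
  apply: (measurableT_comp measurable_sqrtT).
  by apply: measurable_funB => //; exact: measurable_funX measurable_fst.
apply: measurable_fun_pair => //; apply: measurable_fun_pair;
  apply: (@measurable_funM _ _ R) => //.
- exact: (measurableT_comp measurable_cosT measurable_snd).
- exact: (measurableT_comp measurable_sinT measurable_snd).
Qed.

Lemma measurable_fun_cyl_integral g :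
  measurable_fun setT g -> (forall x, (0 <= g x)%E) ->
  measurable_fun setT (fun z : TR =>
    \int[mu]_(c in `[0%R, (2 * pi)%R]) g (cyl z c))%E.
Proof.
move=> mg g0.
under eq_fun do rewrite integral_mkcond.
  apply: (@measurable_fun_fubini_tonelli_F _ _ TR TR R mu (fun p =>
     ((fun c => g (cyl p.1 c)) \_ `[0%R, (2 * pi)%R]%classic) p.2)).
  + rewrite [X in measurable_fun _ X](_ : _ = (fun p => g (cyl p.1 p.2))
        \_ (setT `*` `[0%R, (2 * pi)%R]%classic)); last first.
      apply/funext => -[z c]; rewrite !patchE/=.
      rewrite (_ : (_ \in setT `*` _) = (c \in (`[0, 2 * pi]%classic : set R)))//.
      by apply/idP/idP; rewrite !inE//= => -[].
    apply/(measurable_restrictT _ _).1; first exact: measurableX.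
    by apply: measurable_funTS; exact: measurableT_comp mg measurable_cyl.
  + by move=> [z c]; rewrite patchE; case: ifP.
Qed.

Lemma ge0_integral_sphere_cyl g :
  measurable_fun setT g -> (forall x, (0 <= g x)%E) ->
  (\int[sg]_x g x = \int[mu]_(z in `[(-1)%R, 1%R])
     \int[mu]_(c in `[0%R, (2 * pi)%R]) g (cyl z c))%E.
Proof.
move=> mg g0; rewrite ge0_integral_sphere_polar//.
rewrite -ge0_integral_cos; last 2 first.
- exact: measurable_fun_cyl_integral.
- by move=> z; exact: integral_ge0.
apply: eq_integral => a /[!inE]/=; rewrite in_itv/= => aI.
congr (_ * _)%E; apply: eq_integral => c _; congr g.
by rewrite /sph /cyl/= -sin2cos2 ?sqrtr_sqr ger0_norm ?sin_ge0_pi.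
Qed.
End SphereMeasure.

Section SphereInvariance.
Context {R : realType}.
Notation TR := (measurableTypeR R).
Notation mu := (@lebesgue_measure R).
Notation sg := (@sphere_measure R).
Implicit Types g : R3 R -> \bar R.

Lemma measurable_triple d (T : measurableType d) (f1 f2 f3 : T -> R) :
  measurable_fun setT f1 -> measurable_fun setT f2 -> measurable_fun setT f3 ->
  @measurable_fun _ _ T (R3 R) setT (fun x => (f1 x, f2 x, f3 x)).
Proof.
by move=> m1 m2 m3; apply: measurable_fun_pair => //; exact: measurable_fun_pair.
Qed.

Lemma measurable_c1 : @measurable_fun _ _ (R3 R) R setT (fun x => x.1.1).
Proof. exact: (measurableT_comp measurable_fst measurable_fst). Qed.

Lemma measurable_c2 : @measurable_fun _ _ (R3 R) R setT (fun x => x.1.2).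
Proof. exact: (measurableT_comp measurable_snd measurable_fst). Qed.

Lemma measurable_c3 : @measurable_fun _ _ (R3 R) R setT (fun x => x.2).
Proof. exact: measurable_snd. Qed.

(** Rotations about the third axis and the exchange of the first and third coordinates are enough:
    by Euler angles they compose to a rotation that takes the third axis to any given unit
    vector. *)
Definition rotz (c : R) (x : R3 R) : R3 R :=
  (x.1.1 * cos c - x.1.2 * sin c, x.1.1 * sin c + x.1.2 * cos c, x.2).

Definition swap13 (x : R3 R) : R3 R := (x.2, x.1.2, x.1.1).

Lemma measurable_rotz c : measurable_fun setT (rotz c).
Proof.
apply: measurable_triple; last exact: measurable_c3.
  by apply: measurable_funB; apply: measurable_funM => //;
    [exact: measurable_c1|exact: measurable_c2].
by apply: measurable_funD; apply: measurable_funM => //;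
  [exact: measurable_c1|exact: measurable_c2].
Qed.

Lemma measurable_swap13 : measurable_fun setT swap13.
Proof.
apply: measurable_triple; [exact: measurable_c3|exact: measurable_c2|].
exact: measurable_c1.
Qed.

Lemma rotz_cyl c z a : rotz c (cyl z a) = cyl z (a + c).
Proof. by rewrite /rotz /cyl/= cosD sinD; congr (_, _, _); ring. Qed.

Lemma ge0_integral_sphere_rotz c g : 0 <= c <= 2 * pi ->
  measurable_fun setT g -> (forall x, (0 <= g x)%E) ->
  (\int[sg]_x g (rotz c x) = \int[sg]_x g x)%E.
Proof.
move=> c2 mg g0.
have mgr : measurable_fun setT (fun x => g (rotz c x)).
  exact: (measurableT_comp mg (measurable_rotz c)).
rewrite (ge0_integral_sphere_cyl mg g0) (ge0_integral_sphere_cyl mgr (fun x => g0 (rotz c x))).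
apply: eq_integral => z _.
under eq_integral do rewrite rotz_cyl.
apply: (@ge0_integral_periodic R (2 * pi) c (fun a => g (cyl z a))) => //.
- apply: (measurableT_comp mg).
  exact: (measurable_fun_pair2 (f := fun p : TR * TR => cyl p.1 p.2) z measurable_cyl).
- by move=> x; rewrite /cyl mulr_natl sinD2pi cosD2pi.
Qed.

(** The sphere is a double graph over the plane of the first and third coordinates, with density
    [kgraph]. This chart treats the two coordinates alike, which gives the invariance under
    [swap13]. *)
Definition height (x z : R) : R := Num.sqrt (1 - x ^+ 2 - z ^+ 2).

Definition graph g (x z : R) : \bar R :=
  (g (x, height x z, z)%R + g (x, (- height x z)%R, z)%R)%E.

Definition kgraph (x z : R) : R := (height x z)^-1.

Lemma measurable_height : @measurable_fun _ _ (TR * TR)%type TR setT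
  (fun p => height p.1 p.2).
Proof.
apply: (measurableT_comp measurable_sqrtT).
apply: measurable_funB; last exact: measurable_funX measurable_snd.
by apply: measurable_funB => //; exact: measurable_funX measurable_fst.
Qed.

Lemma measurable_graph g : measurable_fun setT g ->
  measurable_fun setT (fun p : TR * TR => graph g p.1 p.2).
Proof.
move=> mg; apply: emeasurable_funD; apply: (measurableT_comp mg);
  apply: measurable_triple => //; try exact: measurable_height.
exact: (measurableT_comp (@oppr_measurable R setT) measurable_height).
Qed.

Lemma measurable_kgraph : measurable_fun setT (fun p : TR * TR => kgraph p.1 p.2).
Proof.
rewrite /kgraph; under eq_fun do rewrite -powR_inv1 ?sqrtr_ge0//.
exact: (measurableT_comp (measurable_powR _) measurable_height).
Qed.

Lemma half_circle (r z : R) g : 0 < r -> r ^+ 2 = 1 - z ^+ 2 ->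
  measurable_fun setT g -> (forall x, (0 <= g x)%E) ->
  (\int[mu]_(c in `[0%R, (2 * pi)%R]) g (r * cos c, r * sin c, z)%R =
   \int[mu]_(c in `[0%R, pi]) graph g (r * cos c) z)%E.
Proof.
move=> r0 rz mg g0; pose P (c : TR) := g (r * cos c, r * sin c, z).
have mP : measurable_fun setT P.
  apply: (measurableT_comp mg); apply: measurable_triple => //.
    by apply: measurable_funM => //; exact: measurable_cosT.
  by apply: measurable_funM => //; exact: measurable_sinT.
have P0 c : (0 <= P c)%E by exact: g0.
have PT c : P (c + 2 * pi) = P c by rewrite /P mulr_natl sinD2pi cosD2pi.
have pi0 := pi_gt0 R.
(* The period is moved to [-pi, pi]; reflection then pairs each angle with its opposite, that is,
   the two points of the circle over the same abscissa. *)
rewrite -(@ge0_integral_periodic R (2 * pi) pi P)//; last by lra.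
have := @ge0_integral_itv_affine R 1 (- pi) 0 (2 * pi) P ltr01 mP P0.
under eq_integral => x _.
  rewrite mul1e mul1r -PT (_ : x - pi + 2 * pi = x + pi); last by lra.
  over.
rewrite mulr0 add0r mul1r => ->.
rewrite (_ : 2 * pi - pi = pi); last by lra.
rewrite (@ge0_integral_itv_split _ _ 0)//; last by lra.
rewrite -[in X in (X + _)%E]oppr0 -(@ge0_integral_itv_opp R 0 pi P)//.
rewrite -ge0_integralD//=; last 2 first.
- by apply: measurable_funTS; apply: measurableT_comp => //; exact: oppr_measurable.
- exact: measurable_funTS.
apply: eq_integral => c /[!inE]/=; rewrite in_itv/= => cI.
rewrite /P /graph cosN sinN addeC mulrN.
suff -> : height (r * cos c) z = r * sin c by [].
rewrite /height (_ : 1 - _ - _ = (r * sin c) ^+ 2); last first.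
  by rewrite !exprMn sin2cos2 rz; ring.
by rewrite sqrtr_sqr ger0_norm// mulr_ge0 ?sin_ge0_pi// ltW.
Qed.

Lemma measurable_invr : @measurable_fun _ _ TR TR setT (@GRing.inv R).
Proof.
(* The formula x |x|^(-2) also reproduces the default value 0 of the inverse at 0. *)
rewrite (_ : @GRing.inv R = fun x => x * `|x| `^ (- 2)); last first.
  apply/funext => x; have [->|x0] := eqVneq x 0; first by rewrite invr0 mul0r.
  rewrite powRN -[2]/(2%:R) powR_mulrn// -normrX ger0_norm ?sqr_ge0//.
  by rewrite expr2 invfM mulrA divff// mul1r.
apply: measurable_funM => //.
exact: (measurableT_comp (measurable_powR _) (@normr_measurable R setT)).
Qed.

End SphereInvariance.

Section SphereSwap.
Context {R : realType}.
Notation TR := (measurableTypeR R).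
Notation mu := (@lebesgue_measure R).
Notation sg := (@sphere_measure R).
Implicit Types g : R3 R -> \bar R.

Lemma ge0_integral_half_circle (r : R) (G : TR -> \bar R) : 0 < r ->
  measurable_fun setT G -> (forall x, (0 <= G x)%E) ->
  (\int[mu]_(c in `[0%R, pi]) G (r * cos c)%R =
   \int[mu]_x (((Num.sqrt (r ^+ 2 - x ^+ 2))^-1)%:E * G x))%E.
Proof.
move=> r0 mG G0.
pose h (x : TR) := (((Num.sqrt (1 - x ^+ 2))^-1)%:E * G (r * x)%R)%E.
have mGr : measurable_fun setT (fun x : TR => G (r * x)).
  apply: (measurableT_comp mG); exact: measurable_funM.
have mh : measurable_fun setT h.
  apply: emeasurable_funM => //; apply/measurable_EFinP.
  apply: (measurableT_comp measurable_invr); apply: (measurableT_comp measurable_sqrtT).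
  by apply: measurable_funB => //; exact: measurable_funX.
have h0 x : (0 <= h x)%E by rewrite mule_ge0 ?lee_fin ?invr_ge0 ?sqrtr_ge0.
transitivity (\int[mu]_(c in `[0%R, pi]) ((sin c)%:E * h (cos c)))%E.
  (* The end points are dropped because sin c is inverted below. *)
  rewrite integral_itv_bndoo; last first.
    apply: measurable_funTS; apply: (measurableT_comp mG).
    by apply: measurable_funM => //; exact: measurable_cosT.
  rewrite [RHS]integral_itv_bndoo; last first.
    apply: measurable_funTS; apply: emeasurable_funM.
      by apply/measurable_EFinP; exact: measurable_sinT.
    exact: (measurableT_comp mh measurable_cosT).
  apply: eq_integral => c /[!inE]/=; rewrite in_itv/= => cI.
  have s0 := sin_gt0_pi cI.
  rewrite /h -sin2cos2 sqrtr_sqr gtr0_norm// muleA -EFinM divff ?mul1e//.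
  by rewrite gt_eqF.
rewrite (ge0_integral_cos mh h0) integral_mkcond -[RHS](@ge0_integral_affine _ r 0) ?gt_eqF//.
- apply: eq_integral => x _; rewrite patchE /h addr0 muleA -EFinM.
  rewrite (_ : r ^+ 2 - (r * x) ^+ 2 = r ^+ 2 * (1 - x ^+ 2)); last by ring.
  rewrite sqrtrM ?sqr_ge0// sqrtr_sqr gtr0_norm// invfM mulrA divff ?gt_eqF// mul1r.
  (* Outside the disc the square root of a negative number is 0 and so is its inverse; the integrand
     vanishes there, and the integral may run over the whole line. *)
  case: ifPn => // /negP xI; rewrite ler0_sqrtr ?invr0 ?mul0e//.
  rewrite subr_le0 leNgt; apply/negP => x1; apply: xI; rewrite inE/= in_itv/=.
  by rewrite -ler_norml -(@ler_pXn2r _ 2) ?nnegrE// expr1n real_normK ?num_real// ltW.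
- apply: emeasurable_funM => //; apply/measurable_EFinP.
  apply: (measurableT_comp measurable_invr); apply: (measurableT_comp measurable_sqrtT).
  by apply: measurable_funB => //; exact: measurable_funX.
- by move=> x; rewrite mule_ge0 ?lee_fin ?invr_ge0 ?sqrtr_ge0.
Qed.

Lemma ge0_integral_sphere_graph g :
  measurable_fun setT g -> (forall x, (0 <= g x)%E) ->
  (\int[sg]_x g x = \int[mu]_z \int[mu]_x ((kgraph x z)%:E * graph g x z))%E.
Proof.
move=> mg g0; rewrite (ge0_integral_sphere_cyl mg g0).
rewrite integral_itv_bndoo; last first.
  by apply: measurable_funTS; exact: measurable_fun_cyl_integral.
rewrite integral_mkcond; apply: eq_integral => z _.
rewrite patchE; case: ifPn => [|/negP zI].
  rewrite inE/= in_itv/= => zI.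
  have z1 : 0 < 1 - z ^+ 2.
    have := ltr_norml z 1; rewrite zI subr_gt0 => z1.
    by rewrite -(expr1n R 2) -[X in X < _]real_normK ?num_real// ltrXn2r ?nnegrE//.
  have r0 : 0 < Num.sqrt (1 - z ^+ 2) by rewrite sqrtr_gt0.
  have rz : Num.sqrt (1 - z ^+ 2) ^+ 2 = 1 - z ^+ 2 by rewrite sqr_sqrtr// ltW.
  rewrite (half_circle r0 rz mg g0).
  rewrite (@ge0_integral_half_circle _ (graph g ^~ z) r0); last 2 first.
  - exact: (measurable_fun_pair1 (f := fun p : TR * TR => graph g p.1 p.2) z
      (measurable_graph mg)).
  - by move=> x; rewrite /graph adde_ge0.
  by apply: eq_integral => x _; rewrite rz /kgraph /height addrAC.
rewrite integral0_eq// => x _.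
rewrite /kgraph /height ler0_sqrtr ?invr0 ?mul0e//.
rewrite leNgt; apply/negP => x1; apply: zI; rewrite inE/= in_itv/= -ltr_norml.
rewrite -(@ltr_pXn2r _ 2) ?nnegrE// expr1n real_normK ?num_real//.
by have := sqr_ge0 x; lra.
Qed.

Lemma heightC (x z : R) : height x z = height z x.
Proof. by rewrite /height addrAC. Qed.

Lemma graph_swap13 g (x z : R) : graph (g \o swap13) x z = graph g z x.
Proof. by rewrite /graph /swap13/= heightC. Qed.

(** In the chart [graph], exchanging the two coordinates is exchanging the order of integration. *)
Lemma ge0_integral_sphere_swap13 g :
  measurable_fun setT g -> (forall x, (0 <= g x)%E) ->
  (\int[sg]_x g (swap13 x) = \int[sg]_x g x)%E.
Proof.
move=> mg g0.
have mg' : measurable_fun setT (g \o swap13).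
  exact: (measurableT_comp mg measurable_swap13).
rewrite (ge0_integral_sphere_graph mg g0).
rewrite (ge0_integral_sphere_graph mg' (fun x => g0 (swap13 x))).
have mkg : measurable_fun setT
    (fun p : TR * TR => (kgraph p.1 p.2)%:E * graph g p.1 p.2)%E.
  apply: emeasurable_funM; last exact: measurable_graph.
  by apply/measurable_EFinP; exact: measurable_kgraph.
have kg0 (p : TR * TR) : (0 <= (kgraph p.1 p.2)%:E * graph g p.1 p.2)%E.
  by rewrite mule_ge0 ?lee_fin ?invr_ge0 ?sqrtr_ge0// /graph adde_ge0.
rewrite -[RHS](@fubini_tonelli _ _ TR TR R mu mu _ mkg kg0).
apply: eq_integral => z _; apply: eq_integral => x _.
by rewrite graph_swap13 /kgraph heightC.
Qed.
End SphereSwap.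

Section SignedPushforward.
Local Open Scope ereal_scope.
Context d1 d2 (T1 : measurableType d1) (T2 : measurableType d2) (R : realType).
Variables (m : {measure set T1 -> \bar R}) (w : T1 -> R) (u : T1 -> T2).
Hypotheses (mw : measurable_fun setT w) (w0 : forall x, (0 <= w x)%R)
  (mu : measurable_fun setT u).

Lemma integral_wpush (g : T2 -> \bar R) : measurable_fun setT g ->
  \int[wpush m mw w0 mu]_y g y = \int[m]_x ((w x)%:E * g (u x)).
Proof.
move=> mg; rewrite [LHS]integralE [RHS]integralE; congr (_ - _).
- rewrite ge0_integral_wpush//; last exact: measurable_funepos.
  apply: eq_integral => x _; rewrite funeposE [RHS]funeposE.
  by rewrite maxe_pMr ?lee_fin// mule0.
- rewrite ge0_integral_wpush//; last exact: measurable_funeneg.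
  apply: eq_integral => x _; rewrite funenegE [RHS]funenegE.
  by rewrite -muleN maxe_pMr ?lee_fin// mule0.
Qed.
End SignedPushforward.

Section Frames.
Context {R : realType}.
Notation sg := (@sphere_measure R).
Implicit Types x e : R3 R.

Definition frame (e1 e2 e3 : R3 R) x : R3 R :=
  scale3 x.1.1 e1 + scale3 x.1.2 e2 + scale3 x.2 e3.

Lemma measurable_frame e1 e2 e3 : measurable_fun setT (frame e1 e2 e3).
Proof.
have mc (a b c : R) : measurable_fun setT (fun x : R3 R => x.1.1 * a + x.1.2 * b + x.2 * c).
  apply: measurable_funD; first apply: measurable_funD; apply: measurable_funM => //.
  - exact: measurable_c1.
  - exact: measurable_c2.
by apply: measurable_triple; exact: mc.
Qed.

(** Relations between the vectors come first, relations between coordinates across the three vectors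
    second. The former give [dot3_frame2], the latter the invariance of the trace in
    [qval_trace]. *)
Definition orthonormal3 (e1 e2 e3 : R3 R) : Prop :=
  [/\ [/\ dot3 e1 e1 = 1, dot3 e2 e2 = 1 & dot3 e3 e3 = 1],
     [/\ dot3 e1 e2 = 0, dot3 e1 e3 = 0 & dot3 e2 e3 = 0],
     [/\ e1.1.1 ^+ 2 + e2.1.1 ^+ 2 + e3.1.1 ^+ 2 = 1,
         e1.1.2 ^+ 2 + e2.1.2 ^+ 2 + e3.1.2 ^+ 2 = 1 &
         e1.2 ^+ 2 + e2.2 ^+ 2 + e3.2 ^+ 2 = 1] &
     [/\ e1.1.1 * e1.1.2 + e2.1.1 * e2.1.2 + e3.1.1 * e3.1.2 = 0,
         e1.1.1 * e1.2 + e2.1.1 * e2.2 + e3.1.1 * e3.2 = 0 &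
         e1.1.2 * e1.2 + e2.1.2 * e2.2 + e3.1.2 * e3.2 = 0]].

Lemma polar_circle (x y : R) : x ^+ 2 + y ^+ 2 = 1 ->
  exists2 c : R, 0 <= c <= 2 * pi & x = cos c /\ y = sin c.
Proof.
move=> xy; have xI : -1 <= x <= 1.
  rewrite -ler_norml -(@ler_pXn2r _ 2) ?nnegrE// expr1n real_normK ?num_real//.
  by have := sqr_ge0 y; lra.
have sq : Num.sqrt (1 - x ^+ 2) = `|y| by rewrite -xy addrC addKr sqrtr_sqr.
have := acos_ge0 xI; have := acos_lepi xI => p1 p0.
have [y0|y0] := leP 0 y.
  exists (acos x); first by rewrite p0/=; have := pi_gt0 R; lra.
  by rewrite acosK ?in_itv// sin_acos// sq ger0_norm.
exists (2 * pi - acos x); first by have := pi_gt0 R; lra.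
rewrite addrC mulr_natl cosD2pi sinD2pi cosN sinN acosK ?in_itv// sin_acos// sq.
by rewrite ltr0_norm// opprK.
Qed.

(** The frame is a rotation whose Euler angles [a] and [c] are read off from [e3]. It is the
    composition of [rotz c], [swap13], [rotz a] and [swap13], each of which preserves the sphere
    measure. *)
Lemma sphere_frame e3 : dot3 e3 e3 = 1 -> exists e1 e2,
  orthonormal3 e1 e2 e3 /\
  forall g : R3 R -> \bar R,
  measurable_fun setT g -> (forall x, (0 <= g x)%E) ->
  (\int[sg]_x g (frame e1 e2 e3 x) = \int[sg]_x g x)%E.
Proof.
move=> e31.
have [a a2 [ca sa]] : exists2 a : R, 0 <= a <= 2 * pi &
    e3.2 = cos a /\ Num.sqrt (e3.1.1 ^+ 2 + e3.1.2 ^+ 2) = sin a.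
  apply: polar_circle; rewrite sqr_sqrtr ?addr_ge0 ?sqr_ge0//.
  by move: e31; rewrite /dot3 -!expr2 => <-; ring.
have s2 : e3.1.1 ^+ 2 + e3.1.2 ^+ 2 = sin a ^+ 2.
  by rewrite -sa sqr_sqrtr// addr_ge0 ?sqr_ge0.
have [c c2 [x1 x2]] : exists2 c : R, 0 <= c <= 2 * pi &
    e3.1.1 = - (sin a * sin c) /\ e3.1.2 = sin a * cos c.
  (* On the axis the first two coordinates vanish and the azimuth is arbitrary. *)
  have [s0|s0] := eqVneq (sin a) 0.
    exists 0; first by have := pi_gt0 R; lra.
    move: s2; rewrite s0 expr0n/= => /eqP; rewrite paddr_eq0 ?sqr_ge0//.
    by rewrite !sqrf_eq0 => /andP[/eqP -> /eqP ->]; rewrite !mul0r oppr0.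
  have [|c c2 [cc sc]] := @polar_circle (e3.1.2 / sin a) (- (e3.1.1 / sin a)).
    rewrite sqrrN !expr_div_n -mulrDl addrC s2 divff// sqrf_eq0//.
  exists c => //; rewrite -cc -sc; split; field => //.
pose e1 : R3 R := (cos c, sin c, 0).
pose e2 : R3 R := (- (cos a * sin c), cos a * cos c, - sin a).
have E3 : e3 = (- (sin a * sin c), sin a * cos c, cos a).
  by rewrite -x1 -x2 -ca; case: (e3) => -[].
exists e1, e2; split.
  have Ha := cos2Dsin2 a; have Hc := cos2Dsin2 c.
  rewrite E3 /orthonormal3 /dot3 /e1 /e2/=.
  set C := cos c in Hc *; set S := sin c in Hc *.
  set D := cos a in Ha *; set E := sin a in Ha *.
  have E1 : C ^+ 2 = 1 - S ^+ 2 by rewrite -Hc; ring.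
  have E2 : D ^+ 2 = 1 - E ^+ 2 by rewrite -Ha; ring.
  by split; split; ring: E1 E2.
move=> g mg g0.
have mz := @measurable_rotz R; have ms := @measurable_swap13 R.
pose g1 := g \o rotz c; pose g2 := g1 \o swap13; pose g3 := g2 \o rotz a.
have m1 : measurable_fun setT g1 by exact: (measurableT_comp mg (mz _)).
have m2 : measurable_fun setT g2 by exact: (measurableT_comp m1 ms).
have m3 : measurable_fun setT g3 by exact: (measurableT_comp m2 (mz _)).
rewrite -[RHS](ge0_integral_sphere_rotz c2 mg g0).
rewrite -[RHS](ge0_integral_sphere_swap13 m1 (fun x => g0 _)).
rewrite -[RHS](ge0_integral_sphere_rotz a2 m2 (fun x => g0 _)).
rewrite -[RHS](ge0_integral_sphere_swap13 m3 (fun x => g0 _)).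
apply: eq_integral => -[[x y] z] _; rewrite /g3 /g2 /g1/=; congr g.
rewrite E3 /frame /scale3 /e1 /e2 /rotz /swap13/=.
by congr (_, _, _); rewrite /=; ring.
Qed.

Lemma integral_sphere_frame e1 e2 e3 :
  (forall g : R3 R -> \bar R,
    measurable_fun setT g -> (forall x, (0 <= g x)%E) ->
    (\int[sg]_x g (frame e1 e2 e3 x) = \int[sg]_x g x)%E) ->
  forall g : R3 R -> \bar R, measurable_fun setT g ->
    (\int[sg]_x g (frame e1 e2 e3 x) = \int[sg]_x g x)%E.
Proof.
move=> H g mg; rewrite [LHS]integralE [RHS]integralE.
congr (_ - _)%E.
  rewrite -[RHS](H (g^\+)%E)//; last exact: measurable_funepos.
  by apply: eq_integral => x _; rewrite !funeposE.
rewrite -[RHS](H (g^\-)%E)//; last exact: measurable_funeneg.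
  by apply: eq_integral => x _; rewrite !funenegE.
Qed.

Lemma integral_sphere_rotz c : 0 <= c <= 2 * pi ->
  forall g : R3 R -> \bar R, measurable_fun setT g ->
    (\int[sg]_x g (rotz c x) = \int[sg]_x g x)%E.
Proof.
move=> c2 g mg; rewrite [LHS]integralE [RHS]integralE.
congr (_ - _)%E.
  rewrite -[RHS](ge0_integral_sphere_rotz (g := (g^\+)%E) c2)//; last exact: measurable_funepos.
  by apply: eq_integral => x _; rewrite !funeposE.
rewrite -[RHS](ge0_integral_sphere_rotz (g := (g^\-)%E) c2)//; last exact: measurable_funeneg.
  by apply: eq_integral => x _; rewrite !funenegE.
Qed.

End Frames.

(** * The truncated collision integral *)

Section Geometry.
Context {R : realType}.
Implicit Types v w x : R3 R.

Lemma dot3_ge0 v : 0 <= dot3 v v.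
Proof. by rewrite /dot3 -!expr2 !addr_ge0 ?sqr_ge0. Qed.

Lemma norm3_ge0 v : 0 <= norm3 v.
Proof. exact: sqrtr_ge0. Qed.

Lemma norm3_sqr v : norm3 v ^+ 2 = dot3 v v.
Proof. by rewrite sqr_sqrtr// dot3_ge0. Qed.

Lemma dot3_eq0 v : (dot3 v v == 0) = (v == 0).
Proof.
apply/idP/idP => [|/eqP ->]; last by rewrite /dot3 !mulr0 !addr0.
rewrite /dot3 -!expr2 paddr_eq0 ?addr_ge0 ?sqr_ge0// paddr_eq0 ?sqr_ge0//.
by case: v => -[x y] z/=; rewrite !sqrf_eq0 => /andP[/andP[/eqP-> /eqP->] /eqP->].
Qed.

Lemma norm3_gt0 v : (0 < norm3 v) = (v != 0).
Proof. by rewrite sqrtr_gt0 lt0r dot3_ge0 andbT dot3_eq0. Qed.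

Lemma dot3_sph p : dot3 (@sph R p) (sph p) = 1.
Proof.
rewrite /dot3 /sph/=.
have H1 : sin p.1 ^+ 2 = 1 - cos p.1 ^+ 2 by exact: sin2cos2.
have H2 : sin p.2 ^+ 2 = 1 - cos p.2 ^+ 2 by exact: sin2cos2.
by ring: H1 H2.
Qed.

Lemma dot3_frame (e1 e2 e3 : R3 R) x : orthonormal3 e1 e2 e3 ->
  dot3 e3 (frame e1 e2 e3 x) = x.2.
Proof.
move=> [[_ _ h3] [_ h13 h23] _ _].
rewrite -[RHS]mulr1 -h3 -[RHS]addr0 -(mulr0 x.1.1) -h13 -[RHS]addr0 -(mulr0 x.1.2) -h23.
by rewrite /dot3 /frame /scale3/=; ring.
Qed.

Lemma dot3_frame2 (e1 e2 e3 : R3 R) x : orthonormal3 e1 e2 e3 ->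
  dot3 (frame e1 e2 e3 x) (frame e1 e2 e3 x) = dot3 x x.
Proof.
move=> [[h1 h2 h3] [h12 h13 h23] _ _].
transitivity (x.1.1 ^+ 2 * dot3 e1 e1 + x.1.2 ^+ 2 * dot3 e2 e2 + x.2 ^+ 2 * dot3 e3 e3
  + 2 * x.1.1 * x.1.2 * dot3 e1 e2 + 2 * x.1.1 * x.2 * dot3 e1 e3
  + 2 * x.1.2 * x.2 * dot3 e2 e3).
  by rewrite /dot3 /frame /scale3/=; ring.
by rewrite h1 h2 h3 h12 h13 h23 /dot3; ring.
Qed.

End Geometry.

Section CollisionMeasure.
Context {R : realType}.
Notation TR := (measurableTypeR R).
Notation mu := (@lebesgue_measure R).
Notation sg := (@sphere_measure R).
Variable b : R -> R.
Hypothesis hb : cross_section b.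

Lemma acos_le_pihalf (z : R) : 0 <= z <= 1 -> 0 <= acos z <= pi / 2.
Proof.
move=> /andP[z0 z1]; have zI : -1 <= z <= 1 by rewrite z1 andbT; lra.
rewrite acos_ge0//= leNgt; apply/negP => za.
have pi0 := pi_gt0 R; have := acos_ge0 zI; have := acos_lepi zI => p1 p0.
have := ltr_cos (x := pi / 2) (y := acos z).
rewrite !in_itv/= p0 p1 => /(_ ltac:(lra) isT).
by rewrite acosK ?in_itv// cos_pihalf ltNge z0/= za.
Qed.

Lemma cross_section_b_ge0 z : 0 <= z <= 1 -> 0 <= b z.
Proof.
move=> z01; rewrite -(acosK (x := z)); last by rewrite in_itv/=; lra.
by apply: cross_section_ge0 => //; exact: acos_le_pihalf.
Qed.

Lemma cross_section_b_eq0 z : -1 <= z < 0 -> b z = 0.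
Proof.
move=> z01; have zI : -1 <= z <= 1 by lra.
rewrite -(acosK (x := z)); last by rewrite in_itv/=.
apply: cross_section_eq0 => //; rewrite acos_lepi// andbT.
rewrite ltNge; apply/negP => za.
have := cos_ge0_pihalf (x := acos z); rewrite za andbT acosK ?in_itv//.
have := acos_ge0 zI; have := pi_gt0 R => ? ?.
by move=> /(_ ltac:(lra)); lra.
Qed.

(** The kernel as a function of z = cos theta, cut to the angles [eps <= theta <= pi / 2]. *)
Definition bcut (eps : R) : TR -> R := b \_ (`[0, cos eps]%classic : set R).

Lemma bcutE eps z : bcut eps z = if 0 <= z <= cos eps then b z else 0.
Proof.
rewrite /bcut patchE (_ : (z \in `[0, cos eps]%classic) = (0 <= z <= cos eps))//.
by apply/idP/idP; rewrite inE/= in_itv.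
Qed.

Lemma bcut_ge0 eps z : 0 <= bcut eps z.
Proof.
rewrite bcutE; case: ifP => // /andP[z0 zc]; apply: cross_section_b_ge0.
by rewrite z0 (le_trans zc)// cos_le1.
Qed.

Lemma measurable_bcut eps : measurable_fun setT (bcut eps).
Proof.
apply/(measurable_restrictT _ _).1; first exact: measurable_itv.
apply: measurable_funS (cross_section_measurable hb); first exact: measurable_itv.
move=> z /=; rewrite !in_itv/= => /andP[z0 zc]; apply/andP; split; first by lra.
by rewrite (le_trans zc)// cos_le1.
Qed.

Definition bweight eps (x : R3 R) : R := bcut eps x.2.

Lemma measurable_bweight eps : measurable_fun setT (bweight eps).
Proof. exact: (measurableT_comp (measurable_bcut eps) measurable_c3). Qed.

Lemma bweight_ge0 eps x : 0 <= bweight eps x.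
Proof. exact: bcut_ge0. Qed.

(** The measure b(cos theta) dsigma cut off at [eps], in coordinates where the direction of xi is
    the third axis. It is the same for all xi; only the frame changes with xi. *)
Definition collision_measure eps : {measure set (R3 R) -> \bar R} :=
  wpush sg (measurable_bweight eps) (bweight_ge0 eps)
    (@measurable_id _ (R3 R) setT).

Notation nu := collision_measure.

Lemma cos_itvP (eps a : R) : 0 < eps <= pi / 2 -> 0 <= a <= pi ->
  (0 <= cos a <= cos eps) = (eps <= a <= pi / 2).
Proof.
move=> e0 a0; have pi0 := pi_gt0 R.
have leC x y : 0 <= x <= pi -> 0 <= y <= pi -> (cos x <= cos y) = (y <= x).
  by move=> xI yI; rewrite !leNgt ltr_cos// in_itv.
rewrite -(cos_pihalf R) !leC//; [by rewrite andbC|lra|lra].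
Qed.

Lemma integral_zonal (eps : R) (phi : TR -> \bar R) : 0 < eps <= pi / 2 ->
  measurable_fun setT phi -> (forall z, (0 <= phi z)%E) ->
  (\int[nu eps]_x phi x.2 = (2 * pi)%:E *
     \int[mu]_(a in `[eps, (pi / 2)%R]) ((b (cos a) * sin a)%:E * phi (cos a)))%E.
Proof.
move=> e0 mphi phi0; have pi0 := pi_gt0 R.
have mphi2 : measurable_fun setT (fun x : R3 R => phi x.2).
  exact: (measurableT_comp mphi measurable_c3).
rewrite /collision_measure ge0_integral_wpush//.
rewrite ge0_integral_sphere_polar; last 2 first.
- by apply: emeasurable_funM => //; apply/measurable_EFinP; exact: measurable_bweight.
- by move=> x; rewrite mule_ge0 ?lee_fin ?bweight_ge0.
transitivity (\int[mu]_(a in `[0%R, pi])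
    ((2 * pi)%:E * (((bcut eps (cos a)) * sin a)%:E * phi (cos a))))%E.
  apply: eq_integral => a _; rewrite /bweight/=.
  rewrite integral_cst//= lebesgue_itv ?subr0; last by lra.
  by rewrite muleA [LHS]muleC; congr (_ * _)%E; rewrite EFinM -muleA muleCA.
rewrite ge0_integralZl//; last 3 first.
- apply: measurable_funTS; apply: emeasurable_funM.
    apply/measurable_EFinP; apply: measurable_funM; last exact: measurable_sinT.
    exact: (measurableT_comp (measurable_bcut eps) measurable_cosT).
  exact: (measurableT_comp mphi measurable_cosT).
- move=> a /=; rewrite in_itv/= => aI; rewrite mule_ge0// lee_fin mulr_ge0 ?bcut_ge0//.
  exact: sin_ge0_pi.
- by rewrite lee_fin; lra.
congr (_ * _)%E; rewrite integral_mkcond [RHS]integral_mkcond.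
apply: eq_integral => a _; rewrite !patchE.
have [aI|aI] := boolP (0 <= a <= pi); last first.
  rewrite !memNset//= in_itv/=; last by apply/negP.
  by move=> a1; move/negP: aI; apply; move: e0 a1; lra.
rewrite mem_set/= ?in_itv//= bcutE cos_itvP//.
case: ifPn => aJ; first by rewrite mem_set//= in_itv.
by rewrite memNset ?mul0r ?mul0e//= in_itv/=; apply/negP.
Qed.

Lemma collision_measure_finite eps : 0 < eps <= pi / 2 -> (nu eps setT < +oo)%E.
Proof.
move=> e0; have -> : nu eps setT = (\int[nu eps]_x (cst 1%E : TR -> \bar R) x.2)%E.
  by rewrite integral_cst//= mul1e.
rewrite integral_zonal//=.
under eq_integral do rewrite mule1.
have := cross_section_integrable hb (delta := eps); case: ltP e0 => //= e0 _ /(_ isT) H.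
apply: lte_mul_pinfty => //; first by rewrite lee_fin mulr_ge0// pi_ge0.
exact: integrable_lty H.
Qed.

End CollisionMeasure.

Section CollisionIntegral.
Context {R : realType}.
Notation TR := (measurableTypeR R).
Notation mu := (@lebesgue_measure R).
Notation sg := (@sphere_measure R).
Variable b : R -> R.
Hypothesis hb : cross_section b.
Notation nu := (collision_measure hb).

(** This set carries the collision measure. Integrals are restricted to it because the quadratic
    barriers are bounded on the sphere but not on the ambient space. *)
Definition cap (eps : R) : set (R3 R) :=
  [set x | dot3 x x = 1 /\ 0 <= x.2 <= cos eps].

Lemma measurable_dot3 (e : R3 R) : measurable_fun setT (@dot3 R e).
Proof.
apply: measurable_funD; first apply: measurable_funD; apply: measurable_funM => //.
- exact: measurable_c1.
- exact: measurable_c2.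
Qed.

Lemma measurable_dot33 : measurable_fun setT (fun x : R3 R => dot3 x x).
Proof.
have [m1 m2] := (@measurable_c1 R, @measurable_c2 R).
by apply: measurable_funD; first apply: measurable_funD; apply: measurable_funM.
Qed.

Lemma measurable_cap eps : measurable (cap eps).
Proof.
rewrite (_ : cap eps = (setT `&` (fun x : R3 R => dot3 x x) @^-1` [set 1]) `&`
   (setT `&` (fun x : R3 R => x.2) @^-1` `[0, cos eps]%classic)).
  apply: measurableI; first exact: measurable_dot33.
  by apply: measurable_c3 => //; exact: measurable_itv.
by rewrite !setTI; apply/seteqP; split => x /=; rewrite in_itv.
Qed.

Lemma bweight_cap eps p : ~ cap eps (sph p) -> bweight b eps (sph p) = 0.
Proof.
rewrite /cap/= dot3_sph /bweight bcutE => H.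
by case: ifPn => // I; case: H.
Qed.

Lemma integral_capE (eps : R) (h : R3 R -> \bar R) : measurable_fun setT h ->
  (\int[nu eps]_x h x = \int[nu eps]_(x in cap eps) h x)%E.
Proof.
move=> mh; have mw := measurable_bweight hb eps.
have mhc : measurable_fun setT (h \_ (cap eps)).
  apply/(measurable_restrictT _ _).1; first exact: measurable_cap.
  exact: measurable_funTS.
rewrite [RHS]integral_mkcond /collision_measure !integral_wpush//; last 2 first.
- by apply: emeasurable_funM => //; exact/measurable_EFinP.
- by apply: emeasurable_funM => //; exact/measurable_EFinP.
apply: eq_integral => p _; congr (_ * _)%E; rewrite patchE.
have [I|I] := pselect (cap eps (sph p)); first by rewrite mem_set.
by rewrite memNset// bweight_cap// !mul0e.
Qed.

Lemma Rintegral_capE (eps : R) (h : R3 R -> R) : measurable_fun setT h ->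
  \int[nu eps]_x h x = \int[nu eps]_(x in cap eps) h x.
Proof.
by move=> mh; rewrite /Rintegral integral_capE//; exact/measurable_EFinP.
Qed.

Lemma collision_integrable (eps : R) (h : R3 R -> R) (M : R) : 0 < eps <= pi / 2 ->
  measurable_fun setT h -> (forall x, cap eps x -> `|h x| <= M) ->
  (nu eps).-integrable (cap eps) (EFin \o h).
Proof.
move=> e0 mh hM; apply: measurable_bounded_integrable.
- exact: measurable_cap.
- rewrite (le_lt_trans _ (collision_measure_finite hb e0))//.
  apply: le_measure => //; rewrite inE//; exact: measurable_cap.
- exact: measurable_funTS.
- exists M; split; first exact: num_real.
  by move=> N MN x cx; apply: (le_trans (hM x cx)); exact: ltW.
Qed.

Lemma collision_integral_rotz (eps : R) (h : R3 R -> R) : measurable_fun setT h ->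
  \int[nu eps]_(x in cap eps) h (rotz (pi / 2) x) =
  \int[nu eps]_(x in cap eps) h x.
Proof.
move=> mh; have mw := measurable_bweight hb eps.
have mhr : measurable_fun setT (fun x => h (rotz (pi / 2) x)).
  exact: (measurableT_comp mh (measurable_rotz _)).
have mE f : measurable_fun setT f -> (\int[nu eps]_x (f x)%:E =
    \int[sg]_x ((bweight b eps x)%:E * (f x)%:E))%E.
  by move=> mf; rewrite integral_wpush//; exact/measurable_EFinP.
rewrite -!Rintegral_capE// /Rintegral !mE//.
congr fine; rewrite -[RHS](@integral_sphere_rotz _ (pi / 2))//.
- by have := pi_gt0 R; lra.
- by apply: emeasurable_funM => //; exact/measurable_EFinP.
Qed.

Lemma le_acosE (eps z : R) : 0 <= eps <= pi -> -1 <= z <= 1 ->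
  (eps <= acos z) = (z <= cos eps).
Proof.
move=> e0 zI; have zK : cos (acos z) = z by rewrite acosK// in_itv.
by rewrite -[in RHS]zK !leNgt ltr_cos ?in_itv//= acos_ge0// acos_lepi.
Qed.

Lemma dot3_CS (x y : R3 R) : dot3 x y ^+ 2 <= dot3 x x * dot3 y y.
Proof.
rewrite -subr_ge0 (_ : _ - _ = (x.1.1 * y.1.2 - x.1.2 * y.1.1) ^+ 2 +
  (x.1.1 * y.2 - x.2 * y.1.1) ^+ 2 + (x.1.2 * y.2 - x.2 * y.1.2) ^+ 2).
  by rewrite !addr_ge0 ?sqr_ge0.
by rewrite /dot3; ring.
Qed.

(** The link with the definition of [collision]: a rotation carries the truncated sphere integral at
    xi to one fixed measure on [cap], and the dependence on xi moves into the frame. *)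
Lemma sphere_int_collision (eps : R) (xi e1 e2 : R3 R) (H : R3 R -> R) :
  0 < eps <= pi / 2 -> xi != 0 ->
  let e3 := scale3 (norm3 xi)^-1 xi in
  orthonormal3 e1 e2 e3 ->
  (forall g : R3 R -> \bar R,
    measurable_fun setT g -> (forall x, (0 <= g x)%E) ->
    (\int[sg]_x g (frame e1 e2 e3 x) = \int[sg]_x g x)%E) ->
  measurable_fun setT H ->
  sphere_int [set s | eps <= acos (costheta xi s)]
    (fun s => b (costheta xi s) * H s) =
  \int[nu eps]_(x in cap eps) H (frame e1 e2 e3 x).
Proof.
move=> e0 xi0 e3 onb inv mH.
have pi0 := pi_gt0 R.
have mHf : measurable_fun setT (fun x => H (frame e1 e2 e3 x)).
  exact: (measurableT_comp mH (measurable_frame _ _ _)).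
have mG : measurable_fun setT (fun x : R3 R => (bcut b eps (dot3 e3 x) * H x)%:E).
  apply/measurable_EFinP; apply: measurable_funM => //.
  exact: (measurableT_comp (measurable_bcut hb eps) (measurable_dot3 _)).
have cE s : costheta xi s = dot3 e3 s.
  by rewrite /costheta /dot3 /e3 /scale3/=; ring.
rewrite -Rintegral_capE// /Rintegral /collision_measure integral_wpush//; last first.
  exact/measurable_EFinP.
transitivity (fine (\int[sg]_x (bcut b eps (dot3 e3 x) * H x)%:E)%E); last first.
  congr fine; rewrite -[LHS](integral_sphere_frame inv)//.
  by apply: eq_integral => x _; rewrite dot3_frame.
rewrite /sphere_measure integral_wpush// /sphere_int /Rintegral; congr fine.
rewrite [LHS]integral_mkcond; apply: eq_integral => p _.
rewrite patchE /sph_weight !indicE.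
have cI : -1 <= dot3 e3 (sph p) <= 1.
  rewrite -ler_norml -(@ler_pXn2r _ 2) ?nnegrE// expr1n real_normK ?num_real//.
  rewrite (le_trans (dot3_CS _ _))// dot3_sph mulr1.
  by case: onb => -[_ _ ->].
have eI : 0 <= eps <= pi by clear -e0 pi0; lra.
have ecos := le_acosE eI cI.
case: ifPn => [|/negP pD].
  rewrite inE/= cE => -[p1 [p2 pe]].
  rewrite !mem_set/= ?in_itv//= !mul1r -EFinM; congr EFin.
  rewrite mulrC; congr (_ * (_ * _)); rewrite bcutE; case: ifPn => // /negP hn.
  (* Angles beyond pi / 2 belong to the domain of [sphere_int] but not to [cap]; there [b] is 0. *)
  rewrite (cross_section_b_eq0 hb)//; case/andP: cI => -> _/=.
  rewrite ltNge; apply/negP => d0; apply: hn; rewrite d0/=.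
  by rewrite -ecos.
rewrite bcutE; case: (boolP (p.1 \in _)) => [|_]; last by rewrite !mul0r mul0e.
case: (boolP (p.2 \in _)) => [|_]; last by rewrite mulr0 !mul0r mul0e.
rewrite !inE/= !in_itv/= => p2 p1; case: ifPn => [/andP[d0 dc]|_]; last first.
  by rewrite mul0r mule0.
exfalso; apply: pD; rewrite inE/= cE; split => //; split => //.
by rewrite ecos.
Qed.

End CollisionIntegral.

(** * Bounds on the angular moments, uniform in the cutoff *)

Section TrigBounds.
Context {R : realType}.

(** Each Taylor bound below follows from the previous one, which states the sign of a derivative. *)
Lemma derive_ge0_le0 (f df : R -> R) :
  (forall x : R, is_derive x 1 f (df x)) -> (forall x, 0 <= x -> 0 <= df x) ->
  forall x, 0 <= x -> f 0 <= f x.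
Proof.
move=> dfE df0 x x0.
have cf : continuous f.
  by move=> y; apply: differentiable_continuous; apply/derivable1_diffP; exact: ex_derive.
have [y] := @MVT_segment R f df 0 x x0 (fun y _ => dfE y)
  (continuous_subspaceT (fun y => cf y)).
rewrite in_itv/= => /andP[y0 _]; rewrite subr0 -subr_ge0 => ->.
by rewrite mulr_ge0// df0.
Qed.

Lemma sin_le_id (x : R) : 0 <= x -> sin x <= x.
Proof.
move=> x0.
have := @derive_ge0_le0 (fun y => y - sin y) (fun y => 1 - cos y) _ _ x x0.
rewrite sin0 !subr0 subr_ge0; by apply => y; rewrite subr_ge0 cos_le1.
Qed.

Lemma cos_ge_quad (x : R) : 0 <= x -> 1 - cos x <= x ^+ 2 / 2.
Proof.
move=> x0.
have := @derive_ge0_le0 (fun y => y ^+ 2 * 2^-1 + cos y) (fun y => y - sin y) _ _ x x0.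
rewrite expr0n mul0r cos0 add0r => H.
suff : 1 <= x ^+ 2 * 2^-1 + cos x by lra.
apply: H => y; last by rewrite subr_ge0; exact: sin_le_id.
apply: is_derive_eq; rewrite /GRing.scale/=; by field.
Qed.

Lemma sin_ge_cubic (x : R) : 0 <= x -> x - x ^+ 3 / 6 <= sin x.
Proof.
move=> x0.
have := @derive_ge0_le0 (fun y => sin y - y + y ^+ 3 * 6^-1)
  (fun y => cos y - 1 + y ^+ 2 / 2) _ _ x x0.
rewrite expr0n mul0r sin0 addr0 subr0 => H.
suff : 0 <= sin x - x + x ^+ 3 * 6^-1 by lra.
apply: H => y.
  apply: is_derive_eq; rewrite /GRing.scale/=; by field.
by move=> /cos_ge_quad; lra.
Qed.

Lemma cos_le_quartic (x : R) : 0 <= x -> x ^+ 2 / 2 - x ^+ 4 / 24 <= 1 - cos x.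
Proof.
move=> x0.
have := @derive_ge0_le0 (fun y => y ^+ 4 * 24^-1 - y ^+ 2 * 2^-1 - cos y)
  (fun y => y ^+ 3 / 6 - y + sin y) _ _ x x0.
rewrite !expr0n/= !mul0r cos0 subr0 sub0r => H.
suff : -1 <= x ^+ 4 * 24^-1 - x ^+ 2 * 2^-1 - cos x by lra.
apply: H => y.
  apply: is_derive_eq; rewrite /GRing.scale/=; by field.
by move=> /sin_ge_cubic; lra.
Qed.

Lemma sin_ge_half (x : R) : 0 <= x <= 1 -> x / 2 <= sin x.
Proof.
move=> /andP[x0 x1]; apply: le_trans (sin_ge_cubic x0).
have : x ^+ 3 <= x by rewrite -[leRHS]expr1; exact: ler_wiXn2l.
lra.
Qed.

Lemma cos_le_half (x : R) : 0 <= x <= 1 -> x ^+ 2 / 4 <= 1 - cos x.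
Proof.
move=> /andP[x0 x1]; apply: le_trans (cos_le_quartic x0).
have : x ^+ 4 <= x ^+ 2 by exact: ler_wiXn2l.
by have := sqr_ge0 x; lra.
Qed.

End TrigBounds.

Lemma cross_section_near (R : realType) (b : R -> R) (s K : R) : 0 < K ->
  b (cos theta) * theta `^ (2 + 2 * s) @[theta --> 0^'+] --> K -> exists2 t0 : R, 0 < t0 <= 1 &
  forall a : R, 0 < a <= t0 -> K / 2 <= b (cos a) * a `^ (2 + 2 * s) <= 2 * K.
Proof.
move=> hK hbK.
have H1 : \forall a \near 0^'+, K / 2 <= b (cos a) * a `^ (2 + 2 * s).
  by apply: (cvgr_ge _ hbK); rewrite ltr_pdivrMr// ltr_pMr// ltr1n.
have H2 : \forall a \near 0^'+, b (cos a) * a `^ (2 + 2 * s) <= 2 * K.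
  by apply: (cvgr_le _ hbK); rewrite ltr_pMl// ltr1n.
have [e /= e0 He] : \forall a \near 0^'+,
    K / 2 <= b (cos a) * a `^ (2 + 2 * s) <= 2 * K.
  by near=> a; apply/andP; split; near: a.
(* The bound 1 puts the interval where [sin_ge_half] and [cos_le_half] hold; half of [e] turns a
   large inequality into the strict one of the neighbourhood. *)
exists (Num.min 1 (e / 2)); first by rewrite lt_min ltr01 divr_gt0//= ge_min lexx.
move=> a /andP[a0 al]; apply: He => //=.
rewrite sub0r normrN gtr0_norm//; move: al; rewrite le_min => /andP[_ /le_lt_trans]; apply.
by rewrite ltr_pdivrMr// ltr_pMr// ltr1n.
Unshelve. all: by end_near. Qed.

Section CollisionBounds.
Context {R : realType}.
Notation TR := (measurableTypeR R).
Notation mu := (@lebesgue_measure R).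
Implicit Types (b : R -> R) (s K t : R).

Lemma integral_cap_zonal b (hb : cross_section b) (eps : R) (phi : TR -> R) : 0 < eps <= pi / 2 ->
  measurable_fun setT phi -> (forall z, 0 <= z <= 1 -> 0 <= phi z) ->
  (\int[collision_measure hb eps]_(x in cap eps) (phi x.2)%:E = (2 * pi)%:E *
     \int[mu]_(a in `[eps, (pi / 2)%R]) (b (cos a) * sin a * phi (cos a))%:E)%E.
Proof.
move=> e0 mphi phi0; have pi0 := pi_gt0 R.
have mphi2 : measurable_fun setT (fun x : R3 R => (`|phi x.2|)%:E).
  apply/measurable_EFinP; apply: (measurableT_comp (@normr_measurable R setT)).
  exact: (measurableT_comp mphi measurable_c3).
(* The absolute value makes the integrand nonnegative on the whole line, as [integral_zonal] asks,
   and changes nothing on [cap]. *)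
transitivity (\int[collision_measure hb eps]_(x in cap eps) (`|phi x.2|)%:E)%E.
  apply: eq_integral => x /[!inE] -[_ /andP[x0 x1]].
  by rewrite ger0_norm// phi0// x0/= (le_trans x1)// cos_le1.
rewrite -integral_capE// (@integral_zonal _ _ hb eps (fun z => (`|phi z|)%:E))//; last first.
  by apply/measurable_EFinP; exact: (measurableT_comp (@normr_measurable R setT) mphi).
congr (_ * _)%E; apply: eq_integral => a /[!inE]/=; rewrite in_itv/= => /andP[a0 a1].
rewrite -EFinM ger0_norm// phi0// cos_le1 andbT cos_ge0_pihalf//; lra.
Qed.

Lemma powR_integral s (e t : R) : s < 1 -> 0 < e <= t ->
  (\int[mu]_(a in `[e, t]) (a `^ (1 - 2 * s))%:E <=
    (t `^ (2 - 2 * s) / (2 - 2 * s))%:E)%E.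
Proof.
move=> s1 /andP[e0]; have hs2 : 0 < 2 - 2 * s by lra.
rewrite le_eqVlt => /predU1P[<-|et].
  by rewrite set_itv1 integral_set1 lee_fin divr_ge0 ?powR_ge0// ltW.
have cpow (p x : R) : 0 < x -> {for x, continuous (fun y => y `^ p)}.
  move=> x0; apply: differentiable_continuous; apply/derivable1_diffP.
  by apply: derivable_powR; rewrite in_itv/= x0.
pose F (a : R) := (2 - 2 * s)^-1 * a `^ (2 - 2 * s).
rewrite (@continuous_FTC2 _ (fun a => a `^ (1 - 2 * s)) F e t et).
- rewrite -EFinB lee_fin /F mulrC lerBlDr lerDl mulr_ge0 ?powR_ge0// invr_ge0.
  exact: ltW.
- apply: continuous_in_subspaceT => x; rewrite inE/= in_itv/= => /andP[ex _].
  by apply: cpow; exact: lt_le_trans ex.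
- have dF x : 0 < x -> derivable F x 1.
    move=> x0; apply: derivableM => //.
    by apply: derivable_powR; rewrite in_itv/= x0.
  have cF x : 0 < x -> {for x, continuous F}.
    move=> x0; apply: cvgM; first exact: cvg_cst.
    exact: cpow.
  split.
  + by move=> x; rewrite in_itv/= => /andP[ex _]; apply: dF; exact: lt_trans ex.
  + by apply: cvg_at_right_filter; exact: cF.
  + by apply: cvg_at_left_filter; apply: cF; exact: lt_trans et.
- move=> x; rewrite in_itv/= => /andP[ex _]; have x0 : 0 < x by exact: lt_trans ex.
  rewrite derive1E deriveZ/=; last first.
    by apply: derivable_powR; rewrite in_itv/= x0.
  rewrite -derive1E powR_derive1 ?in_itv/= ?x0// /GRing.scale/= mulrA mulVf ?gt_eqF// mul1r.
  by congr (_ `^ _); ring.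
Qed.

Lemma measurable_bcos b (d : R) : cross_section b -> 0 < d ->
  measurable_fun (`[d, pi / 2]%classic : set TR) (fun a => b (cos a) * sin a).
Proof.
move=> hb d0; have /measurable_int := cross_section_integrable hb d0.
by move=> /measurable_EFinP.
Qed.

(** Near 0 the integrand in theta is at most 2K theta^(-2-2s) * theta * theta^2/4 = (K/2)
    theta^(1-2s), which is integrable since s < 1. Away from 0 the integrability of b(cos theta) sin
    theta is enough. Neither bound depends on [eps]. *)
Lemma collision_integral_ub b (hb : cross_section b) s K t0 :
  s < 1 -> 0 < K -> 0 < t0 <= 1 ->
  (forall a : R, 0 < a <= t0 -> K / 2 <= b (cos a) * a `^ (2 + 2 * s) <= 2 * K) ->
  exists2 k : R, 0 < k &
  forall eps : R, 0 < eps <= pi / 2 ->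
  \int[collision_measure hb eps]_(x in cap eps) ((1 - x.2) / 2) <= k.
Proof.
move=> s1 hK /andP[t00 t01] Ht; have pi2 := pi_ge2 R.
have hs2 : 0 < 2 - 2 * s by lra.
pose g a := b (cos a) * sin a * ((1 - cos a) / 2).
have tpi : 0 < t0 <= pi / 2 by lra.
have [C0 HC0] : exists C : R, (\int[mu]_(a in `[t0, (pi / 2)%R]) (g a)%:E <= C%:E)%E.
  have H := cross_section_integrable hb t00.
  exists (fine (\int[mu]_(a in `[t0, (pi / 2)%R]) (b (cos a) * sin a)%:E)%E).
  rewrite fineK; last exact: integrable_fin_num H.
  apply: ge0_le_integral => //.
  - move=> a /=; rewrite in_itv/= => aI; rewrite lee_fin !mulr_ge0//.
    + by apply: (cross_section_ge0 hb); lra.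
    + by apply: sin_ge0_pi; lra.
  - apply/measurable_EFinP; apply: measurable_funM; first exact: measurable_bcos.
    apply: measurable_funTS; apply: measurable_funM => //.
    by apply: measurable_funB => //; exact: measurable_cosT.
  - by apply/measurable_EFinP; exact: measurable_bcos.
  - move=> a /=; rewrite in_itv/= => aI; rewrite lee_fin ler_piMr//.
      rewrite mulr_ge0//; first by apply: (cross_section_ge0 hb); lra.
      by apply: sin_ge0_pi; lra.
    by have := cos_geN1 a; lra.
have gle (a : R) : 0 < a <= t0 -> g a <= (K / 2) * a `^ (1 - 2 * s).
  move=> aI; have a0 : 0 < a by lra.
  have P0 := powR_gt0 (2 + 2 * s) a0.
  rewrite -(ler_pM2r P0) -[leRHS]mulrA -powRD; last by apply/implyP => _; rewrite gt_eqF.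
  rewrite (_ : 1 - 2 * s + (2 + 2 * s) = 3%:R); last by ring.
  rewrite powR_mulrn ?(ltW a0)//.
  have /andP[b1 b2] := Ht a aI.
  rewrite (_ : g a * _ = (b (cos a) * a `^ (2 + 2 * s)) * (sin a * ((1 - cos a) / 2))); last first.
    by rewrite /g; ring.
  have sn : 0 <= sin a <= a by rewrite sin_ge0_pi ?sin_le_id ?(ltW a0)//; lra.
  have c1 : 0 <= (1 - cos a) / 2 <= a ^+ 2 / 4.
    by have := cos_ge_quad (ltW a0); have := cos_le1 a; lra.
  have -> : K / 2 * a ^+ 3 = 2 * K * (a * (a ^+ 2 / 4)) by field.
  apply: ler_pM => //; first by lra.
  - by rewrite mulr_ge0//; lra.
  - by apply: ler_pM; lra.
pose C1 : R := K / 2 * (t0 `^ (2 - 2 * s) / (2 - 2 * s)).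
(* The maximum with 1 makes the bound positive. *)
exists (Num.max 1 (2 * pi * (C1 + C0))); first by rewrite lt_max ltr01.
move=> eps e0; rewrite le_max; apply/orP; right.
have g0 (a : R) : 0 <= a <= pi / 2 -> 0 <= g a.
  move=> aI; rewrite !mulr_ge0//; first exact: (cross_section_ge0 hb).
    by apply: sin_ge0_pi; lra.
have mg (d : R) : 0 < d -> measurable_fun (`[d, pi / 2]%classic : set TR) g.
  move=> d0; apply: measurable_funM; first exact: measurable_bcos.
  apply: measurable_funTS; apply: measurable_funM => //.
  by apply: measurable_funB => //; exact: measurable_cosT.
rewrite -lee_fin /Rintegral fineK; last first.
  apply: integrable_fin_num; first exact: measurable_cap.
  apply: (@collision_integrable _ _ hb eps _ 1) => //.
    apply: measurable_funM => //; apply: measurable_funB => //.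
  move=> x [_ /andP[x0 x1]]; have := cos_le1 eps => ?.
  by rewrite ger0_norm; lra.
rewrite (@integral_cap_zonal b hb eps (fun z => (1 - z) / 2))//; last 2 first.
- by apply: measurable_funM => //; apply: measurable_funB.
- by move=> z zI; lra.
rewrite [leRHS]EFinM; apply: lee_wpmul2l; first by rewrite lee_fin; lra.
(* For [eps > t0] the domain is enlarged, so that it can always be cut at [t0]. *)
pose e := Num.min eps t0.
have e1 : 0 < e <= t0 by rewrite lt_min t00 ge_min lexx orbT andbT; case/andP: e0 => ->.
apply: (@le_trans _ _ (\int[mu]_(a in `[e, (pi / 2)%R]) (g a)%:E)%E).
  apply: ge0_subset_integral => //.
  - by apply/measurable_EFinP; apply: mg; lra.
  - by move=> a /=; rewrite in_itv/= => aI; rewrite lee_fin g0//; lra.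
  - by move=> a /=; rewrite !in_itv/= ge_min => /andP[-> ->].
rewrite (_ : `[e, pi / 2]%classic = `[e, t0]%classic `|` `]t0, pi / 2]%classic); last first.
  apply/seteqP; split => a /=; rewrite !in_itv/=.
    by move=> aI; have [at0|at0] := leP a t0; [left|right]; lra.
  by move=> [] aI; lra.
rewrite ge0_integral_setU//=; last 3 first.
- apply/measurable_EFinP; apply: (measurable_funS _ _ (mg e _)) => //; last by lra.
  by move=> a /=; rewrite !in_itv/= => -[] aI; lra.
- by move=> a /=; rewrite !in_itv/= => -[] aI; rewrite lee_fin g0//; lra.
- by apply/disj_set2P; apply/seteqP; split => // a /=; rewrite !in_itv/= => -[] aI; lra.
rewrite EFinD; apply: leeD; last first.
  rewrite integral_itv_obnd_cbnd//.
  apply/measurable_EFinP; apply: (measurable_funS _ _ (mg t0 _)) => //.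
  by move=> a /=; rewrite !in_itv/= => aI; lra.
apply: (@le_trans _ _ (\int[mu]_(a in `[e, t0]) ((K / 2)%:E * (a `^ (1 - 2 * s))%:E))%E).
  apply: ge0_le_integral => //.
  - by move=> a /=; rewrite in_itv/= => aI; rewrite lee_fin g0//; lra.
  - apply/measurable_EFinP; apply: (measurable_funS _ _ (mg e _)) => //; last by lra.
    by move=> a /=; rewrite !in_itv/= => aI; lra.
  - apply: emeasurable_funM => //; apply/measurable_EFinP; apply: measurable_funTS.
    exact: measurable_powR.
  - by move=> a /=; rewrite in_itv/= => aI; rewrite -EFinM lee_fin gle//; lra.
rewrite ge0_integralZl//; last 3 first.
- apply/measurable_EFinP; apply: measurable_funTS; exact: measurable_powR.
- by move=> a _; rewrite lee_fin powR_ge0.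
- by rewrite lee_fin; lra.
by rewrite [leRHS]EFinM; apply: lee_wpmul2l; rewrite ?lee_fin; [lra|exact: powR_integral].
Qed.

End CollisionBounds.

Section CollisionLowerBound.
Context {R : realType}.
Notation TR := (measurableTypeR R).
Notation mu := (@lebesgue_measure R).

Lemma cos_ring_itv (t a : R) : 0 < t -> t <= a <= 2 * t -> 2 * t <= 1 ->
  cos a \in `[cos (2 * t), cos t].
Proof.
move=> t0 /andP[ta at2] t1; have pi2 := pi_ge2 R.
have tI : t \in `[0, pi] by rewrite in_itv/=; lra.
have aI : a \in `[0, pi] by rewrite in_itv/=; lra.
have t2I : 2 * t \in `[0, pi] by rewrite in_itv/=; lra.
by rewrite in_itv/= !leNgt !ltr_cos// -!leNgt at2 ta.
Qed.

(** The arithmetic of the ring t <= a <= 2t. [Pa], [Pt], [P2] stand for the powers 2+2s of a, t and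
    2, and [B], [S], [C] for b(cos a), sin a and cos a. The factor 1/32 is 1/2 * 1/2 * 1/8. *)
Lemma ring_lower_bound (K t a B S C Pa Pt P2 : R) : 0 < K -> 0 < t -> t <= a ->
  0 < Pa -> 0 < Pt -> 0 < P2 -> K / 2 <= B * Pa -> a / 2 <= S -> a ^+ 2 / 4 <= 1 - C ->
  Pa <= P2 * Pt -> K / 32 / P2 * (t ^+ 3 / Pt) <= B * S * ((1 - C) / 2).
Proof.
move=> K0 t0 ta Pa0 Pt0 P20 KB aS aC PaP.
have BL : K / 2 / (P2 * Pt) <= B.
  rewrite ler_pdivrMr ?mulr_gt0//; apply: (le_trans KB); rewrite ler_wpM2l//.
  by rewrite -(pmulr_lge0 _ Pa0) (le_trans _ KB)// divr_ge0// ltW.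
have tS : t / 2 <= S by apply: le_trans aS; rewrite ler_pM2r.
have tC : t ^+ 2 / 8 <= (1 - C) / 2.
  have ta2 : t ^+ 2 <= a ^+ 2 by apply: lerXn2r; rewrite ?nnegrE ?(le_trans (ltW t0) ta) ?(ltW t0).
  by move: aC ta2; move: (t ^+ 2) (a ^+ 2) => x y; lra.
rewrite (_ : K / 32 / P2 * (t ^+ 3 / Pt) = K / 2 / (P2 * Pt) * (t / 2) * (t ^+ 2 / 8)); last first.
  by field; rewrite !gt_eqF.
have x0 : 0 <= K / 2 / (P2 * Pt) by rewrite !divr_ge0 ?mulr_ge0 ?ltW.
have y0 : 0 <= t / 2 by rewrite divr_ge0 ?ltW.
have z0 : 0 <= t ^+ 2 / 8 by rewrite divr_ge0 ?sqr_ge0.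
by apply: ler_pM => //; [exact: mulr_ge0|exact: ler_pM].
Qed.

(** The ring t <= theta <= 2t has width [t] and an integrand of at least a multiple of t^(1-2s), so
    it contributes the order t^(2-2s). The condition [eps <= t] keeps the ring clear of the cutoff,
    and [t <= t0 / 2] keeps it in the asymptotic range of [b]. *)
Lemma collision_integral_lb b (hb : cross_section b) (s K t0 : R) :
  0 < s -> 0 < K -> 0 < t0 <= 1 ->
  (forall a : R, 0 < a <= t0 -> K / 2 <= b (cos a) * a `^ (2 + 2 * s) <= 2 * K) ->
  exists2 c : R, 0 < c &
  forall t eps : R, 0 < t <= t0 / 2 -> 0 < eps <= t ->
  c * (t ^+ 4 / t `^ (2 + 2 * s)) <=
  \int[collision_measure hb eps]_(x in cap eps)
    ((1 - x.2) / 2 * \1_(`[cos (2 * t), cos t]%classic : set R) x.2).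
Proof.
move=> s0 hK /andP[t00 t01] Ht; have pi2 := pi_ge2 R.
have P2 : 0 < (2 : R) `^ (2 + 2 * s) by exact: powR_gt0.
exists (2 * pi * (K / 32 / 2 `^ (2 + 2 * s))).
  by rewrite !mulr_gt0 ?invr_gt0//; lra.
move=> t eps /andP[tp tt] /andP[ep et].
have Pt := powR_gt0 (2 + 2 * s) tp.
pose phi (z : TR) : R := (1 - z) / 2 * \1_(`[cos (2 * t), cos t]%classic : set TR) z.
have mphi : measurable_fun setT phi.
  apply: measurable_funM; last exact: measurable_indic.
  by apply: measurable_funM => //; apply: measurable_funB.
have phi0 (z : R) : 0 <= z <= 1 -> 0 <= phi z by move=> zI; rewrite mulr_ge0//; lra.
have e0 : 0 < eps <= pi / 2 by lra.
rewrite -lee_fin /Rintegral fineK; last first.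
  apply: integrable_fin_num; first exact: measurable_cap.
  apply: (@collision_integrable _ _ hb eps (fun x => phi x.2) 1) => //.
    exact: (measurableT_comp mphi measurable_c3).
  move=> x [_ /andP[x0 x1]]; have := cos_le1 eps => ?.
  rewrite ger0_norm ?phi0//; last by lra.
  by rewrite /phi indicE; case: (_ \in _); rewrite ?mulr1 ?mulr0; lra.
rewrite (@integral_cap_zonal R b hb eps phi)// -[in leLHS]mulrA [leLHS]EFinM.
apply: lee_wpmul2l; first by rewrite lee_fin; lra.
pose g (a : R) : R := b (cos a) * sin a * phi (cos a).
have g0 (a : R) : 0 <= a <= pi / 2 -> 0 <= g a.
  move=> aI; rewrite /g mulr_ge0//; last first.
    by apply: phi0; rewrite cos_le1 andbT cos_ge0_pihalf//; lra.
  rewrite mulr_ge0//; first exact: (cross_section_ge0 hb).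
  by apply: sin_ge0_pi; lra.
have mg (d : R) : 0 < d -> measurable_fun (`[d, pi / 2]%classic : set TR) g.
  move=> d0; apply: measurable_funM; first exact: measurable_bcos.
  apply: measurable_funTS; exact: (measurableT_comp mphi measurable_cosT).
pose m := K / 32 / 2 `^ (2 + 2 * s) * (t ^+ 3 / t `^ (2 + 2 * s)).
have m0 : 0 <= m.
  by rewrite !mulr_ge0 ?invr_ge0 ?powR_ge0 ?exprn_ge0//; lra.
have gm (a : R) : t <= a <= 2 * t -> m <= g a.
  move=> /andP[ta at2]; have at0 : a <= t0 by apply: le_trans at2 _; rewrite mulrC -ler_pdivlMr.
  have a0 : 0 < a by exact: lt_le_trans ta.
  have a1 : 0 <= a <= 1 by rewrite (ltW a0) (le_trans at0).
  have /andP[b1 _] := Ht a (introT andP (conj a0 at0)).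
  rewrite /g /phi indicE mem_set ?mulr1/=; last first.
    by apply: cos_ring_itv; rewrite ?ta// mulrC -ler_pdivlMr// (le_trans tt)// ler_pM2r.
  apply: (ring_lower_bound hK tp ta) b1 (sin_ge_half a1) (cos_le_half a1) _ => //.
    exact: powR_gt0.
  rewrite -powRM ?(ltW tp)//; apply: ge0_ler_powR; rewrite ?nnegrE ?(ltW a0) ?mulr_ge0 ?(ltW tp)//.
  by rewrite addr_ge0// mulr_ge0// ltW.
apply: (@le_trans _ _ (\int[mu]_(a in `[t, (2 * t)%R]) (g a)%:E)%E); last first.
  apply: ge0_subset_integral => //.
  - by apply/measurable_EFinP; apply: mg.
  - by move=> a /=; rewrite in_itv/= => aI; rewrite lee_fin g0//; lra.
  - by move=> a /=; rewrite !in_itv/= => aI; lra.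
apply: (@le_trans _ _ (\int[mu]_(a in `[t, (2 * t)%R]) m%:E)%E).
  rewrite integral_cst//= lebesgue_itv; last by lra.
  rewrite -EFinM lee_fin /m (_ : 2 * t - t = t); last by ring.
  by rewrite le_eqVlt; apply/orP; left; apply/eqP; field; rewrite !gt_eqF.
apply: ge0_le_integral => //.
- by apply/measurable_EFinP; apply: (measurable_funS _ _ (mg t tp)) => // a /=; rewrite !in_itv/= => aI; lra.
Qed.

End CollisionLowerBound.

(** * Characteristic functions *)

Section CharacteristicFunctions.
Context {R : realType}.
Notation TR := (measurableTypeR R).
Implicit Types (F : probability (R3 R) R) (v xi : R3 R).

(** The characteristic function is [cosF] - i [sinF], and [qF] is its squared modulus. *)
Definition cosF F xi : R := \int[F]_v cos (dot3 v xi).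
Definition sinF F xi : R := \int[F]_v sin (dot3 v xi).
Definition qF F xi : R := cosF F xi ^+ 2 + sinF F xi ^+ 2.

Lemma measurable_dot3l xi : measurable_fun setT (fun v : R3 R => dot3 v xi).
Proof.
rewrite (_ : (fun v => dot3 v xi) = dot3 xi); first exact: measurable_dot3.
by apply/funext => v; rewrite /dot3; ring.
Qed.

Lemma measurable_cos_dot3 xi : measurable_fun setT (fun v : R3 R => cos (dot3 v xi)).
Proof. exact: (measurableT_comp measurable_cosT (measurable_dot3l xi)). Qed.

Lemma measurable_sin_dot3 xi : measurable_fun setT (fun v : R3 R => sin (dot3 v xi)).
Proof. exact: (measurableT_comp measurable_sinT (measurable_dot3l xi)). Qed.

Lemma probability_integrable F (D : set (R3 R)) (h : R3 R -> R) (M : R) :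
  measurable D -> measurable_fun setT h -> (forall v, D v -> `|h v| <= M) ->
  F.-integrable D (EFin \o h).
Proof.
move=> mD mh hM; apply: measurable_bounded_integrable => //.
- by rewrite (le_lt_trans (probability_le1 _ _))// ltry.
- exact: measurable_funTS.
- exists M; split; first exact: num_real.
  by move=> N MN x Dx; apply: (le_trans (hM x Dx)); exact: ltW.
Qed.

Lemma integrable_cosF F xi D : measurable D ->
  F.-integrable D (EFin \o (fun v => cos (dot3 v xi))).
Proof.
by move=> mD; apply: (@probability_integrable _ _ _ 1) => //;
  [exact: measurable_cos_dot3|move=> v _; exact: cos_max].
Qed.

Lemma integrable_sinF F xi D : measurable D ->
  F.-integrable D (EFin \o (fun v => sin (dot3 v xi))).
Proof.
by move=> mD; apply: (@probability_integrable _ _ _ 1) => //;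
  [exact: measurable_sin_dot3|move=> v _; exact: sin_max].
Qed.

Lemma cosF0 F : cosF F 0 = 1.
Proof.
rewrite /cosF; under eq_Rintegral => v _.
  rewrite (_ : dot3 v 0 = 0) ?cos0; last by rewrite /dot3 !mulr0 !addr0.
  over.
by rewrite Rintegral_cst//= probability_setT mul1r.
Qed.

Lemma sinF0 F : sinF F 0 = 0.
Proof.
rewrite /sinF; under eq_Rintegral => v _.
  rewrite (_ : dot3 v 0 = 0) ?sin0; last by rewrite /dot3 !mulr0 !addr0.
  over.
by rewrite Rintegral_cst//= mul0r.
Qed.

Lemma Rintegral_prob_le F (h : R3 R -> R) (M : R) : measurable_fun setT h ->
  (forall v, `|h v| <= M) -> `|\int[F]_v h v| <= M.
Proof.
move=> mh hM.
have ih : F.-integrable setT (EFin \o h) by exact: (@probability_integrable _ _ _ M).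
apply: (le_trans (le_normr_Rintegral _ ih)) => //.
rewrite -[leRHS]mulr1 -[X in _ * X](_ : fine (F setT) = 1); last by rewrite probability_setT.
rewrite -Rintegral_cst//; apply: le_Rintegral => //.
- by apply: (@probability_integrable _ _ _ M) => // [|v _];
    [exact: (measurableT_comp (@normr_measurable R setT) mh)|rewrite normr_id].
- apply: (@probability_integrable _ _ _ `|M|) => //.
Qed.

Lemma qF_expand F xi : \int[F]_v (1 - (cosF F xi * cos (dot3 v xi) +
    sinF F xi * sin (dot3 v xi))) = 1 - qF F xi.
Proof.
have i1 := integrable_cosF F xi measurableT.
have i2 := integrable_sinF F xi measurableT.
rewrite RintegralB//; last 2 first.
- by apply: (@probability_integrable _ _ _ 1) => // v _; rewrite normr1.
- exact: (integrableD measurableT (integrableZl measurableT _ i1)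
    (integrableZl measurableT _ i2)).
rewrite Rintegral_cst//= probability_setT mul1r; congr (_ - _).
rewrite RintegralD//; [|exact: (integrableZl measurableT _ i1)|exact: (integrableZl measurableT _ i2)].
by rewrite !RintegralZl//.
Qed.

Lemma qF_ge0 F xi : 0 <= qF F xi.
Proof. by rewrite addr_ge0 ?sqr_ge0. Qed.

(** By Cauchy-Schwarz the integrand that yields q is at most n, the square root of q; hence n^2 <=
    n. *)
Lemma qF_le1 F xi : qF F xi <= 1.
Proof.
have H (c s x : R) : c ^+ 2 + s ^+ 2 <= 1 -> c * cos x + s * sin x <= 1.
  move=> cs; have := cos2Dsin2 x; have := sqr_ge0 (c - cos x); have := sqr_ge0 (s - sin x).
  by rewrite !sqrrB; lra.
rewrite leNgt; apply/negP => q1.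
have q0 : 0 < qF F xi by lra.
pose n := Num.sqrt (qF F xi).
have n0 : 0 < n by rewrite sqrtr_gt0.
have nn : n ^+ 2 = qF F xi by rewrite sqr_sqrtr// ltW.
have n1 : 1 < n by rewrite -(@ltr_pXn2r _ 2) ?nnegrE ?(ltW n0)// expr1n nn.
have : `|\int[F]_v (cosF F xi * cos (dot3 v xi) + sinF F xi * sin (dot3 v xi))| <= n.
  apply: Rintegral_prob_le.
    apply: measurable_funD; apply: measurable_funM => //.
      exact: measurable_cos_dot3.
    exact: measurable_sin_dot3.
  move=> v; have := cos2Dsin2 (dot3 v xi); rewrite ler_norml.
  set c := cosF F xi in nn *; set s := sinF F xi in nn *.
  set x := cos _; set y := sin _ => xy.
  have cs : (c * x + s * y) ^+ 2 <= n ^+ 2.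
    rewrite nn /qF -/c -/s -[leRHS]mulr1 -xy -subr_ge0.
    by rewrite (_ : _ - _ = (c * y - s * x) ^+ 2) ?sqr_ge0//; ring.
  by rewrite -ler_norml -(@ler_pXn2r _ 2) ?nnegrE ?(ltW n0)// real_normK ?num_real.
have i1 := integrable_cosF F xi measurableT.
have i2 := integrable_sinF F xi measurableT.
rewrite RintegralD//; [|exact: (integrableZl measurableT _ i1)|exact: (integrableZl measurableT _ i2)].
rewrite !RintegralZl// -!expr2 -/(qF F xi) ger0_norm ?(ltW q0)// -nn.
by rewrite -[leRHS]mulr1 expr2 ler_pM2l// leNgt n1.
Qed.

End CharacteristicFunctions.

Section Regularity.
Context {R : realType}.
Notation TR := (measurableTypeR R).
Implicit Types (F : probability (R3 R) R) (v xi : R3 R).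

Lemma lipschitz1 (f df : R -> R) : (forall x : R, is_derive x 1 f (df x)) ->
  (forall x, `|df x| <= 1) -> forall x y, `|f x - f y| <= `|x - y|.
Proof.
move=> fdf df1; have cf : continuous f.
  by move=> y; apply: differentiable_continuous; apply/derivable1_diffP; exact: ex_derive.
have H x y : x <= y -> `|f y - f x| <= `|y - x|.
  move=> xy; have [z _ ->] := @MVT_segment R f df x y xy (fun z _ => fdf z)
    (continuous_subspaceT (fun z => cf z)).
  by rewrite normrM ler_piMl.
move=> x y; have [xy|yx] := leP x y; last by apply: H; exact: ltW.
by rewrite distrC [leRHS]distrC H.
Qed.

Lemma lipschitz_cos (x y : R) : `|cos x - cos y| <= `|x - y|.
Proof.
by apply: (@lipschitz1 cos (fun x => - sin x)) => z; rewrite ?normrN ?sin_max.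
Qed.

Lemma lipschitz_sin (x y : R) : `|sin x - sin y| <= `|x - y|.
Proof. by apply: (@lipschitz1 sin cos) => z; rewrite ?cos_max. Qed.

Lemma normr_dot3_le v xi : `|dot3 v xi| <= norm3 v * norm3 xi.
Proof.
rewrite -(@ler_pXn2r _ 2) ?nnegrE ?mulr_ge0 ?norm3_ge0// real_normK ?num_real//.
by rewrite exprMn !norm3_sqr dot3_CS.
Qed.

Lemma measurable_norm3 : measurable_fun setT (@norm3 R).
Proof. exact: (measurableT_comp measurable_sqrtT measurable_dot33). Qed.

Lemma measurable_ball3 (n : R) : measurable [set v : R3 R | norm3 v <= n].
Proof.
rewrite (_ : [set _ | _] = setT `&` (@norm3 R) @^-1` `]-oo, n]%classic).
  by apply: measurable_norm3.
by rewrite setTI; apply/seteqP; split => v /=; rewrite in_itv.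
Qed.

Lemma probability_tail F (e : R) : 0 < e ->
  exists2 n : R, 0 < n & fine (F (~` [set v | norm3 v <= n])) <= e.
Proof.
move=> e0; pose B (n : nat) := [set v : R3 R | norm3 v <= n%:R].
have mB n : measurable (B n) by exact: measurable_ball3.
have UB : \bigcup_n B n = setT.
  rewrite -subTset => v _; exists (Num.truncn (norm3 v)).+1 => //=.
  exact/ltW/truncnS_gt.
have : (F \o B) n @[n --> \oo] --> F (\bigcup_n B n).
  apply: nondecreasing_cvg_mu => //; first exact: bigcupT_measurable.
  move=> m n mn; apply/subsetPset => v /= /le_trans; apply.
  by rewrite ler_nat.
rewrite UB probability_setT => /fine_cvgP[_ /cvgr_ge/(_ (1 - e))].
rewrite ltrBlDr ltrDl => /(_ e0) [N _ HN].
exists N.+1%:R => //; have := HN N.+1 (leqnSn N) => /=.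
have fB : F (B N.+1) \is a fin_num by exact: fin_num_measure.
rewrite -[X in F (~` X)]/(B N.+1).
have -> : F (~` B N.+1) = (1 - F (B N.+1))%E by apply: probability_setC; exact: mB.
by rewrite -(fineK fB) -EFinB/= => ?; lra.
Qed.

(** Tightness splits the integral. Outside a ball whose complement has mass at most e/4 the
    integrand is at most 2; inside it the Lipschitz bound gives n * e/(2n). Each part costs e/2. *)
Lemma trigF_unif F (T : R -> R) (e : R) :
  (forall x y, `|T x - T y| <= `|x - y|) -> (forall x, `|T x| <= 1) ->
  @measurable_fun _ _ TR TR setT T -> 0 < e ->
  exists2 d, 0 < d & forall xi xi', norm3 (xi - xi') <= d ->
  `|\int[F]_v T (dot3 v xi) - \int[F]_v T (dot3 v xi')| <= e.
Proof.
move=> lT T1 mT e0.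
have [n n0 Fn] := @probability_tail F (e / 4) ltac:(lra).
set B := [set v : R3 R | norm3 v <= n] in Fn.
have mB : measurable B by exact: measurable_ball3.
have mTd xi : measurable_fun setT (fun v : R3 R => T (dot3 v xi)).
  exact: (measurableT_comp mT (measurable_dot3l xi)).
have iT xi : F.-integrable setT (EFin \o (fun v => T (dot3 v xi))).
  by apply: (@probability_integrable _ _ _ _ 1).
exists (e / (2 * n)); first by rewrite divr_gt0// mulr_gt0.
move=> xi xi' dxi; rewrite -RintegralB//.
apply: (le_trans (le_normr_Rintegral measurableT (integrableB measurableT (iT xi) (iT xi')))).
apply: (@le_trans _ _ (\int[F]_v (e / 2 + 2 * \1_(~` B) v))).
  apply: le_Rintegral => //.
  - apply: (@probability_integrable _ _ _ _ 2) => //.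
      apply: (measurableT_comp (@normr_measurable R setT)).
      exact: measurable_funB.
    move=> v _; rewrite normr_id (le_trans (ler_normB _ _))//.
    by have := T1 (dot3 v xi); have := T1 (dot3 v xi'); lra.
  - apply: (@probability_integrable _ _ _ _ (e / 2 + 2)) => //.
      apply: measurable_funD => //; apply: measurable_funM => //.
      by apply: measurable_indic; exact: measurableC.
    move=> v _; rewrite indicE; case: (_ \in _); rewrite ?mulr1 ?mulr0 ger0_norm; lra.
  - move=> v _; rewrite indicE; case: (boolP (v \in ~` B)) => vB.
      rewrite mulr1 (le_trans (ler_normB _ _))//.
      by have := T1 (dot3 v xi); have := T1 (dot3 v xi'); lra.
    rewrite mulr0 addr0 (le_trans (lT _ _))//.
    have -> : dot3 v xi - dot3 v xi' = dot3 v (xi - xi') by rewrite /dot3/=; ring.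
    rewrite (le_trans (normr_dot3_le _ _))//.
    have vn : norm3 v <= n by apply: contrapT => H; move/negP: vB; apply; rewrite inE.
    rewrite (_ : e / 2 = n * (e / (2 * n))); last by field; rewrite gt_eqF.
    by rewrite ler_pM ?norm3_ge0.
have m1 : measurable_fun setT (\1_(~` B) : R3 R -> R).
  by apply: measurable_indic; exact: measurableC.
have i1 : F.-integrable setT (EFin \o \1_(~` B)).
  apply: (@probability_integrable _ _ _ _ 1) => // v _.
  by rewrite indicE; case: (_ \in _); rewrite ?normr1 ?normr0.
rewrite RintegralD//; last 2 first.
- by apply: (@probability_integrable _ _ _ _ `|e / 2|).
- exact: (integrableZl measurableT _ i1).
rewrite Rintegral_cst//= probability_setT mulr1 RintegralZl//.
rewrite /Rintegral integral_indic ?setIT; last exact: measurableC.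
  lra.
exact: measurableT.
Qed.

(** Tonelli's theorem is applied to the nonnegative function 1 + T, and the constant is subtracted
    afterwards. *)
Lemma measurable_trigF F (T : R -> R) : (forall x, `|T x| <= 1) ->
  @measurable_fun _ _ TR TR setT T ->
  measurable_fun setT (fun xi : R3 R => \int[F]_v T (dot3 v xi)).
Proof.
move=> T1 mT.
have mTd xi : measurable_fun setT (fun v : R3 R => T (dot3 v xi)).
  exact: (measurableT_comp mT (measurable_dot3l xi)).
have iT xi : F.-integrable setT (EFin \o (fun v => T (dot3 v xi))).
  by apply: (@probability_integrable _ _ _ _ 1).
pose g (p : R3 R * R3 R) : \bar R := (1 + T (dot3 p.2 p.1))%:E.
have mg : measurable_fun setT g.
  apply/measurable_EFinP; apply: measurable_funD => //.
  apply: (measurableT_comp mT).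
  have m11 (p : (R3 R * R3 R)%type -> R3 R) : measurable_fun setT p ->
      [/\ measurable_fun setT (fun x => (p x).1.1), measurable_fun setT (fun x => (p x).1.2)
       & measurable_fun setT (fun x => (p x).2)].
    move=> mp; split; [exact: (measurableT_comp (@measurable_c1 R) mp)|
      exact: (measurableT_comp (@measurable_c2 R) mp)|
      exact: (measurableT_comp (@measurable_c3 R) mp)].
  have [a1 a2 a3] := m11 _ measurable_fst; have [b1 b2 b3] := m11 _ measurable_snd.
  by apply: measurable_funD; first apply: measurable_funD; apply: measurable_funM.
have g0 p : (0 <= g p)%E.
  by rewrite lee_fin; have := T1 (dot3 p.2 p.1); rewrite ler_norml; lra.
have mF := measurable_fun_fubini_tonelli_F (m2 := F) g mg g0.
rewrite (_ : (fun _ => _) = (fun xi => fine (fubini_F F g xi) - 1)).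
  apply: measurable_funB => //; exact: (measurableT_comp (@fine_measurable R setT measurableT) mF).
apply/funext => xi; rewrite /fubini_F /g/=.
rewrite -[fine _]/(\int[F]_v (1 + T (dot3 v xi))) RintegralD//; last first.
  by apply: (@probability_integrable _ _ _ _ 1) => // v _; rewrite normr1.
by rewrite Rintegral_cst//= probability_setT mul1r addrC addKr.
Qed.

End Regularity.

(** * A quadratic form that detects Dirac masses *)

Section QuadraticLowerBound.
Context {R : realType}.
Notation TR := (measurableTypeR R).
Implicit Types (F : probability (R3 R) R) (v xi : R3 R).

Record qform := QForm { q11 : R ; q22 : R ; q33 : R ; q12 : R ; q13 : R ; q23 : R }.

Definition qval (A : qform) xi : R :=
  q11 A * xi.1.1 ^+ 2 + q22 A * xi.1.2 ^+ 2 + q33 A * xi.2 ^+ 2 +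
  2 * (q12 A * (xi.1.1 * xi.1.2) + q13 A * (xi.1.1 * xi.2) + q23 A * (xi.1.2 * xi.2)).

Definition qtrace (A : qform) : R := q11 A + q22 A + q33 A.

Definition near_pairs (n : R) : set (R3 R * R3 R) := [set p | norm3 (p.1 - p.2) <= n].

Lemma measurable_diff :
  @measurable_fun _ _ (R3 R * R3 R)%type (R3 R) setT (fun p => p.1 - p.2).
Proof.
have mc := (@measurable_c1 R, @measurable_c2 R, @measurable_c3 R).
rewrite (_ : (fun _ => _) = (fun p => (p.1.1.1 - p.2.1.1, p.1.1.2 - p.2.1.2, p.1.2 - p.2.2)))//.
apply: measurable_triple; apply: measurable_funB.
- exact: (measurableT_comp (@measurable_c1 R) measurable_fst).
- exact: (measurableT_comp (@measurable_c1 R) measurable_snd).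
- exact: (measurableT_comp (@measurable_c2 R) measurable_fst).
- exact: (measurableT_comp (@measurable_c2 R) measurable_snd).
- exact: (measurableT_comp (@measurable_c3 R) measurable_fst).
- exact: (measurableT_comp (@measurable_c3 R) measurable_snd).
Qed.

Lemma measurable_near_pairs n : measurable (near_pairs n).
Proof.
rewrite (_ : near_pairs n = setT `&` (fun p : R3 R * R3 R => p.1 - p.2) @^-1`
   [set v : R3 R | norm3 v <= n]); last by rewrite setTI.
by apply: measurable_diff => //; exact: measurable_ball3.
Qed.

(** For independent v, w of law [F], the mean of cos((v - w).xi) is the squared modulus of the
    characteristic function. *)
Lemma qF_prod F xi : ((1 - qF F xi)%:E =
  \int[(F \x F)%E]_p (1 - cos (dot3 (p.1 - p.2) xi))%:E)%E.
Proof.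
have md : measurable_fun setT (fun p : (R3 R * R3 R)%type => 1 - cos (dot3 (p.1 - p.2) xi)).
  apply: measurable_funB => //.
  exact: (measurableT_comp (measurable_cos_dot3 xi) measurable_diff).
rewrite (@fubini_tonelli1 _ _ _ _ _ F F); last 2 first.
- exact/measurable_EFinP.
- by move=> p; rewrite lee_fin subr_ge0 cos_le1.
have i1 := integrable_cosF F xi measurableT.
have i2 := integrable_sinF F xi measurableT.
have ic (c : R) : F.-integrable setT (EFin \o fun=> c).
  by apply: (@probability_integrable _ _ _ _ `|c|).
have E v : fubini_F F (fun p : R3 R * R3 R => (1 - cos (dot3 (p.1 - p.2) xi))%:E) v =
    (1 - (cosF F xi * cos (dot3 v xi) + sinF F xi * sin (dot3 v xi)))%:E.
  rewrite /fubini_F /=.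
  have iv : F.-integrable setT (EFin \o (fun w => cos (dot3 v xi) * cos (dot3 w xi) +
      sin (dot3 v xi) * sin (dot3 w xi))).
    exact: (integrableD measurableT (integrableZl measurableT _ i1)
      (integrableZl measurableT _ i2)).
  transitivity (\int[F]_w (1 - (cos (dot3 v xi) * cos (dot3 w xi) +
      sin (dot3 v xi) * sin (dot3 w xi)))%:E)%E.
    apply: eq_integral => w _; congr (_%:E); congr (_ - _); rewrite -cosB; congr cos.
    by rewrite /dot3/=; ring.
  rewrite -[LHS]fineK; last first.
    apply: integrable_fin_num => //.
    exact: (integrableB measurableT (ic 1) iv).
  congr EFin; rewrite -/(Rintegral _ _ _) RintegralB//.
  rewrite Rintegral_cst//= probability_setT mul1r RintegralD//; last 2 first.
  - exact: (integrableZl measurableT _ i1).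
  - exact: (integrableZl measurableT _ i2).
  by rewrite !RintegralZl// -/(cosF F xi) -/(sinF F xi) mulrC (mulrC (sin _)).
under eq_integral do rewrite E.
rewrite -qF_expand /Rintegral fineK//; apply: integrable_fin_num => //.
have i3 := integrableD measurableT (integrableZl measurableT (cosF F xi) i1)
  (integrableZl measurableT (sinF F xi) i2).
exact: (integrableB measurableT (ic 1) i3).
Qed.

(** Second moments of v - w for independent v, w of law [F]; the restriction to [near_pairs n] makes
    them finite. *)
Definition dform F n : qform :=
  let I (h : R3 R -> R) := \int[(F \x F)%E]_(p in near_pairs n) h (p.1 - p.2) in
  QForm (I (fun z => z.1.1 ^+ 2)) (I (fun z => z.1.2 ^+ 2)) (I (fun z => z.2 ^+ 2))
    (I (fun z => z.1.1 * z.1.2)) (I (fun z => z.1.1 * z.2)) (I (fun z => z.1.2 * z.2)).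

Lemma probability_prodT F : ((F \x F)%E) setT = 1%E.
Proof.
rewrite -setXTT.
by rewrite (product_measure1E F F)//= probability_setT mule1.
Qed.

Lemma pair_integrable F n (h : R3 R -> R) (M : R) : measurable_fun setT h ->
  (forall z, norm3 z <= n -> `|h z| <= M) ->
  ((F \x F)%E).-integrable (near_pairs n) (EFin \o (fun p => h (p.1 - p.2))).
Proof.
move=> mh hM; apply: measurable_bounded_integrable => //.
- exact: measurable_near_pairs.
- apply: (@le_lt_trans _ _ (((F \x F)%E) setT)); last by rewrite probability_prodT ltry.
  by apply: le_measure; rewrite ?inE//; exact: measurable_near_pairs.
- by apply: measurable_funTS; exact: (measurableT_comp mh measurable_diff).
- exists M; split; first exact: num_real.
  by move=> N MN p np; apply: (le_trans (hM _ np)); exact: ltW.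
Qed.

Lemma norm3_coord (z : R3 R) n : norm3 z <= n ->
  [/\ `|z.1.1| <= n, `|z.1.2| <= n & `|z.2| <= n].
Proof.
move=> zn; have n0 : 0 <= n by exact: le_trans (norm3_ge0 z) zn.
have z2 : norm3 z ^+ 2 <= n ^+ 2 by rewrite ler_pXn2r ?nnegrE ?norm3_ge0.
move: z2; rewrite norm3_sqr /dot3 -!expr2 => z2.
have [[s1 s2] s3] := (sqr_ge0 z.1.1, sqr_ge0 z.1.2, sqr_ge0 z.2).
by split; rewrite -(@ler_pXn2r _ 2) ?nnegrE// real_normK ?num_real//; lra.
Qed.

Lemma dot3_sqr_expand (d xi : R3 R) : dot3 d xi ^+ 2 =
  xi.1.1 ^+ 2 * d.1.1 ^+ 2 + xi.1.2 ^+ 2 * d.1.2 ^+ 2 + xi.2 ^+ 2 * d.2 ^+ 2 +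
  2 * (xi.1.1 * xi.1.2) * (d.1.1 * d.1.2) + 2 * (xi.1.1 * xi.2) * (d.1.1 * d.2) +
  2 * (xi.1.2 * xi.2) * (d.1.2 * d.2).
Proof.
rewrite /dot3; move: (d.1.1 : R) (d.1.2 : R) (d.2 : R) (xi.1.1 : R) (xi.1.2 : R) (xi.2 : R).
by move=> x y z a b c; ring.
Qed.

Lemma dform_integral F n xi : 0 <= n ->
  ((F \x F)%E).-integrable (near_pairs n) (EFin \o (fun p => dot3 (p.1 - p.2) xi ^+ 2)) /\
  \int[(F \x F)%E]_(p in near_pairs n) (dot3 (p.1 - p.2) xi ^+ 2) = qval (dform F n) xi.
Proof.
move=> n0.
have [[m1 m2] m3] := (@measurable_c1 R, @measurable_c2 R, @measurable_c3 R).
have ms (h : R3 R -> R) : measurable_fun setT h -> measurable_fun setT (fun z => h z ^+ 2).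
  by move=> mh; exact: measurable_funX.
have mp (h g : R3 R -> R) : measurable_fun setT h -> measurable_fun setT g ->
  measurable_fun setT (fun z => h z * g z) by exact: measurable_funM.
have bp (a c : R) : `|a| <= n -> `|c| <= n -> `|a * c| <= n ^+ 2.
  by move=> an cn; rewrite normrM expr2 ler_pM.
have I11 := @pair_integrable F n (fun z => z.1.1 ^+ 2) (n ^+ 2) (ms _ m1)
  (fun z zn => let: And3 a c d := norm3_coord zn in bp _ _ a a).
have I22 := @pair_integrable F n (fun z => z.1.2 ^+ 2) (n ^+ 2) (ms _ m2)
  (fun z zn => let: And3 a c d := norm3_coord zn in bp _ _ c c).
have I33 := @pair_integrable F n (fun z => z.2 ^+ 2) (n ^+ 2) (ms _ m3)
  (fun z zn => let: And3 a c d := norm3_coord zn in bp _ _ d d).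
have I12 := @pair_integrable F n (fun z => z.1.1 * z.1.2) (n ^+ 2) (mp _ _ m1 m2)
  (fun z zn => let: And3 a c d := norm3_coord zn in bp _ _ a c).
have I13 := @pair_integrable F n (fun z => z.1.1 * z.2) (n ^+ 2) (mp _ _ m1 m3)
  (fun z zn => let: And3 a c d := norm3_coord zn in bp _ _ a d).
have I23 := @pair_integrable F n (fun z => z.1.2 * z.2) (n ^+ 2) (mp _ _ m2 m3)
  (fun z zn => let: And3 a c d := norm3_coord zn in bp _ _ c d).
have mN := @measurable_near_pairs n.
have Z := fun (h : R3 R * R3 R -> R) (k : R) (ih : ((F \x F)%E).-integrable (near_pairs n) (EFin \o h)) =>
  integrableZl mN k ih.
have E : (fun p : R3 R * R3 R => dot3 (p.1 - p.2) xi ^+ 2) = (fun p : R3 R * R3 R =>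
    xi.1.1 ^+ 2 * (p.1 - p.2).1.1 ^+ 2 + xi.1.2 ^+ 2 * (p.1 - p.2).1.2 ^+ 2 +
    xi.2 ^+ 2 * (p.1 - p.2).2 ^+ 2 + 2 * (xi.1.1 * xi.1.2) * ((p.1 - p.2).1.1 * (p.1 - p.2).1.2) +
    2 * (xi.1.1 * xi.2) * ((p.1 - p.2).1.1 * (p.1 - p.2).2) +
    2 * (xi.1.2 * xi.2) * ((p.1 - p.2).1.2 * (p.1 - p.2).2)).
  by apply/funext => p; exact: dot3_sqr_expand.
have J2 := integrableD mN (Z _ (xi.1.1 ^+ 2) I11) (Z _ (xi.1.2 ^+ 2) I22).
have J3 := integrableD mN J2 (Z _ (xi.2 ^+ 2) I33).
have J4 := integrableD mN J3 (Z _ (2 * (xi.1.1 * xi.1.2)) I12).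
have J5 := integrableD mN J4 (Z _ (2 * (xi.1.1 * xi.2)) I13).
have J6 := integrableD mN J5 (Z _ (2 * (xi.1.2 * xi.2)) I23).
rewrite E; split; first exact: J6.
rewrite RintegralD; [|exact: mN|exact: J5|exact: (Z _ _ I23)].
rewrite RintegralD; [|exact: mN|exact: J4|exact: (Z _ _ I13)].
rewrite RintegralD; [|exact: mN|exact: J3|exact: (Z _ _ I12)].
rewrite RintegralD; [|exact: mN|exact: J2|exact: (Z _ _ I33)].
rewrite RintegralD; [|exact: mN|exact: (Z _ _ I11)|exact: (Z _ _ I22)].
rewrite (RintegralZl _ mN I11) (RintegralZl _ mN I22) (RintegralZl _ mN I33).
rewrite (RintegralZl _ mN I12) (RintegralZl _ mN I13) (RintegralZl _ mN I23).
have lin (i11 i22 i33 i12 i13 i23 a b c : R) :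
    a ^+ 2 * i11 + b ^+ 2 * i22 + c ^+ 2 * i33 + 2 * (a * b) * i12 + 2 * (a * c) * i13 +
    2 * (b * c) * i23 = i11 * a ^+ 2 + i22 * b ^+ 2 + i33 * c ^+ 2 +
    2 * (i12 * (a * b) + i13 * (a * c) + i23 * (b * c)) by ring.
exact: lin.
Qed.

Lemma dform_ge0 F n xi : 0 <= n -> 0 <= qval (dform F n) xi.
Proof.
move=> n0; have [_ <-] := dform_integral F xi n0.
by apply: Rintegral_ge0 => p _; exact: sqr_ge0.
Qed.

(** On the kept pairs |(v - w).xi| <= n * n^-1 = 1, where 1 - cos x >= x^2/4; the dropped pairs
    contribute a nonnegative amount. *)
Lemma qF_quadratic F (n : R) xi : 0 < n -> norm3 xi <= n^-1 ->
  qval (dform F n) xi / 4 <= 1 - qF F xi.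
Proof.
move=> n0 xin; have [ii <-] := dform_integral F xi (ltW n0).
have mN := @measurable_near_pairs n.
rewrite mulrC -RintegralZl// -lee_fin qF_prod.
have i4 := integrableZl mN 4^-1 ii.
rewrite /Rintegral fineK; last exact: integrable_fin_num i4.
have md : measurable_fun setT (fun p : (R3 R * R3 R)%type => 1 - cos (dot3 (p.1 - p.2) xi)).
  apply: measurable_funB => //.
  exact: (measurableT_comp (measurable_cos_dot3 xi) measurable_diff).
apply: (@le_trans _ _ (\int[(F \x F)%E]_(p in near_pairs n) (1 - cos (dot3 (p.1 - p.2) xi))%:E)%E).
  apply: ge0_le_integral => //.
  - by move=> p _; rewrite lee_fin mulr_ge0 ?sqr_ge0.
  - exact: measurable_int i4.
  - by apply: measurable_funTS; exact/measurable_EFinP.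
  - move=> p pn; rewrite lee_fin; have : `|dot3 (p.1 - p.2) xi| <= 1.
      rewrite (le_trans (normr_dot3_le _ _))//.
      apply: (@le_trans _ _ (n * n^-1)); first by rewrite ler_pM ?norm3_ge0.
      by rewrite divff// gt_eqF.
    set x := dot3 _ _ => x1; have := @cos_le_half R `|x|.
    rewrite x1 normr_ge0 real_normK ?num_real// => /(_ isT).
    rewrite (_ : cos `|x| = cos x); first by lra.
    by have [x0|x0] := leP 0 x; [rewrite ger0_norm|rewrite ltr0_norm// cosN].
apply: ge0_subset_integral => //.
exact/measurable_EFinP.
Qed.

End QuadraticLowerBound.

Section QuadraticTrace.
Context {R : realType}.
Notation TR := (measurableTypeR R).
Implicit Types (F : probability (R3 R) R) (v xi : R3 R).

Lemma dot3_sqr_sum (d : R3 R) : dot3 d d =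
  dot3 d (1, 0, 0) ^+ 2 + dot3 d (0, 1, 0) ^+ 2 + dot3 d (0, 0, 1) ^+ 2.
Proof. by rewrite /dot3/= !mulr0 !mulr1 !addr0 !add0r. Qed.

Lemma dform_trace F (n : R) : 0 <= n ->
  ((F \x F)%E).-integrable (near_pairs n) (EFin \o (fun p => dot3 (p.1 - p.2) (p.1 - p.2))) /\
  \int[(F \x F)%E]_(p in near_pairs n) dot3 (p.1 - p.2) (p.1 - p.2) = qtrace (dform F n).
Proof.
move=> n0.
have [i1 j1] := dform_integral F (1, 0, 0) n0.
have [i2 j2] := dform_integral F (0, 1, 0) n0.
have [i3 j3] := dform_integral F (0, 0, 1) n0.
have mN := @measurable_near_pairs R n.
have i12 := integrableD mN i1 i2; have i123 := integrableD mN i12 i3.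
have E : (fun p : R3 R * R3 R => dot3 (p.1 - p.2) (p.1 - p.2)) = (fun p : R3 R * R3 R =>
    dot3 (p.1 - p.2) (1, 0, 0) ^+ 2 + dot3 (p.1 - p.2) (0, 1, 0) ^+ 2 +
    dot3 (p.1 - p.2) (0, 0, 1) ^+ 2).
  by apply/funext => p; exact: dot3_sqr_sum.
rewrite E; split; first exact: i123.
rewrite RintegralD; [|exact: mN|exact: i12|exact: i3].
rewrite RintegralD; [|exact: mN|exact: i1|exact: i2].
by rewrite j1 j2 j3 /qval/qtrace/=; ring.
Qed.

(** If every truncated trace vanishes, the product measure is carried by the diagonal. Some section
    of the complement is then null, and [F] sits at the corresponding point. *)
Lemma qtrace_dform_gt0 F : ~ is_dirac F ->
  exists2 n : R, 0 < n & 0 < qtrace (dform F n).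
Proof.
move=> Fd; apply: contrapT => H; apply: Fd.
have T0 (n : nat) : qtrace (dform F n.+1%:R) = 0.
  have [_ E] := dform_trace F (ler0n R n.+1).
  have T0 : 0 <= qtrace (dform F n.+1%:R).
    by rewrite -E; apply: Rintegral_ge0 => p _; exact: dot3_ge0.
  apply/eqP; rewrite eq_le T0 andbT leNgt; apply/negP => T1; apply: H.
  by exists n.+1%:R.
pose X : set (R3 R * R3 R) := [set p | p.1 != p.2].
have mX : measurable X.
  rewrite (_ : X = setT `&` (fun p : R3 R * R3 R => dot3 (p.1 - p.2) (p.1 - p.2)) @^-1` (~` [set 0])).
    have md : measurable_fun setT (fun p : (R3 R * R3 R)%type => dot3 (p.1 - p.2) (p.1 - p.2)).
      exact: (measurableT_comp measurable_dot33 measurable_diff).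
    by apply: md => //; exact: measurableC.
  rewrite setTI; apply/seteqP; split => p /=.
    by move=> /negP p12 /eqP; rewrite dot3_eq0 subr_eq0.
  by move=> /eqP; rewrite dot3_eq0 subr_eq0.
have X0 : ((F \x F)%E) X = 0%E.
  pose Xn (n : nat) := X `&` near_pairs n.+1%:R.
  have -> : X = \bigcup_n Xn n.
    rewrite -setI_bigcupr setIidl// => p _; exists (Num.truncn (norm3 (p.1 - p.2))) => //=.
    exact/ltW/truncnS_gt.
  apply/eqP; rewrite -measure_le0.
  have mXn n : measurable (Xn n) by apply: measurableI => //; exact: measurable_near_pairs.
  apply: (le_trans (measure_sigma_subadditive _ mXn _ (subset_refl _))) => //.
    exact: bigcupT_measurable.
  rewrite eseries0// => n _ _.
  have [ii E] := dform_trace F (ler0n R n.+1).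
  have mN := @measurable_near_pairs R n.+1%:R.
  have I0 : (\int[(F \x F)%E]_(p in near_pairs n.+1%:R) `|(dot3 (p.1 - p.2) (p.1 - p.2))%:E| = 0)%E.
    under eq_integral do rewrite gee0_abs ?lee_fin ?dot3_ge0//.
    move: E; rewrite T0 /Rintegral => /eqP; rewrite fine_eq0; last exact: integrable_fin_num ii.
    by move=> /eqP.
  have := (ae_eq_integral_abs _ mN (measurable_int _ ii)).1 I0.
  move=> [N [mN' N0 sub]]; apply/eqP; rewrite -measure_le0 -N0; apply: le_measure; rewrite ?inE//.
  move=> p [/= p12 pn]; apply: sub => /= /(_ pn) [] /eqP.
  by rewrite dot3_eq0 subr_eq0 (negPf p12).
(* The mass of [X] is the integral of the masses of its sections, so almost all of these are null;
   as [F] has mass 1, at least one is. *)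
have [a Fa] : exists a, F (xsection X a) = 0%E.
  apply: contrapT => Hn.
  have mF := measurable_fun_xsection F mX.
  have I0 : (\int[F]_x `|(F \o xsection X) x| = 0)%E.
    by rewrite -X0; apply: eq_integral => x _; rewrite gee0_abs.
  have [N [mN N0 sub]] := (ae_eq_integral_abs F measurableT mF).1 I0.
  have NT : N = setT.
    by rewrite -subTset => x _; apply: sub => /= /(_ I) H0; apply: Hn; exists x.
  move: N0; rewrite NT => N0.
  by have /eqP := etrans (esym (probability_setT F)) N0; rewrite onee_eq0.
have mXa : measurable (xsection X a) by exact: measurable_xsection.
exists a => A mA; have [aA|aA] := pselect (A a); last first.
  rewrite diracE memNset//; apply/eqP; rewrite -measure_le0 -Fa; apply: le_measure; rewrite ?inE//.
  by move=> y Ay; rewrite /xsection/= inE/=; apply/eqP => /= ay; apply: aA; rewrite ay.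
rewrite diracE mem_set//.
have CA : F (~` A) = 0%E.
  apply/eqP; rewrite -measure_le0 -Fa; apply: le_measure; rewrite ?inE//.
    exact: measurableC.
  by move=> y Ay; rewrite /xsection/= inE/=; apply/eqP => /= ay; apply: Ay; rewrite -ay.
have fA : F A \is a fin_num by exact: fin_num_measure.
have := etrans (esym CA) (probability_setC F mA).
by rewrite -(fineK fA) -EFinB => -[/eqP]; rewrite eq_sym subr_eq0 => /eqP <-.
Qed.

End QuadraticTrace.

(** * The differential inequality and the lower barrier *)

Section CollisionInequality.
Context {R : realType}.
Notation TR := (measurableTypeR R).
Implicit Types (F : probability (R3 R) R) (v xi : R3 R).

Lemma measurable_xip xi : measurable_fun setT (@xip R xi).
Proof.
apply: measurable_triple; apply: measurable_funD => //; apply: measurable_funM => //.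
- exact: measurable_c1.
- exact: measurable_c2.
Qed.

Lemma measurable_xim xi : measurable_fun setT (@xim R xi).
Proof.
apply: measurable_triple; apply: measurable_funB => //; apply: measurable_funM => //.
- exact: measurable_c1.
- exact: measurable_c2.
Qed.

Lemma measurable_cosF F : measurable_fun setT (cosF F).
Proof. apply: measurable_trigF; [exact: cos_max|exact: measurable_cosT]. Qed.

Lemma measurable_sinF F : measurable_fun setT (sinF F).
Proof. apply: measurable_trigF; [exact: sin_max|exact: measurable_sinT]. Qed.

Lemma measurable_qF F : measurable_fun setT (qF F).
Proof.
by apply: measurable_funD; apply: measurable_funX;
  [exact: measurable_cosF|exact: measurable_sinF].
Qed.

Lemma cosF_le1 F xi : `|cosF F xi| <= 1.
Proof.
rewrite -(@ler_pXn2r _ 2) ?nnegrE// real_normK ?num_real// expr1n.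
by have := qF_le1 F xi; have := sqr_ge0 (sinF F xi); rewrite /qF; lra.
Qed.

Lemma sinF_le1 F xi : `|sinF F xi| <= 1.
Proof.
rewrite -(@ler_pXn2r _ 2) ?nnegrE// real_normK ?num_real// expr1n.
by have := qF_le1 F xi; have := sqr_ge0 (cosF F xi); rewrite /qF; lra.
Qed.

Lemma qF0 F : qF F 0 = 1.
Proof. by rewrite /qF cosF0 sinF0 expr1n expr0n addr0. Qed.

(* Pointwise form of [2 Re (conj psi * (psi^+ psi^- - psi))
   <= |psi^+ psi^-|^2 - |psi|^2]. *)
Lemma two_Re_le (c s c1 s1 c2 s2 : R) :
  2 * c * (c1 * c2 - s1 * s2 - c) - 2 * s * (s - (c1 * s2 + s1 * c2)) <=
  (c1 ^+ 2 + s1 ^+ 2) * (c2 ^+ 2 + s2 ^+ 2) - (c ^+ 2 + s ^+ 2).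
Proof.
rewrite -subr_ge0.
rewrite (_ : _ - _ = (c - (c1 * c2 - s1 * s2)) ^+ 2 + (s - (c1 * s2 + s1 * c2)) ^+ 2).
  by rewrite addr_ge0 ?sqr_ge0.
by ring.
Qed.

Definition gain F xi (e1 e2 : R3 R) (x : R3 R) : R :=
  let sigma := frame e1 e2 (scale3 (norm3 xi)^-1 xi) x in
  qF F (xip xi sigma) * qF F (xim xi sigma) - qF F xi.

Lemma measurable_gain F xi e1 e2 : measurable_fun setT (gain F xi e1 e2).
Proof.
apply: measurable_funB => //; apply: measurable_funM;
  apply: (measurableT_comp (measurable_qF F)).
- exact: (measurableT_comp (measurable_xip xi) (measurable_frame _ _ _)).
- exact: (measurableT_comp (measurable_xim xi) (measurable_frame _ _ _)).
Qed.

(** Any frame with third axis xi/|xi| that preserves the sphere measure will do; the estimates below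
    hold for all of them. *)
Definition collision_frame xi (e1 e2 : R3 R) : Prop :=
  orthonormal3 e1 e2 (scale3 (norm3 xi)^-1 xi) /\
  forall g : R3 R -> \bar R,
    measurable_fun setT g -> (forall x, (0 <= g x)%E) ->
    (\int[sphere_measure]_x g (frame e1 e2 (scale3 (norm3 xi)^-1 xi) x) =
     \int[sphere_measure]_x g x)%E.

Lemma collision_frame_exists xi : xi != 0 -> exists e1 e2, collision_frame xi e1 e2.
Proof.
move=> xi0; apply: sphere_frame.
have n0 : norm3 xi != 0 by rewrite gt_eqF// norm3_gt0.
have := norm3_sqr xi; rewrite /dot3 /scale3/= => E.
transitivity ((norm3 xi)^-1 ^+ 2 * norm3 xi ^+ 2); first by rewrite E; ring.
by rewrite exprVn mulVf// sqrf_eq0.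
Qed.

Lemma gain_bound (F : probability (R3 R) R) (xi e1 e2 x : R3 R) : `|gain F xi e1 e2 x| <= 2.
Proof.
rewrite /gain; set sg := frame _ _ _ _.
have := qF_ge0 F (xip xi sg); have := qF_ge0 F (xim xi sg).
have := qF_le1 F (xip xi sg); have := qF_le1 F (xim xi sg).
have := qF_ge0 F xi; have := qF_le1 F xi.
set a := qF F xi; set a1 := qF F _; set a2 := qF F _ => ? ? ? ? ? ?.
have : 0 <= a2 * a1 <= 1 by rewrite mulr_ge0//= mulr_ile1.
by rewrite ler_norml; lra.
Qed.


Lemma normr_sub3 (p q r : R) : `|p| <= 1 -> `|q| <= 1 -> `|r| <= 1 -> `|p - q - r| <= 3.
Proof. by rewrite !ler_norml; lra. Qed.

(** The limit eps -> 0 is taken here only. It exists for the truncations of 2 Re(conj psi *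
    collision), and [two_Re_le] bounds each of them by an integral of [gain]. Stating the result
    through a common bound [B] avoids any limit of the gain integrals. *)
Lemma collision_derivative (b : R -> R) (hb : cross_section b) (alpha : R)
    (F0 : probability (R3 R) R) (f : R -> probability (R3 R) R) :
  boltzmann_solution b alpha F0 f ->
  forall (t : R) xi e1 e2, 0 < t -> xi != 0 -> collision_frame xi e1 e2 ->
  exists d : R, is_derive t 1 (fun u : R => qF (f u) xi) d /\
  forall B e0 : R, 0 < e0 ->
  (forall eps : R, 0 < eps <= pi / 2 -> eps <= e0 ->
    \int[collision_measure hb eps]_(x in cap eps) gain (f t) xi e1 e2 x <= B) ->
  d <= B.
Proof.
move=> [_ _ hf] t xi e1 e2 t0 xi0 [onb inv].
have [l] := hf t xi t0; rewrite /collision_value (negPf xi0) => -[cRe cIm] [dRe dIm].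
have pi0 := pi_gt0 R.
(* The minus sign comes from the imaginary part of [charf], which is minus [sinF]. *)
exists (2 * cosF (f t) xi * complex.Re l - 2 * sinF (f t) xi * complex.Im l); split.
  have -> : (fun u : R => qF (f u) xi) = (fun u : R =>
     complex.Re (charf (f u) xi) ^+ 2 + complex.Im (charf (f u) xi) ^+ 2).
    by apply/funext => u; rewrite /charf/= sqrrN.
  have D1 := is_deriveX 2 dRe; have D2 := is_deriveX 2 dIm.
  have D := is_deriveD D1 D2.
  apply: (is_derive_eq D).
  by rewrite /GRing.scale/= expr1 -/(cosF (f t) xi) -/(sinF (f t) xi); ring.
move=> B e0 e00 HB.
set c := cosF (f t) xi; set s := sinF (f t) xi.
have cvgd : (2 * c * complex.Re (collision b (charf (f t)) eps xi) -
    2 * s * complex.Im (collision b (charf (f t)) eps xi)) @[eps --> 0^'+] -->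
    2 * c * complex.Re l - 2 * s * complex.Im l.
  by apply: cvgB; apply: cvgM => //; exact: cvg_cst.
apply: (cvgr_to_le cvgd).
have near1 : \forall eps \near 0^'+, 0 < eps <= Num.min e0 (pi / 2).
  near=> eps; apply/andP; split; near: eps; first exact: nbhs_right_gt.
  by apply: nbhs_right_le; rewrite lt_min e00 divr_gt0.
apply: filterS near1 => eps /andP[ep]; rewrite le_min => /andP[ee epi].
have eI : 0 < eps <= pi / 2 by rewrite ep.
set sg := frame e1 e2 (scale3 (norm3 xi)^-1 xi).
pose F := f t.
pose wRe (x : R3 R) := cosF F (xip xi x) * cosF F (xim xi x) -
  sinF F (xip xi x) * sinF F (xim xi x) - c.
pose wIm (x : R3 R) := s - (cosF F (xip xi x) * sinF F (xim xi x) +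
  sinF F (xip xi x) * cosF F (xim xi x)).
have mcp := measurableT_comp (measurable_cosF F) (measurable_xip xi).
have mcm := measurableT_comp (measurable_cosF F) (measurable_xim xi).
have msp := measurableT_comp (measurable_sinF F) (measurable_xip xi).
have msm := measurableT_comp (measurable_sinF F) (measurable_xim xi).
have mRe : measurable_fun setT wRe.
  by apply: measurable_funB => //; apply: measurable_funB; apply: measurable_funM.
have mIm : measurable_fun setT wIm.
  by apply: measurable_funB => //; apply: measurable_funD; apply: measurable_funM.
have ERe : complex.Re (collision b (charf F) eps xi) =
    \int[collision_measure hb eps]_(x in cap eps) wRe (sg x).
  rewrite -(sphere_int_collision hb eI xi0 onb inv mRe) /collision /sphere_intC/=.
  congr (sphere_int _ _); apply/funext => x.
  rewrite /charf/= -/(cosF F _) -/(sinF F _) -!/(cosF _ _) -!/(sinF _ _) cosF0 sinF0.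
  by rewrite /wRe /c; ring.
have EIm : complex.Im (collision b (charf F) eps xi) =
    \int[collision_measure hb eps]_(x in cap eps) wIm (sg x).
  rewrite -(sphere_int_collision hb eI xi0 onb inv mIm) /collision /sphere_intC/=.
  congr (sphere_int _ _); apply/funext => x.
  rewrite /charf/= -!/(cosF _ _) -!/(sinF _ _) cosF0 sinF0.
  by rewrite /wIm /s; ring.
rewrite ERe EIm.
have b1 (a d : R) : `|a| <= 1 -> `|d| <= 1 -> `|a * d| <= 1.
  by move=> a1 d1; rewrite normrM mulr_ile1.
have mc := @measurable_cap R eps.
have iRe : (collision_measure hb eps).-integrable (cap eps) (EFin \o (fun x => wRe (sg x))).
  apply: (@collision_integrable _ _ hb eps _ 3) => //.
    exact: (measurableT_comp mRe (measurable_frame _ _ _)).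
  move=> x _; rewrite /wRe.
  apply: normr_sub3; last exact: cosF_le1.
    exact: b1 (cosF_le1 F _) (cosF_le1 F _).
  exact: b1 (sinF_le1 F _) (sinF_le1 F _).
have iIm : (collision_measure hb eps).-integrable (cap eps) (EFin \o (fun x => wIm (sg x))).
  apply: (@collision_integrable _ _ hb eps _ 3) => //.
    exact: (measurableT_comp mIm (measurable_frame _ _ _)).
  move=> x _; rewrite /wIm.
  rewrite opprD addrA; apply: normr_sub3; first exact: sinF_le1.
    exact: b1 (cosF_le1 F _) (sinF_le1 F _).
  exact: b1 (sinF_le1 F _) (cosF_le1 F _).
have jRe := integrableZl mc (2 * c) iRe; have jIm := integrableZl mc (2 * s) iIm.
have -> : 2 * c * (\int[collision_measure hb eps]_(x in cap eps) wRe (sg x)) -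
    2 * s * (\int[collision_measure hb eps]_(x in cap eps) wIm (sg x)) =
  \int[collision_measure hb eps]_(x in cap eps)
    (2 * c * wRe (sg x) - 2 * s * wIm (sg x)).
  rewrite -(RintegralZl (2 * c) mc iRe) -(RintegralZl (2 * s) mc iIm).
  by rewrite -(RintegralB mc jRe jIm).
apply: le_trans (HB eps eI ee); apply: le_Rintegral => //.
- exact: (integrableB mc jRe jIm).
- apply: (@collision_integrable _ _ hb eps _ 2) => //; first exact: measurable_gain.
  by move=> x _; exact: gain_bound.
- by move=> x _; exact: two_Re_le.
Unshelve. all: by end_near. Qed.

End CollisionInequality.

(** * Geometry of the collision and averages over the azimuth *)

Section CollisionGeometry.
Context {R : realType}.
Implicit Types (x xi e : R3 R).

Lemma xi_unit xi : xi != 0 -> xi = scale3 (norm3 xi) (scale3 (norm3 xi)^-1 xi).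
Proof.
rewrite -norm3_gt0 => n0; case: xi n0 => -[a b] c n0.
rewrite /scale3/=; set n := norm3 _ in n0 *.
by congr (_, _, _); rewrite mulrA divff ?mul1r// gt_eqF.
Qed.

Lemma dot3_comb (n sg : R) e x :
  dot3 (scale3 2^-1 (scale3 n e) + scale3 (sg * (n / 2)) x)
     (scale3 2^-1 (scale3 n e) + scale3 (sg * (n / 2)) x) =
   n ^+ 2 / 4 * (dot3 e e + 2 * sg * dot3 e x + sg ^+ 2 * dot3 x x).
Proof. by rewrite /dot3 /scale3/=; field. Qed.

(** The four points are the quarter turns of [x] about the third axis. Their sum kills the terms
    linear in the horizontal part and the mixed products, and leaves only the values of the form on
    the three axes. *)
Lemma qval_comb_sum4 (A : qform) (n : R) e1 e2 e3 x :
  let q y := qval A (scale3 2^-1 (scale3 n e3) + scale3 (n / 2) (frame e1 e2 e3 y)) in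
  q (x.1.1, x.1.2, x.2) + q (- x.1.2, x.1.1, x.2) +
  q (- x.1.1, - x.1.2, x.2) + q (x.1.2, - x.1.1, x.2) =
    n ^+ 2 / 4 * (2 * (dot3 x x - x.2 ^+ 2) * (qval A e1 + qval A e2) +
      4 * (1 + x.2) ^+ 2 * qval A e3).
Proof. by rewrite /qval /dot3 /frame /scale3/=; field. Qed.

Lemma qval_scale3 (A : qform) (n : R) x : qval A (scale3 n x) = n ^+ 2 * qval A x.
Proof. by rewrite /qval /scale3/=; ring. Qed.

(** The two factors are cos^2(theta/2) and sin^2(theta/2). *)
Lemma collision_dot3 xi e1 e2 x : xi != 0 ->
  let e3 := scale3 (norm3 xi)^-1 xi in
  orthonormal3 e1 e2 e3 -> dot3 x x = 1 ->
  dot3 (xip xi (frame e1 e2 e3 x)) (xip xi (frame e1 e2 e3 x)) =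
    dot3 xi xi * ((1 + x.2) / 2) /\
  dot3 (xim xi (frame e1 e2 e3 x)) (xim xi (frame e1 e2 e3 x)) =
    dot3 xi xi * ((1 - x.2) / 2).
Proof.
move=> xi0 e3 onb xx; rewrite /xip /xim.
have e33 : dot3 e3 e3 = 1 by case: onb => -[].
have h1 := dot3_frame x onb; have h2 := dot3_frame2 x onb.
have Hx : scale3 2^-1 xi = scale3 2^-1 (scale3 (norm3 xi) e3) by rewrite -xi_unit.
rewrite Hx -(norm3_sqr xi); set n := norm3 xi; set s := frame e1 e2 e3 x in h1 h2 *.
split.
  have := dot3_comb n 1 e3 s; rewrite mul1r => ->; rewrite e33 h1 h2 xx.
  by move: (n) (x.2) => m y; clear; field.
have -> : scale3 2^-1 (scale3 n e3) - scale3 (n / 2) s =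
   scale3 2^-1 (scale3 n e3) + scale3 (-1 * (n / 2)) s.
  by rewrite /scale3/= !mulN1r !mulNr.
rewrite dot3_comb e33 h1 h2 xx.
by move: (n) (x.2) => m y; clear; field.
Qed.

Lemma qval_trace (A : qform) e1 e2 e3 : orthonormal3 e1 e2 e3 ->
  qval A e1 + qval A e2 + qval A e3 = qtrace A.
Proof.
move=> [_ _ [h1 h2 h3] [h12 h13 h23]].
transitivity (q11 A * (e1.1.1 ^+ 2 + e2.1.1 ^+ 2 + e3.1.1 ^+ 2) +
    q22 A * (e1.1.2 ^+ 2 + e2.1.2 ^+ 2 + e3.1.2 ^+ 2) +
    q33 A * (e1.2 ^+ 2 + e2.2 ^+ 2 + e3.2 ^+ 2) +
    2 * (q12 A * (e1.1.1 * e1.1.2 + e2.1.1 * e2.1.2 + e3.1.1 * e3.1.2) +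
     q13 A * (e1.1.1 * e1.2 + e2.1.1 * e2.2 + e3.1.1 * e3.2) +
     q23 A * (e1.1.2 * e1.2 + e2.1.2 * e2.2 + e3.1.2 * e3.2))).
  by rewrite /qval; ring.
by rewrite h1 h2 h3 h12 h13 h23 /qtrace; ring.
Qed.

(** The second term is the spreading effect: transversally to xi the form is seen through its trace
    minus its value along xi, whatever its degeneracy in the direction xi. *)
Lemma qval_sum4 (A : qform) xi e1 e2 x : xi != 0 ->
  let e3 := scale3 (norm3 xi)^-1 xi in
  orthonormal3 e1 e2 e3 -> dot3 x x = 1 ->
  let Q y := qval A (xip xi (frame e1 e2 e3 y)) in
  let u := (1 - x.2) / 2 in
  Q (x.1.1, x.1.2, x.2) + Q (- x.1.2, x.1.1, x.2) +
  Q (- x.1.1, - x.1.2, x.2) + Q (x.1.2, - x.1.1, x.2) =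
  4 * ((1 - u) ^+ 2 * qval A xi + u * (1 - u) * (dot3 xi xi * qtrace A - qval A xi) / 2).
Proof.
move=> xi0 e3 onb xx Q u.
have tr := qval_trace A onb.
have Qxi : qval A xi = norm3 xi ^+ 2 * qval A e3 by rewrite {1}(xi_unit xi0) qval_scale3.
have Hx : scale3 2^-1 xi = scale3 2^-1 (scale3 (norm3 xi) e3) by rewrite -xi_unit.
rewrite Qxi -(norm3_sqr xi) -tr /Q /xip Hx qval_comb_sum4 xx /u.
by move: (norm3 xi) (qval A e1) (qval A e2) (qval A e3) (x.2) => n a1 a2 a3 z; clear; field.
Qed.

Lemma rotz_pihalf x : rotz (pi / 2) x = (- x.1.2, x.1.1, x.2).
Proof.
by rewrite /rotz cos_pihalf sin_pihalf !mulr0 !mulr1 sub0r addr0.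
Qed.

End CollisionGeometry.

Section CollisionAverage.
Context {R : realType}.
Variable b : R -> R.
Hypothesis hb : cross_section b.
Notation nu := (collision_measure hb).

Lemma measurable_qval (A : qform) : measurable_fun setT (@qval R A).
Proof.
have [[m1 m2] m3] := (@measurable_c1 R, @measurable_c2 R, @measurable_c3 R).
have m11 := measurable_funX 2 m1; have m22 := measurable_funX 2 m2.
have m33 := measurable_funX 2 m3; have m12 := measurable_funM m1 m2.
have m13 := measurable_funM m1 m3; have m23 := measurable_funM m2 m3.
have k (c : R) (h : R3 R -> R) : measurable_fun setT h ->
  measurable_fun setT (fun x => c * h x) by move=> mh; exact: measurable_funM.
apply: measurable_funD; first exact: measurable_funD (measurable_funD (k _ _ m11) (k _ _ m22)) (k _ _ m33).
apply: (k 2); exact: measurable_funD (measurable_funD (k _ _ m12) (k _ _ m13)) (k _ _ m23).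
Qed.

(** Invariance under quarter turns replaces the integrand by a sum over four points, in which the
    terms of order theta cancel for the quadratic barrier. *)
Lemma collision_integral_average (eps : R) (P : R3 R -> R) :
  0 < eps <= pi / 2 -> measurable_fun setT P ->
  (exists M : R, forall x, cap eps x -> `|P x| <= M) ->
  4 * \int[nu eps]_(x in cap eps) P x = \int[nu eps]_(x in cap eps)
    (P (x.1.1, x.1.2, x.2) + P (- x.1.2, x.1.1, x.2) +
     P (- x.1.1, - x.1.2, x.2) + P (x.1.2, - x.1.1, x.2)).
Proof.
move=> e0 mP bP; have mc := @measurable_cap R eps.
have rE (x : R3 R) : rotz (pi / 2) x = (- x.1.2, x.1.1, x.2) by exact: rotz_pihalf.
pose P1 x := P (rotz (pi / 2) x); pose P2 x := P1 (rotz (pi / 2) x).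
pose P3 x := P2 (rotz (pi / 2) x).
have mr := measurable_rotz (pi / 2 : R).
have m1 : measurable_fun setT P1 by exact: (measurableT_comp mP mr).
have m2 : measurable_fun setT P2 by exact: (measurableT_comp m1 mr).
have m3 : measurable_fun setT P3 by exact: (measurableT_comp m2 mr).
have capr x : cap eps x -> cap eps (rotz (pi / 2) x).
  by rewrite /cap/= rE/= => -[<- ?]; split => //; rewrite /dot3/=; ring.
have J1 : \int[nu eps]_(x in cap eps) P1 x = \int[nu eps]_(x in cap eps) P x.
  exact: collision_integral_rotz.
have J2 : \int[nu eps]_(x in cap eps) P2 x = \int[nu eps]_(x in cap eps) P1 x.
  exact: collision_integral_rotz.
have J3 : \int[nu eps]_(x in cap eps) P3 x = \int[nu eps]_(x in cap eps) P2 x.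
  exact: collision_integral_rotz.
have ib (h : R3 R -> R) : measurable_fun setT h -> (exists M : R, forall x, cap eps x -> `|h x| <= M) ->
    (nu eps).-integrable (cap eps) (EFin \o h).
  by move=> mh [M hM]; exact: collision_integrable hM.
have [M PM] := bP.
have b1 x : cap eps x -> `|P1 x| <= M by move=> cx; apply: PM; exact: capr.
have b2 x : cap eps x -> `|P2 x| <= M by move=> cx; apply: b1; exact: capr.
have b3 x : cap eps x -> `|P3 x| <= M by move=> cx; apply: b2; exact: capr.
have i0 := ib _ mP (ex_intro _ M PM).
have i1 := ib _ m1 (ex_intro _ M b1).
have i2 := ib _ m2 (ex_intro _ M b2).
have i3 := ib _ m3 (ex_intro _ M b3).
have i01 := integrableD mc i0 i1; have i012 := integrableD mc i01 i2.
transitivity (\int[nu eps]_(x in cap eps) (P x + P1 x + P2 x + P3 x)).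
  rewrite RintegralD; [|exact: mc|exact: i012|exact: i3].
  rewrite RintegralD; [|exact: mc|exact: i01|exact: i2].
  rewrite RintegralD; [|exact: mc|exact: i0|exact: i1].
  by rewrite J3 J2 J1; ring.
apply: eq_Rintegral => -[[x y] z] _; rewrite /P3 /P2 /P1 !rE/= opprK.
by congr (_ + _ + _ + _); rewrite !rE/=.
Qed.

End CollisionAverage.

Section Continuity.
Context {R : realType}.
Implicit Types (x xi : R3 R).

(** Only earlier times are compared, since the maximum may be reached at the final time. *)
Lemma left_derivative_ge0 (h : R -> R) (a t d : R) : a < t ->
  is_derive t 1 h d -> (forall u, a <= u < t -> h u <= h t) -> 0 <= d.
Proof.
move=> at_ dh hmax; rewrite leNgt; apply/negP => d0.
have [dv dE] := dh; move: dv; rewrite /derivable => /cvg_ex[l cl].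
have ld : l = d.
  by rewrite -dE; apply/esym/cvg_lim.
rewrite ld in cl.
have := cvgr_lt _ cl _ d0.
move=> [e /= e0 He].
(* A backward step that stays both in the neighbourhood and in [a, t]. *)
pose k := - (Num.min (e / 2) (t - a)).
have k0 : k < 0 by rewrite oppr_lt0 lt_min subr_gt0 at_ divr_gt0.
have ka : - k <= t - a by rewrite opprK ge_min lexx orbT.
have ke : - k <= e / 2 by rewrite opprK ge_min lexx.
have := He k; rewrite /ball/= sub0r normrN ltr0_norm// => /(_ ltac:(lra)) /(_ ltac:(by rewrite lt_eqF)).
rewrite /GRing.scale/= mulr1 nmulr_rlt0 ?invr_lt0// subr_gt0 addrC.
by apply/negP; rewrite -leNgt; apply: hmax; apply/andP; split; lra.
Qed.

Lemma continuous_norm3_sub (xi : R * R * R) :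
  continuous (fun x : R * R * R => norm3 (xi - x : R3 R)).
Proof.
move=> x; apply: (@continuous_comp _ _ _ (fun y : R * R * R =>
  dot3 (xi - y : R3 R) (xi - y)) Num.sqrt); last exact: sqrt_continuous.
have c1 : {for x, continuous (fun y : R * R * R => xi.1.1 - y.1.1)}.
  apply: cvgB; first exact: cvg_cst.
  by apply: (@continuous_comp _ _ _ fst fst); exact: cvg_fst.
have c2 : {for x, continuous (fun y : R * R * R => xi.1.2 - y.1.2)}.
  apply: cvgB; first exact: cvg_cst.
  by apply: (@continuous_comp _ _ _ fst snd); [exact: cvg_fst|exact: cvg_snd].
have c3 : {for x, continuous (fun y : R * R * R => xi.2 - y.2)}.
  by apply: cvgB; [exact: cvg_cst|exact: cvg_snd].
by apply: cvgD; first apply: cvgD; apply: cvgM.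
Qed.

Lemma norm3_le_sub (x y : R3 R) : norm3 y <= norm3 x + norm3 (x - y).
Proof.
have n0 : 0 <= norm3 x + norm3 (x - y) by rewrite addr_ge0 ?norm3_ge0.
rewrite -(@ler_pXn2r _ 2) ?nnegrE ?norm3_ge0// sqrrD !norm3_sqr.
have H : `|dot3 x (x - y)| <= norm3 x * norm3 (x - y) by exact: normr_dot3_le.
have : - dot3 x (x - y) <= norm3 x * norm3 (x - y).
  by apply: le_trans H; rewrite -normrN ler_norm.
rewrite -mulr_natl.
have -> : dot3 y y = dot3 x x - 2 * dot3 x (x - y) + dot3 (x - y) (x - y).
  by rewrite /dot3/=; ring.
lra.
Qed.

Lemma near_norm3 (xi : R * R * R) (d : R) : 0 < d ->
  \forall x \near xi, norm3 (xi - x : R3 R) < d.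
Proof.
move=> d0; have := @continuous_norm3_sub xi xi.
move=> /cvgr_lt; apply.
by rewrite subrr /norm3 /dot3 !mulr0 !addr0 sqrtr0.
Qed.

Variables (alpha : R) (f : R -> probability (R3 R) R).
Hypothesis alpha0 : 0 <= alpha.
Hypothesis cf : continuous_calKa alpha (fun t => charf (f t)).

Lemma distK_le (F G : probability (R3 R) R) (xi : R3 R) (D : R) :
  (distK alpha (charf F) (charf G) <= D%:E)%E -> xi != 0 ->
  `|cosF F xi - cosF G xi| <= D * norm3 xi `^ alpha /\
  `|sinF F xi - sinF G xi| <= D * norm3 xi `^ alpha.
Proof.
move=> HD xi0; have n0 : 0 < norm3 xi by rewrite norm3_gt0.
have P0 := powR_gt0 alpha n0.
have H : ComplexField.Normc.normc (charf F xi - charf G xi) <= D * norm3 xi `^ alpha.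
  rewrite -ler_pdivrMr// -lee_fin; apply: le_trans HD.
  by apply: ereal_sup_ubound; exists xi.
have E : ComplexField.Normc.normc (charf F xi - charf G xi) =
  Num.sqrt ((cosF F xi - cosF G xi) ^+ 2 + (sinF F xi - sinF G xi) ^+ 2).
  rewrite /ComplexField.Normc.normc /charf/= -!/(cosF _ _) -!/(sinF _ _).
  by congr Num.sqrt; ring.
rewrite E in H; split; apply: le_trans H; rewrite -sqrtr_sqr ler_sqrt ?addr_ge0 ?sqr_ge0//.
  by rewrite lerDl sqr_ge0.
by rewrite lerDr sqr_ge0.
Qed.

Lemma time_near (t0 e : R) : 0 <= t0 -> 0 < e ->
  exists2 d : R, 0 < d & forall t, 0 <= t -> `|t - t0| < d ->
    (distK alpha (charf (f t)) (charf (f t0)) <= e%:E)%E.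
Proof.
move=> t00 e0; have [_ /(_ t0 t00)] := cf.
move=> /fine_cvgP[Hfin /cvgr_lt/(_ e e0) Hlt].
have [d /= d0 Hd] : \forall t \near t0, 0 <= t ->
    (distK alpha (charf (f t)) (charf (f t0)) <= e%:E)%E.
  have : \forall t \near within [set t | 0 <= t] (nbhs t0),
      (distK alpha (charf (f t)) (charf (f t0)) <= e%:E)%E.
    near=> t.
    have F1 : distK alpha (charf (f t)) (charf (f t0)) \is a fin_num by near: t.
    have F2 : fine (distK alpha (charf (f t)) (charf (f t0))) < e by near: t.
    by rewrite -(fineK F1) lee_fin ltW.
  by rewrite near_withinE.
exists d => // t t1 td; apply: Hd => //=.
by rewrite distrC.
Unshelve. all: by end_near. Qed.

(** The space variable moves first at a fixed time, by uniform continuity. Then time moves, where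
    the metric bounds the difference by D |xi|^alpha, at most e/2 on the ball of radius [M]. The
    absolute value extends the family to negative times, so that continuity at 0 is two-sided. *)
Lemma trig_joint_cvg (p0 : R * (R * R * R)) (e : R) : 0 < e ->
  \forall p \near p0,
   `|cosF (f `|p0.1|) p0.2 - cosF (f `|p.1|) p.2| <= e /\
   `|sinF (f `|p0.1|) p0.2 - sinF (f `|p.1|) p.2| <= e.
Proof.
move=> e0; have e2 : 0 < e / 2 by lra.
have [d1 d10 H1] := @trigF_unif R (f `|p0.1|) cos (e / 2) (@lipschitz_cos R) (@cos_max R) measurable_cosT e2.
have [d2 d20 H2] := @trigF_unif R (f `|p0.1|) sin (e / 2) (@lipschitz_sin R) (@sin_max R) measurable_sinT e2.
pose M := norm3 (p0.2 : R3 R) + 1.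
have M1 : 0 <= M by rewrite addr_ge0 ?norm3_ge0.
pose D := e / 2 / (M `^ alpha + 1).
have MP : 0 < M `^ alpha + 1 by rewrite ltr_wpDl ?powR_ge0.
have D0 : 0 < D by rewrite divr_gt0.
have [d d0 Hd] := @time_near `|p0.1| D (normr_ge0 _) D0.
pose dd := Num.min 1 (Num.min d1 d2).
have dd0 : 0 < dd by rewrite !lt_min ltr01 d10 d20.
have N1 : \forall p \near p0, norm3 (p0.2 - p.2 : R3 R) < dd.
  have /= := near_norm3 p0.2 dd0.
  exact: (@cvg_snd _ _ (nbhs p0.1) (nbhs p0.2) _).
have N2 : \forall p \near p0, `|p0.1 - p.1| < d.
  have : \forall t \near p0.1, `|p0.1 - t| < d by exists d.
  exact: (@cvg_fst _ _ (nbhs p0.1) (nbhs p0.2) _).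
near=> p.
have n1 : norm3 (p0.2 - p.2 : R3 R) < dd by near: p.
have n2 : `|p0.1 - p.1| < d by near: p.
move: n1; rewrite !lt_min => /and3P[n11 n12 n13].
have td : Num.norm (`|p.1| - `|p0.1|) < d.
  by apply: le_lt_trans n2; rewrite (distrC p0.1); exact: ler_dist_dist.
have HD := Hd `|p.1| (normr_ge0 _) td.
have T : `|cosF (f `|p.1|) p.2 - cosF (f `|p0.1|) p.2| <= e / 2 /\
         `|sinF (f `|p.1|) p.2 - sinF (f `|p0.1|) p.2| <= e / 2.
  (* [distK] says nothing at the origin, where all characteristic functions are 1. *)
  have [->|xi0] := eqVneq (p.2 : R3 R) 0.
    by rewrite !cosF0 !sinF0 !subrr normr0; split; exact: ltW.
  have [A1 A2] := distK_le HD xi0.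
  suff S : D * norm3 (p.2 : R3 R) `^ alpha <= e / 2 by split; [exact: le_trans A1 S|exact: le_trans A2 S].
  have nM : norm3 (p.2 : R3 R) <= M.
    have tri : norm3 (p.2 : R3 R) <= norm3 (p0.2 : R3 R) + norm3 (p0.2 - p.2 : R3 R).
      exact: norm3_le_sub.
    by rewrite (le_trans tri)// lerD2l ltW.
  have PM : norm3 (p.2 : R3 R) `^ alpha <= M `^ alpha.
    by apply: ge0_ler_powR; rewrite ?nnegrE ?norm3_ge0.
  rewrite (@le_trans _ _ (D * (M `^ alpha + 1)))//.
    by rewrite ler_wpM2l ?(ltW D0)// (le_trans PM)// lerDl.
  by rewrite /D divfK// gt_eqF.
have [T1 T2] := T.
split.
- rewrite (_ : _ - _ = (cosF (f `|p0.1|) p0.2 - cosF (f `|p0.1|) p.2) -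
     (cosF (f `|p.1|) p.2 - cosF (f `|p0.1|) p.2)); last by ring.
  rewrite (le_trans (ler_normB _ _))// [leRHS](splitr e) lerD//.
  by apply: H1; exact: ltW.
- rewrite (_ : _ - _ = (sinF (f `|p0.1|) p0.2 - sinF (f `|p0.1|) p.2) -
     (sinF (f `|p.1|) p.2 - sinF (f `|p0.1|) p.2)); last by ring.
  rewrite (le_trans (ler_normB _ _))// [leRHS](splitr e) lerD//.
  by apply: H2; exact: ltW.
Unshelve. all: by end_near. Qed.

Lemma continuous_qF :
  continuous (fun p : R * (R * R * R) => qF (f `|p.1|) p.2).
Proof.
move=> p0.
have c1 : (fun p : R * (R * R * R) => cosF (f `|p.1|) p.2) @ p0 --> cosF (f `|p0.1|) p0.2.
  by apply/cvgrPdist_le => e e0; apply: filterS (trig_joint_cvg p0 e0) => p [].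
have c2 : (fun p : R * (R * R * R) => sinF (f `|p.1|) p.2) @ p0 --> sinF (f `|p0.1|) p0.2.
  by apply/cvgrPdist_le => e e0; apply: filterS (trig_joint_cvg p0 e0) => p [].
rewrite /qF; apply: cvgD; rewrite ?expr2; first exact: (cvgM c1 c1).
exact: (cvgM c2 c2).
Qed.

End Continuity.

Section LowerBarrier.
Context {R : realType}.
Variable b : R -> R.
Hypothesis hb : cross_section b.
Notation nu := (collision_measure hb).

Lemma cap_u (eps : R) (x : R3 R) : cap eps x -> 0 <= (1 - x.2) / 2 <= 2^-1.
Proof. by move=> [_ /andP[x0 x1]]; have := @cos_le1 R eps; lra. Qed.

Lemma cap_height (eps : R) (x : R3 R) : cap eps x -> dot3 x x = 1 /\ 0 <= (x.2 : R) <= 1.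
Proof. by move=> cx; have := cap_u cx; move: cx => [xx /andP[x0 _]]; split => //; lra. Qed.

Lemma collision_u_integrable (eps : R) : 0 < eps <= pi / 2 ->
  (nu eps).-integrable (cap eps) (EFin \o (fun x : R3 R => (1 - x.2) / 2)).
Proof.
move=> e0; apply: (@collision_integrable _ _ hb eps _ 1) => //.
  by apply: measurable_funM => //; apply: measurable_funB => //; exact: measurable_c3.
by move=> x /cap_u => H; rewrite ler_norml; lra.
Qed.

Lemma add_le_sub (p q r c d : R) : r + q <= c + d -> p <= q -> p - d <= c - r.
Proof. lra. Qed.

(** [T] stands for |xi|^2 times the trace and [u] for sin^2(theta/2). The negative term in [T] is
    the spreading effect; its coefficient 1/4 comes from 1 - u >= 1/2. *)
Lemma quadratic_pointwise (Q T u : R) : 0 <= Q -> 0 <= T -> 0 <= u <= 2^-1 ->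
  Q - ((1 - u) ^+ 2 * Q + u * (1 - u) * (T - Q) / 2) <= (5 / 2 * Q - T / 4) * u.
Proof.
move=> Q0 T0 /andP[u0 u1]; rewrite -subr_ge0.
rewrite (_ : _ - _ = 3 / 2 * Q * u ^+ 2 + T * u * (2^-1 - u) / 2); last by field.
have H1 : 0 <= 3 / 2 * Q * u ^+ 2 by rewrite mulr_ge0 ?sqr_ge0// mulr_ge0.
by rewrite addr_ge0// divr_ge0// mulr_ge0 ?subr_ge0// mulr_ge0.
Qed.

(** A crude bound that serves integrability on [cap]. *)
Lemma quadratic_pointwise_ub (Q T D u E kp g : R) : 0 <= Q -> 0 <= T -> 0 <= D ->
  0 <= E -> 0 <= kp -> 0 <= g -> 0 <= u <= 2^-1 ->
  4 * (E * (kp * ((1 - u) ^+ 2 * Q + u * (1 - u) * (T - Q) / 2) + g * (D * (1 - u)))) <=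
  4 * (E * (kp * Q + g * D) + E * (kp * T)).
Proof.
move=> Q0 T0 D0 E0 kp0 g0 /andP[u0 u1].
have H : (1 - u) ^+ 2 * Q + u * (1 - u) * (T - Q) / 2 <= Q + T.
  rewrite -subr_ge0.
  rewrite (_ : _ - _ = Q * (u * (2 - u) + u * (1 - u) / 2) + T * (1 - u * (1 - u) / 2)); last by field.
  have u2 : 0 <= u * (1 - u) <= 1 by rewrite mulr_ge0 ?mulr_ile1//; lra.
  have u3 : 0 <= u * (2 - u) by rewrite mulr_ge0//; lra.
  by rewrite addr_ge0// mulr_ge0//; lra.
have H2 : g * (D * (1 - u)) <= g * D by rewrite ler_wpM2l// ler_piMr//; lra.
have H3 := ler_wpM2l kp0 H.
rewrite ler_pM2l// -mulrDr ler_wpM2l//.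
move: H3 H2; move: (kp * (_ + _ / 2)) => X; rewrite mulrDr.
move: (g * (D * (1 - u))) (kp * Q) (kp * T) (g * D) => a b' c d; lra.
Qed.

Lemma barrier_pointwise (Q X T D u E kp g : R) : 0 <= E -> 0 <= kp ->
  Q - X <= (5 / 2 * Q - T / 4) * u ->
  4 * (E * (kp * Q + g * D)) - 4 * (E * (kp * X + g * (D * (1 - u)))) <=
  4 * (E * (kp * (5 / 2 * Q - T / 4) + g * D)) * u.
Proof.
move=> E0 kp0 H; rewrite -subr_ge0.
rewrite (_ : _ - _ = 4 * (E * (kp * ((5 / 2 * Q - T / 4) * u - (Q - X))))); last by field.
by rewrite !mulr_ge0// subr_ge0.
Qed.

(** The coefficient of [J] has no definite sign: its positive part is estimated with [k], its
    negative part with [m]. *)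
Lemma barrier_total (Q tr D E kp g J k m : R) : 0 <= E -> 0 <= kp -> 0 <= g ->
  0 <= Q -> 0 <= tr -> 0 <= D -> m <= J <= k ->
  4 * (E * (kp * (5 / 2 * Q - D * tr / 4) + g * D)) * J <=
  4 * (E * ((5 / 2 * kp * Q + g * D) * k - kp * D * tr * m / 4)).
Proof.
move=> E0 kp0 g0 Q0 tr0 D0 /andP[Jm Jk].
rewrite (_ : 4 * _ * J = 4 * (E * ((5 / 2 * kp * Q + g * D) * J - kp * D * tr / 4 * J))); last by field.
rewrite ler_pM2l// ler_wpM2l// lerB//.
  by rewrite ler_wpM2l// addr_ge0// ?mulr_ge0.
rewrite (_ : kp * D * tr * m / 4 = kp * D * tr / 4 * m); last by field.
by rewrite ler_wpM2l// ?divr_ge0// !mulr_ge0.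
Qed.

Lemma xip_le (xi e1 e2 x : R3 R) : xi != 0 ->
  orthonormal3 e1 e2 (scale3 (norm3 xi)^-1 xi) -> dot3 x x = 1 -> x.2 <= 1 ->
  norm3 (xip xi (frame e1 e2 (scale3 (norm3 xi)^-1 xi) x)) <= norm3 xi.
Proof.
move=> xi0 onb xx x1; rewrite /norm3 ler_sqrt ?dot3_ge0//.
have [-> _] := collision_dot3 xi0 onb xx.
by rewrite ler_piMr ?dot3_ge0//; lra.
Qed.

(** At a point where q plus the barrier is maximal over the ball |y| <= |xi|, the factor q(xi^-) <=
    1 is dropped, and q(xi^+) - q(xi) is at most the decrease of the barrier from xi to xi^+. *)
Lemma quadratic_barrier_gain (F : probability (R3 R) R) (A : qform)
    (kp g E k m eps : R) (xi e1 e2 : R3 R) :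
  0 <= kp -> 0 <= g -> 0 <= E -> (forall y : R3 R, 0 <= qval A y) -> 0 <= qtrace A ->
  0 < eps <= pi / 2 -> xi != 0 -> collision_frame xi e1 e2 ->
  m <= \int[nu eps]_(x in cap eps) ((1 - x.2) / 2) <= k ->
  (forall y : R3 R, norm3 y <= norm3 xi ->
    E * (kp * qval A y + g * dot3 y y) + qF F y <=
    E * (kp * qval A xi + g * dot3 xi xi) + qF F xi) ->
  \int[nu eps]_(x in cap eps) gain F xi e1 e2 x <=
    E * ((5 / 2 * kp * qval A xi + g * dot3 xi xi) * k -
      kp * dot3 xi xi * qtrace A * m / 4).
Proof.
move=> kp0 g0 E0 A0 tr0 eI xi0 [onb inv] /andP[Jm Jk] Hmax.
have mc := @measurable_cap R eps.
set e3 := scale3 (norm3 xi)^-1 xi in onb inv.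
pose be (y : R3 R) : R := E * (kp * qval A y + g * dot3 y y).
pose pt x := xip xi (frame e1 e2 e3 x).
pose P x := be xi - be (pt x).
have mpt : measurable_fun setT pt.
  exact: (measurableT_comp (measurable_xip xi) (measurable_frame _ _ _)).
have mbe : measurable_fun setT be.
  apply: measurable_funM => //; apply: measurable_funD; apply: measurable_funM => //.
    exact: measurable_qval.
  exact: measurable_dot33.
have mP : measurable_fun setT P.
  by apply: measurable_funB => //; exact: (measurableT_comp mbe mpt).
have be0 y : 0 <= be y by rewrite mulr_ge0// addr_ge0// mulr_ge0// dot3_ge0.
have capI := @cap_height eps.
have ptdot (x : R3 R) : cap eps x -> dot3 (pt x) (pt x) = dot3 xi xi * (1 - (1 - x.2) / 2).
  move=> /capI[xx _]; rewrite /pt; have [-> _] := collision_dot3 xi0 onb xx.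
  by move: (dot3 xi xi) (x.2) => D z; clear; field.
have sum4 (x : R3 R) : cap eps x ->
    be (pt (x.1.1, x.1.2, x.2)) + be (pt (- x.1.2, x.1.1, x.2)) +
    be (pt (- x.1.1, - x.1.2, x.2)) + be (pt (x.1.2, - x.1.1, x.2)) =
    4 * (E * (kp * ((1 - (1 - x.2) / 2) ^+ 2 * qval A xi +
      (1 - x.2) / 2 * (1 - (1 - x.2) / 2) * (dot3 xi xi * qtrace A - qval A xi) / 2) +
      g * (dot3 xi xi * (1 - (1 - x.2) / 2)))).
  move=> cx; have [xx x01] := capI _ cx.
  have c1 : cap eps (x.1.1, x.1.2, x.2) by move: cx; rewrite /cap/= /dot3/=.
  have c2 : cap eps (- x.1.2, x.1.1, x.2).
    by move: cx; rewrite /cap/= /dot3/= => -[<- ->]; split => //; ring.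
  have c3 : cap eps (- x.1.1, - x.1.2, x.2).
    by move: cx; rewrite /cap/= /dot3/= => -[<- ->]; split => //; ring.
  have c4 : cap eps (x.1.2, - x.1.1, x.2).
    by move: cx; rewrite /cap/= /dot3/= => -[<- ->]; split => //; ring.
  have H := qval_sum4 A xi0 onb xx.
  rewrite /be (ptdot _ c1) (ptdot _ c2) (ptdot _ c3) (ptdot _ c4)/=.
  move: H; rewrite /= -/e3 -!/(pt _).
  set u := (1 - x.2) / 2; set a1 := qval A (pt _); set a2 := qval A (pt _).
  set a3 := qval A (pt _); set a4 := qval A (pt _) => H.
  transitivity (E * (kp * (a1 + a2 + a3 + a4) + 4 * (g * (dot3 xi xi * (1 - u))))).
    by move: (a1) (a2) (a3) (a4) (u) (dot3 xi xi) => *; ring.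
  by rewrite H; move: (u) (dot3 xi xi) (qval A xi) (qtrace A) => *; ring.
pose U := be xi + E * (kp * (dot3 xi xi * qtrace A)).
have bP x : cap eps x -> `|P x| <= be xi + 4 * U.
  move=> cx; have H := sum4 x cx; have cu := cap_u cx.
  have B1 := be0 (pt (x.1.1, x.1.2, x.2)).
  have B2 := be0 (pt (- x.1.2, x.1.1, x.2)).
  have B3 := be0 (pt (- x.1.1, - x.1.2, x.2)).
  have B4 := be0 (pt (x.1.2, - x.1.1, x.2)).
  have B0 := be0 xi.
  have Le : be (pt x) <= 4 * U.
    apply: le_trans (quadratic_pointwise_ub (A0 xi) (mulr_ge0 (dot3_ge0 xi) tr0)
      (dot3_ge0 xi) E0 kp0 g0 cu).
    by rewrite -H; move: (x) B1 B2 B3 B4 => -[[x1 x2] x3]/= B1 B2 B3 B4; rewrite -!addrA lerDl !addr_ge0.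
  rewrite /P ler_norml; have B5 := be0 (pt x).
  move: (be (pt x)) (be xi) U Le B5 B0 => a c V; clear; lra.
have iP : (nu eps).-integrable (cap eps) (EFin \o P).
  exact: (@collision_integrable _ _ hb eps _ (be xi + 4 * U)).
have ig : (nu eps).-integrable (cap eps) (EFin \o gain F xi e1 e2).
  apply: (@collision_integrable _ _ hb eps _ 2) => //; first exact: measurable_gain.
  by move=> x _; exact: gain_bound.
have J1 : \int[nu eps]_(x in cap eps) gain F xi e1 e2 x <= \int[nu eps]_(x in cap eps) P x.
  apply: le_Rintegral => // x cx; have [xx /andP[x0 x1]] := capI _ cx.
  have := Hmax _ (xip_le xi0 onb xx x1); rewrite -/e3 -/(pt x) -!/(be _) => Hm.
  rewrite /gain /P -/e3 -/(pt x).
  have : qF F (pt x) * qF F (xim xi (frame e1 e2 e3 x)) <= qF F (pt x).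
    by rewrite ler_piMr ?qF_ge0 ?qF_le1.
  exact: add_le_sub Hm.
apply: (le_trans J1).
(* Only after passing to the sum over quarter turns is the integrand bounded by a multiple of u,
   uniformly in [eps]. *)
rewrite -(@ler_pM2l _ 4)// (collision_integral_average hb eI mP (ex_intro _ _ bP)).
pose co : R := E * (kp * (5 / 2 * qval A xi - dot3 xi xi * qtrace A / 4) + g * dot3 xi xi).
have iu := collision_u_integrable eI.
pose x4 (x : R3 R) := P (x.1.1, x.1.2, x.2) + P (- x.1.2, x.1.1, x.2) +
     P (- x.1.1, - x.1.2, x.2) + P (x.1.2, - x.1.1, x.2).
have x4E (x : R3 R) : cap eps x -> x4 x = 4 * be xi - 4 * (E * (kp * ((1 - (1 - x.2) / 2) ^+ 2 * qval A xi +
      (1 - x.2) / 2 * (1 - (1 - x.2) / 2) * (dot3 xi xi * qtrace A - qval A xi) / 2) +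
      g * (dot3 xi xi * (1 - (1 - x.2) / 2)))).
  move=> cx; rewrite -(sum4 x cx) /x4 /P.
  move: (be xi) (be _) (be _) (be _) (be _) => a0 a1 a2 a3 a4; clear; ring.
have mx4 : measurable_fun setT x4.
  have [[n1 n2] n3] := (@measurable_c1 R, @measurable_c2 R, @measurable_c3 R).
  have o1 : measurable_fun setT (fun x : R3 R => - x.1.1) by exact: measurableT_comp n1.
  have o2 : measurable_fun setT (fun x : R3 R => - x.1.2) by exact: measurableT_comp n2.
  by apply: measurable_funD; first apply: measurable_funD; first apply: measurable_funD;
    apply: (measurableT_comp mP); exact: measurable_triple.
have bx4 (x : R3 R) : cap eps x -> `|x4 x| <= 4 * be xi + 4 * U.
  move=> cx; have cu := cap_u cx; rewrite (x4E x cx).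
  have := quadratic_pointwise_ub (A0 xi) (mulr_ge0 (dot3_ge0 xi) tr0)
      (dot3_ge0 xi) E0 kp0 g0 cu.
  rewrite -/(be xi) -/U.
  have : 0 <= 4 * (E * (kp * ((1 - (1 - x.2) / 2) ^+ 2 * qval A xi +
      (1 - x.2) / 2 * (1 - (1 - x.2) / 2) * (dot3 xi xi * qtrace A - qval A xi) / 2) +
      g * (dot3 xi xi * (1 - (1 - x.2) / 2)))).
    by rewrite -(sum4 x cx) !addr_ge0.
  move: (4 * (E * _)) => a; have := be0 xi; rewrite ler_norml.
  by move: (be xi) (U) => c d; clear; lra.
apply: (@le_trans _ _ (\int[nu eps]_(x in cap eps) (4 * co * ((1 - x.2) / 2)))).
  apply: le_Rintegral => //.
  - exact: (@collision_integrable _ _ hb eps _ (4 * be xi + 4 * U)).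
  - exact: (integrableZl mc (4 * co) iu).
  move=> x cx; have cu := cap_u cx; rewrite -/(x4 x) (x4E x cx).
  exact: barrier_pointwise (quadratic_pointwise (A0 xi) (mulr_ge0 (dot3_ge0 xi) tr0) cu).
rewrite RintegralZl//.
by apply: barrier_total => //; [exact: dot3_ge0|apply/andP].
Qed.

End LowerBarrier.

(** * Maximum principle for the squared modulus *)

Section MaximumPrinciple.
Context {R : realType}.
Implicit Types (xi : R3 R).

Lemma continuous_norm3 : continuous (fun x : R * R * R => norm3 (x : R3 R)).
Proof.
move=> x; have := @continuous_norm3_sub R 0 x.
rewrite (_ : (fun y : R * R * R => norm3 (0 - y : R3 R)) = (fun y : R * R * R => norm3 (y : R3 R)))//.
by apply/funext => y; rewrite /norm3 /dot3/= !sub0r !mulrNN.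
Qed.

(** A positive inner radius keeps the logarithm in the upper barrier continuous; the lower barrier
    takes inner radius 0. *)
Definition slab (t0 T r1 r2 : R) : set (R * (R * R * R)) :=
  [set p | t0 <= p.1 <= T /\ r1 <= norm3 (p.2 : R3 R) <= r2].

Lemma compact_slab (t0 T r1 r2 : R) : compact (slab t0 T r1 r2).
Proof.
pose I : set R := `[- r2, r2]%classic.
apply: (@subclosed_compact _ _ (`[t0, T]%classic `*` (I `*` I `*` I))).
- pose N := fun p : R * (R * R * R) => norm3 (p.2 : R3 R).
  have cN : continuous N.
    move=> p; apply: (@continuous_comp _ _ _ snd (fun x : R * R * R => norm3 (x : R3 R))).
      exact: cvg_snd.
    exact: continuous_norm3.
  have -> : slab t0 T r1 r2 = fst @^-1` `[t0, T]%classic `&` N @^-1` `[r1, r2]%classic.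
    by apply/seteqP; split => p /=; rewrite !in_itv.
  apply: closedI; apply: preimage_closed; last 2 first.
  - by move=> p _; exact: cN.
  - exact: interval_closed.
  - by move=> p _; exact: cvg_fst.
  - exact: interval_closed.
- apply: compact_setX; first exact: segment_compact.
  by apply: compact_setX; [apply: compact_setX|]; exact: segment_compact.
- move=> [t [[x y] z]] [/= t01 /andP[_ n2]].
  have [c1 c2 c3] := norm3_coord n2.
  by rewrite /I/= !in_itv/= t01 -!ler_norml.
Qed.

Variables (b : R -> R) (alpha : R) (F0 : probability (R3 R) R) (f : R -> probability (R3 R) R).
Hypotheses (hb : cross_section b) (alpha0 : 0 <= alpha).
Hypothesis hf : boltzmann_solution b alpha F0 f.

(** At a positive maximum of q - Phi over the compact slab the time derivative is at most
    [B - dPhi < 0], whereas a maximum reached after t0 has a nonnegative one. The premise may use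
    maximality over the whole slab because [gain] is nonlocal in xi. *)
Lemma parabolic_maximum (t0 T r1 r2 : R) (Phi : R -> R3 R -> R) : 0 <= t0 ->
  (forall p, slab t0 T r1 r2 p ->
    {for p, continuous (fun p : R * (R * R * R) => Phi p.1 p.2)}) ->
  (forall (t : R) xi, slab t0 T r1 r2 (t, xi) -> Phi t xi < qF (f t) xi ->
    (forall (t' : R) xi', slab t0 T r1 r2 (t', xi') ->
      qF (f t') xi' - Phi t' xi' <= qF (f t) xi - Phi t xi) ->
    [/\ t0 < t, xi != 0 & exists dPhi B e0 : R,
      [/\ is_derive t 1 (Phi ^~ xi) dPhi, B < dPhi, 0 < e0 &
        forall e1 e2 (eps : R), collision_frame xi e1 e2 -> 0 < eps <= pi / 2 -> eps <= e0 ->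
        \int[collision_measure hb eps]_(x in cap eps) gain (f t) xi e1 e2 x <= B]]) ->
  forall (t : R) xi, slab t0 T r1 r2 (t, xi) -> qF (f t) xi <= Phi t xi.
Proof.
move=> t00 cPhi H t xi txi; rewrite leNgt; apply/negP => bad.
(* The absolute value of time matches [continuous_qF]; on the slab times are nonnegative. *)
pose Z (p : R * (R * R * R)) := qF (f `|p.1|) p.2 - Phi p.1 p.2.
have ZE (u : R) (y : R3 R) : slab t0 T r1 r2 (u, y) -> Z (u, y) = qF (f u) y - Phi u y.
  by move=> [/= /andP[u0 _] _]; rewrite /Z/= ger0_norm// (le_trans t00).
have cZ : {within slab t0 T r1 r2, continuous Z}.
  apply: continuous_in_subspaceT => p; rewrite inE => sp.
  apply: cvgB; last exact: cPhi.
  by case: hf => cf _ _; exact: (continuous_qF alpha0 cf).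
have [] := compact_EVT_max _ (@compact_slab t0 T r1 r2) cZ; first by exists (t, xi).
move=> [t1 xi1]; rewrite inE => s1 Hmax.
have Hm (t' : R) xi' : slab t0 T r1 r2 (t', xi') ->
    qF (f t') xi' - Phi t' xi' <= qF (f t1) xi1 - Phi t1 xi1.
  by move=> s'; rewrite -(ZE _ _ s') -(ZE _ _ s1); apply: Hmax; rewrite inE.
have bad1 : Phi t1 xi1 < qF (f t1) xi1.
  by rewrite -subr_gt0; apply: lt_le_trans (Hm _ _ txi); rewrite subr_gt0.
have [t01 xi0 [dPhi [B [e0 [dP BP e00 HB]]]]] := H t1 xi1 s1 bad1 Hm.
have [e1 [e2 fr]] := collision_frame_exists xi0.
have [d [dq dB]] := collision_derivative hb hf (le_lt_trans t00 t01) xi0 fr.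
have dle := dB B e0 e00 (fun eps ei ee => HB e1 e2 eps fr ei ee).
have D := is_deriveB dq dP.
have := left_derivative_ge0 t01 D; rewrite subr_ge0.
suff Hu : forall u : R, t0 <= u < t1 ->
    ((fun u => qF (f u) xi1) - Phi^~ xi1) u <= ((fun u => qF (f u) xi1) - Phi^~ xi1) t1.
  by move=> /(_ Hu); rewrite leNgt (le_lt_trans dle BP).
move=> u /andP[u0 u1]; apply: Hm; case: s1 => /= /andP[_ t1T] nI; split => //=.
by rewrite u0 (le_trans (ltW u1)).
Qed.

End MaximumPrinciple.

Section LowerBarrierThm.
Context {R : realType}.
Implicit Types (xi : R3 R).

(** The lower bound [m] comes from one fixed ring, t0/2 <= theta <= t0, which all small cutoffs
    leave intact. *)
Lemma collision_moment (b : R -> R) (hb : cross_section b) (s K : R) :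
  0 < s < 1 -> 0 < K ->
  b (cos theta) * theta `^ (2 + 2 * s) @[theta --> 0^'+] --> K ->
  exists e0 m k : R, [/\ 0 < e0, 0 < m, 0 < k & forall eps : R, 0 < eps <= pi / 2 -> eps <= e0 ->
    m <= \int[collision_measure hb eps]_(x in cap eps) ((1 - x.2) / 2) <= k].
Proof.
move=> /andP[s0 s1] K0 hbK; have [t0 t0I Ht] := cross_section_near K0 hbK.
have [k k0 Hk] := collision_integral_ub hb s1 K0 t0I Ht.
have [c c0 Hc] := collision_integral_lb hb s0 K0 t0I Ht.
have t1 : 0 < t0 / 2 <= t0 / 2 by rewrite lexx andbT divr_gt0//; case/andP: t0I.
exists (t0 / 2), (c * ((t0 / 2) ^+ 4 / (t0 / 2) `^ (2 + 2 * s))), k.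
have th0 : 0 < t0 / 2 by case/andP: t1.
split => //; first by rewrite mulr_gt0// divr_gt0 ?exprn_gt0 ?powR_gt0.
move=> eps eI ee; rewrite Hk// andbT.
have eI2 : 0 < eps <= t0 / 2 by rewrite ee andbT; case/andP: eI.
apply: le_trans (Hc _ _ t1 eI2) _.
have mu : measurable_fun setT (fun x : R3 R => (1 - x.2) / 2).
  by apply: measurable_funM => //; apply: measurable_funB => //; exact: measurable_c3.
have iu := collision_u_integrable hb eI.
set I := `[_, _]%classic.
apply: le_Rintegral => //; first exact: measurable_cap.
- apply: (@collision_integrable _ _ hb eps _ 1) => //.
    apply: measurable_funM => //; apply: (measurableT_comp _ (@measurable_c3 R)).
    by apply: measurable_indic; exact: measurable_itv.
  move=> x /cap_u => H; rewrite indicE; case: (_ \in _); rewrite ?mulr1 ?mulr0 ?normr0// ler_norml; lra.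
- by move=> x /cap_u /andP[H _]; rewrite indicE; case: (_ \in _); rewrite ?mulr1 ?mulr0.
Qed.

Lemma continuous_R3_coord : [/\ continuous (fun p : R * (R * R * R) => p.2.1.1),
  continuous (fun p : R * (R * R * R) => p.2.1.2) & continuous (fun p : R * (R * R * R) => p.2.2)].
Proof.
have c2 : continuous (fun p : R * (R * R * R) => p.2) by move=> p; exact: cvg_snd.
have c21 : continuous (fun p : R * (R * R * R) => p.2.1).
  move=> p; apply: (@continuous_comp _ _ _ (fun p : R * (R * R * R) => p.2) fst); first exact: c2.
  exact: cvg_fst.
split=> p.
- apply: (@continuous_comp _ _ _ (fun p : R * (R * R * R) => p.2.1) fst); first exact: c21.
  exact: cvg_fst.
- apply: (@continuous_comp _ _ _ (fun p : R * (R * R * R) => p.2.1) snd); first exact: c21.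
  exact: cvg_snd.
- apply: (@continuous_comp _ _ _ (fun p : R * (R * R * R) => p.2) snd); first exact: c2.
  exact: cvg_snd.
Qed.

Lemma continuous_qval2 (A : qform) : continuous (fun p : R * (R * R * R) => qval A (p.2 : R3 R)).
Proof.
have [c1 c2 c3] := continuous_R3_coord; move=> p.
have M (h1 h2 : R * (R * R * R) -> R) : continuous h1 -> continuous h2 -> continuous (fun p => h1 p * h2 p).
  by move=> k1 k2 q; apply: cvgM; [exact: k1|exact: k2].
have S (h1 : R * (R * R * R) -> R) (a : R) : continuous h1 -> continuous (fun p => a * h1 p).
  by move=> k1 q; apply: cvgM; [exact: cvg_cst|exact: k1].
have D (h1 h2 : R * (R * R * R) -> R) : continuous h1 -> continuous h2 -> continuous (fun p => h1 p + h2 p).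
  by move=> k1 k2 q; apply: cvgD; [exact: k1|exact: k2].
have X (h1 : R * (R * R * R) -> R) : continuous h1 -> continuous (fun p => h1 p ^+ 2).
  by move=> k1; exact: M.
exact: (D _ _ (D _ _ (D _ _ (S _ (q11 A) (X _ c1)) (S _ (q22 A) (X _ c2))) (S _ (q33 A) (X _ c3)))
  (S _ 2 (D _ _ (D _ _ (S _ (q12 A) (M _ _ c1 c2)) (S _ (q13 A) (M _ _ c1 c3)))
    (S _ (q23 A) (M _ _ c2 c3))))).
Qed.

Lemma continuous_dot3 : continuous (fun p : R * (R * R * R) => dot3 (p.2 : R3 R) p.2).
Proof.
have [c1 c2 c3] := continuous_R3_coord => p.
by apply: cvgD; [apply: cvgD|]; apply: cvgM; [exact: c1|exact: c1|exact: c2|exact: c2|exact: c3|exact: c3].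
Qed.

Lemma is_derive_lin (a t : R) : is_derive t 1 (fun u : R => a * u) a.
Proof. by have := is_deriveZ a (is_derive_id t 1); rewrite /GRing.scale/= mulr1. Qed.

Lemma is_derive_explin (a t : R) : is_derive t 1 (fun u : R => expR (a * u)) (a * expR (a * t)).
Proof.
have H := is_derive1_comp (is_derive_expR (a * t)) (is_derive_lin a t).
by move: H; rewrite mulrC.
Qed.

(** The decay rate 3k exceeds the loss rates, 5k/2 for the form and k for the isotropic part. The
    value of [g] lets the trace term pay exactly for the growth of g t |xi|^2, and [dl] makes the
    inequality strict. *)
Lemma lower_barrier_derivative (E kp g t k Q D tr m dl : R) : 0 <= E -> 0 <= kp -> 0 <= g -> 0 <= t ->
  0 <= k -> 0 <= Q -> 0 <= D -> 0 < dl -> g = kp * tr * m / 4 ->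
  E * ((5 / 2 * kp * Q + g * t * D) * k - kp * D * tr * m / 4) <
  3 * k * E * (kp * Q + g * t * D) - E * (g * D) + dl.
Proof.
move=> E0 kp0 g0 t0 k0 Q0 D0 dl0 gE; rewrite -subr_gt0.
rewrite (_ : _ - _ = E * k * (kp * Q / 2 + 2 * (g * t * D)) + dl); last by rewrite gE; field.
by rewrite ltr_wpDl// mulr_ge0// ?mulr_ge0// addr_ge0 ?mulr_ge0// ?divr_ge0 ?mulr_ge0.
Qed.

Variables (b : R -> R) (alpha : R) (F0 : probability (R3 R) R) (f : R -> probability (R3 R) R).
Hypotheses (hb : cross_section b) (alpha0 : 0 <= alpha).
Hypothesis hf : boltzmann_solution b alpha F0 f.

Lemma qF_initial xi : qF (f 0) xi = qF F0 xi.
Proof.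
case: hf => _ h0 _; have := congr1 (fun h => h xi) h0; rewrite /charf => -[h1 h2].
by rewrite /qF /cosF /sinF h1 (oppr_inj h2).
Qed.

(** At time 0 the barrier is a given, possibly degenerate form; the isotropic term g t |xi|^2 then
    grows out of its trace. *)
Lemma lower_barrier (A : qform) (kp g k m e0 r0 : R) :
  0 < e0 -> 0 < k -> 0 < m -> 0 < kp -> 0 < r0 ->
  (forall eps : R, 0 < eps <= pi / 2 -> eps <= e0 ->
    m <= \int[collision_measure hb eps]_(x in cap eps) ((1 - x.2) / 2) <= k) ->
  (forall y : R3 R, 0 <= qval A y) -> 0 < qtrace A -> g = kp * qtrace A * m / 4 ->
  (forall xi, norm3 xi <= r0 -> kp * qval A xi <= 1 - qF F0 xi) ->
  forall (t : R) xi, 0 <= t -> norm3 xi <= r0 ->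
  expR (- (3 * k * t)) * (kp * qval A xi + g * t * dot3 xi xi) <= 1 - qF (f t) xi.
Proof.
move=> e00 k0 m0 kp0 r00 HJ A0 tr0 gE init t xi t0 xir.
have g0 : 0 < g by rewrite gE divr_gt0// !mulr_gt0.
pose be (u : R) (y : R3 R) := expR (- (3 * k * u)) * (kp * qval A y + g * u * dot3 y y).
rewrite -/(be t xi).
(* The slack dl (1 + t) has positive time derivative, which gives the strict inequality asked by
   [parabolic_maximum]; it tends to 0 with [dl]. *)
suff H : forall dl : R, 0 < dl -> qF (f t) xi <= 1 - be t xi + dl * (1 + t).
  rewrite lerBrDr -lerBrDl; apply/ler_addgt0Pr => e ep.
  have := H (e / (1 + t)); rewrite divfK ?gt_eqF ?ltr_wpDr//; apply.
  by rewrite divr_gt0 ?ltr_wpDr.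
move=> dl dl0.
pose Phi (u : R) (y : R3 R) := 1 - be u y + dl * (1 + u).
apply: (@parabolic_maximum R b alpha F0 f hb alpha0 hf 0 t 0 r0 Phi) => //; last first.
  by split; rewrite /= ?lexx ?t0 ?norm3_ge0.
- move: (t) => T {}t {}xi [/= /andP[{}t0 tT] /andP[_ {}xir]] bad Hm.
  have b1 := qF_le1 (f t) xi.
  have t1 : 0 < t.
    rewrite lt0r t0 andbT; apply/negP => /eqP tE; move: bad; rewrite tE /Phi /be.
    rewrite qF_initial !mulr0 oppr0 expR0 mul1r mul0r !addr0 mulr1.
    by have := init xi xir; lra.
  have xi0 : xi != 0.
    apply/negP => /eqP xE; move: bad; rewrite xE qF0 /Phi /be.
    rewrite (_ : qval A 0 = 0); last by rewrite /qval/=; ring.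
    rewrite (_ : dot3 0 0 = 0); last by rewrite /dot3/=; ring.
    rewrite !mulr0 addr0 mulr0 subr0.
    by apply/negP; rewrite -leNgt lerDl mulr_ge0 ?(ltW dl0)// addr_ge0.
  split => //.
  have Q0 := A0 xi; have D0 := dot3_ge0 xi.
  exists (3 * k * expR (- (3 * k * t)) * (kp * qval A xi + g * t * dot3 xi xi) -
    expR (- (3 * k * t)) * (g * dot3 xi xi) + dl).
  exists (expR (- (3 * k * t)) * ((5 / 2 * kp * qval A xi + g * t * dot3 xi xi) * k -
      kp * dot3 xi xi * qtrace A * m / 4)), e0.
  split => //.
  + have d1 := is_derive_explin (- (3 * k)) t.
    have d2 := is_deriveD (is_derive_cst (kp * qval A xi) t 1) (is_derive_lin (g * dot3 xi xi) t).
    have d3 := is_deriveM d1 d2.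
    have d4 := is_deriveD (is_deriveB (is_derive_cst (1 : R) t 1) d3)
      (is_deriveD (is_derive_cst dl t 1) (is_derive_lin dl t)).
    rewrite (_ : Phi^~ xi = (cst (1 : R) - (fun u : R => expR (- (3 * k) * u)) *
      (cst (kp * qval A xi) + (fun u => g * dot3 xi xi * u)) + (cst dl + (fun u => dl * u)))%R).
      apply: (is_derive_eq d4).
      rewrite -!(mulNr (3 * k)) /GRing.scale !fctE /cst/=.
      by move: (expR _) (qval A xi) (dot3 xi xi) => *; ring.
    apply/funext => u; rewrite /Phi /be !fctE /cst/= -(mulNr (3 * k)).
    by move: (expR _) (qval A xi) (dot3 xi xi) => *; ring.
  + by apply: lower_barrier_derivative => //; rewrite ?expR_ge0 ?ltW.
  + move=> e1 e2 eps fr eI ee.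
    apply: quadratic_barrier_gain => //.
    * exact: ltW.
    * by rewrite mulr_ge0// ltW.
    * exact: ltW.
    * exact: HJ.
    move=> y yxi; have sy : slab 0 T 0 r0 (t, y).
      by split; rewrite /= ?t0 ?tT// norm3_ge0 (le_trans yxi).
    have := Hm t y sy; rewrite /Phi -!/(be _ _).
    have comb (p q r c d : R) : p - (1 - q + r) <= c - (1 - d + r) -> q + p <= d + c by lra.
    exact: comb.
- move=> p _; apply: cvgD.
    apply: cvgB; first exact: cvg_cst.
    have c1 : (fun q : R * (R * R * R) => q.1) @ p --> p.1 by exact: cvg_fst.
    apply: cvgM.
      apply: (@continuous_comp _ _ _ (fun q : R * (R * R * R) => - (3 * k * q.1)) expR); last exact: continuous_expR.
      by apply: cvgN; apply: cvgM => //; exact: cvg_cst.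
    apply: cvgD; first by apply: cvgM; [exact: cvg_cst|exact: continuous_qval2].
    apply: cvgM; last exact: continuous_dot3.
    by apply: cvgM => //; exact: cvg_cst.
  apply: cvgM; first exact: cvg_cst.
  by apply: cvgD; [exact: cvg_cst|exact: cvg_fst].
Qed.

End LowerBarrierThm.

(** * The upper barrier *)

Section UpperBarrier.
Context {R : realType}.
Implicit Types (xi : R3 R).

Lemma ln_le_sub1 (x : R) : 0 < x -> ln x <= x - 1.
Proof. by move=> x0; have := @le_ln1Dx R (x - 1); rewrite (addrC 1) subrK; apply; lra. Qed.

Lemma powRV (a s : R) : 0 <= a -> a^-1 `^ s = (a `^ s)^-1.
Proof. by move=> a0; rewrite -powR_inv1// -powRrM mulN1r powRN. Qed.

Lemma one_sub_gt0 (u : R) : u <= 2^-1 -> 0 < 1 - u.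
Proof. lra. Qed.

Lemma sub_le_subC (p q r c : R) : p - q <= r - c -> p - r <= q - c.
Proof. lra. Qed.

Lemma height_le (c z q t : R) : c <= z -> 1 - c <= q -> q = t * 2 -> 1 - z <= t * 2.
Proof. lra. Qed.

(** The left-hand side is (1 - u)^(-a) - 1, the relative growth of the upper barrier from xi to
    xi^+. *)
Lemma expR_log_bound (a A u : R) : 0 <= a <= A -> 0 <= u <= 2^-1 ->
  expR (- (a * ln (1 - u))) - 1 <= 2 * A * expR A * u.
Proof.
move=> /andP[a0 aA] /andP[u0 u1].
have u2 : 2^-1 <= 1 - u by lra.
have v0 : 0 < 1 - u by apply: lt_le_trans u2; rewrite invr_gt0.
have L : - ln (1 - u) <= 2 * u.
  rewrite -lnV ?posrE//; apply: le_trans (ln_le_sub1 _) _; first by rewrite invr_gt0.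
  rewrite lerBlDr -[leLHS]mul1r ler_pdivrMr//.
  by rewrite (_ : (2 * u + 1) * (1 - u) = 1 + u * (1 - 2 * u)); [rewrite lerDl mulr_ge0//; lra|ring].
have A0 : 0 <= A by exact: le_trans aA.
pose w := 2 * A * u.
have w0 : 0 <= w by rewrite !mulr_ge0.
have wA : w <= A by rewrite /w; nra.
have H1 : expR (- (a * ln (1 - u))) <= expR w.
  rewrite ler_expR -mulrN (@le_trans _ _ (a * (2 * u)))//; first by rewrite ler_wpM2l.
  by rewrite (_ : w = A * (2 * u)); [rewrite ler_wpM2r// mulr_ge0|rewrite /w; ring].
have H2 : expR w - 1 <= w * expR w.
  have := expR_ge1Dx (- w); rewrite expRN => H.
  have e0 := expR_gt0 w.
  have : (1 - w) * expR w <= 1 by rewrite -ler_pdivlMr// mul1r.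
  by rewrite mulrBl mul1r; move: (expR w) (w * expR w) => p q; lra.
have H3 : w * expR w <= w * expR A by rewrite ler_wpM2l// ler_expR.
rewrite (_ : 2 * A * expR A * u = w * expR A); last by rewrite /w; ring.
move: H1 H2 H3; move: (expR w) (w * expR w) (w * expR A) (expR _) => p q r z; lra.
Qed.

Variables (b : R -> R).
Hypotheses (hb : cross_section b).
Notation nu := (collision_measure hb).
Notation ring_u th x := ((1 - x.2) / 2 * \1_(`[cos (2 * th), cos th]%classic) x.2).

Lemma measurable_ring_u (th : R) : measurable_fun setT (fun x : R3 R => ring_u th x).
Proof.
apply: measurable_funM.
  by apply: measurable_funM => //; apply: measurable_funB => //; exact: measurable_c3.
apply: (measurableT_comp _ (@measurable_c3 R)).
by apply: measurable_indic; exact: measurable_itv.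
Qed.

Lemma ring_u_integrable (th eps : R) : 0 < eps <= pi / 2 ->
  (nu eps).-integrable (cap eps) (EFin \o (fun x : R3 R => ring_u th x)).
Proof.
move=> e0; apply: (@collision_integrable _ _ hb eps _ 1) => //; first exact: measurable_ring_u.
move=> x /cap_u => H; rewrite indicE; case: (_ \in _); rewrite ?mulr1 ?mulr0 ?normr0// ler_norml; lra.
Qed.

(** Rests on q^+ q^- - q = q^- (q^+ - q) - q (1 - q^-). The first term is at most the growth of the
    barrier [p]. The second gains on the ring, where |xi^-| <= r0. Since p <= q(xi), that gain is
    also at least a multiple of [p]. *)
Lemma decay_gain (F : probability (R3 R) R) xi (e1 e2 : R3 R) (eps p C c0 r0 th : R) :
  xi != 0 -> collision_frame xi e1 e2 -> 0 < eps <= pi / 2 -> 0 <= p <= qF F xi -> 0 <= C ->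
  0 <= c0 -> 0 <= r0 -> 0 <= th -> dot3 xi xi * th ^+ 2 <= r0 ^+ 2 ->
  (forall x, cap eps x ->
    qF F (xip xi (frame e1 e2 (scale3 (norm3 xi)^-1 xi) x)) - qF F xi <= p * (C * ((1 - x.2) / 2))) ->
  (forall y : R3 R, norm3 y <= r0 -> c0 * dot3 y y <= 1 - qF F y) ->
  \int[nu eps]_(x in cap eps) gain F xi e1 e2 x <=
    p * (C * (\int[nu eps]_(x in cap eps) ((1 - x.2) / 2)) -
      c0 * dot3 xi xi * \int[nu eps]_(x in cap eps) (ring_u th x)).
Proof.
move=> xi0 [onb inv] eI /andP[p0 pq] C0 c00 r00 th0 Dth Hp Hc.
have mc := @measurable_cap R eps.
have iu := collision_u_integrable hb eI; have iv := ring_u_integrable th eI.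
have ju := integrableZl mc (p * C) iu; have jv := integrableZl mc (p * (c0 * dot3 xi xi)) iv.
rewrite mulrBr !mulrA -(mulrA p c0).
rewrite -(RintegralZl (p * C) mc iu) -(RintegralZl (p * (c0 * dot3 xi xi)) mc iv).
rewrite -(RintegralB mc ju jv); apply: le_Rintegral => //.
- apply: (@collision_integrable _ _ hb eps _ 2) => //; first exact: measurable_gain.
  by move=> x _; exact: gain_bound.
- exact: (integrableB mc ju jv).
move=> x cx; have /andP[u0 u1] := cap_u cx; have [xx _] := cap_height cx.
have := Hp x cx; rewrite /gain; set e3 := scale3 _ xi in onb inv *.
set yp := xip _ _; set ym := xim _ _ => Hq.
have qm0 := qF_ge0 F ym; have qm1 := qF_le1 F ym.
have Em : c0 * dot3 xi xi * ring_u th x <= 1 - qF F ym.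
  rewrite indicE; case: (boolP (_ \in _)) => [|_]; last by rewrite !mulr0 subr_ge0.
  rewrite inE/= in_itv/= mulr1 => /andP[I1 _].
  have [_ ymE] := collision_dot3 xi0 onb xx.
  rewrite -mulrA -ymE; apply: Hc.
  rewrite -(@ler_pXn2r _ 2) ?nnegrE ?norm3_ge0// norm3_sqr ymE.
  apply: le_trans Dth; rewrite ler_wpM2l ?dot3_ge0//.
  (* As 1 - cos(2 th) <= 2 th^2, the ring satisfies u <= th^2. *)
  have := @cos_ge_quad R (2 * th) ltac:(by rewrite mulr_ge0).
  move: I1; move: (cos (2 * th)) (x.2 : R) => cc z h1 h2; rewrite ler_pdivrMr//.
  have : (2 * th) ^+ 2 / 2 = th ^+ 2 * 2 by field.
  exact: height_le h1 h2.
have H1 : qF F ym * (qF F yp - qF F xi) <= p * (C * ((1 - x.2) / 2)).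
  have P0 : 0 <= p * (C * ((1 - x.2) / 2)) by exact: mulr_ge0 p0 (mulr_ge0 C0 u0).
  apply: (@le_trans _ _ (qF F ym * (p * (C * ((1 - x.2) / 2))))); first by rewrite ler_wpM2l.
  by rewrite ler_piMl.
have H2 : p * (c0 * dot3 xi xi * ring_u th x) <= qF F xi * (1 - qF F ym).
  apply: (@le_trans _ _ (p * (1 - qF F ym))); first by rewrite ler_wpM2l.
  by rewrite ler_wpM2r// subr_ge0.
have -> : qF F yp * qF F ym - qF F xi =
    qF F ym * (qF F yp - qF F xi) - qF F xi * (1 - qF F ym).
  by move: (qF F yp) (qF F ym) (qF F xi) => *; ring.
by rewrite -(mulrA p C) -(mulrA p); exact: lerB.
Qed.

(** Here D = |xi|^2 and D th^2 = r0^2, so the gain of the ring is c0 c r0^2 (D/r0^2)^s. With y =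
    D/rho >= 1, the bounds ln y <= y^s/s and 1 <= y^s reduce everything to multiples of y^s. *)
Lemma decay_total (s r0 D rho c0 c C k M th : R) : 0 < s -> 0 < r0 -> 0 < c0 -> 0 < c ->
  0 <= C * k -> 0 <= M -> 0 < rho -> rho <= D -> 0 < th -> D * th ^+ 2 = r0 ^+ 2 ->
  (C * k + M / s + 1) / (c0 * c * r0 ^+ 2) <= (rho / r0 ^+ 2) `^ s ->
  C * k - c0 * D * (c * (th ^+ 4 / th `^ (2 + 2 * s))) < - (M * ln (D / rho)).
Proof.
move=> s0 r00 c00 c_0 Ck M0 rho0 rhoD th0 thE Hrho.
have D0 : 0 < D by exact: lt_le_trans rhoD.
pose y := D / rho.
have y1 : 1 <= y by rewrite ler_pdivlMr// mul1r.
have y0 : 0 < y by exact: lt_le_trans y1.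
have ys1 : 1 <= y `^ s by rewrite -(powRr0 y) ler_powR// ltW.
have LE : c0 * D * (c * (th ^+ 4 / th `^ (2 + 2 * s))) =
    c0 * c * r0 ^+ 2 * ((rho / r0 ^+ 2) `^ s * y `^ s).
  have th2 : th `^ (2 + 2 * s) = th ^+ 2 * (r0 ^+ 2 / D) `^ s.
    rewrite powRD; last by rewrite (gt_eqF th0) implybT.
    rewrite powRrM -!(@powR_mulrn _ th 2) ?ltW//.
    congr (_ * _ `^ _).
    by rewrite (@powR_mulrn _ th 2) ?ltW// -thE mulrC mulKf// gt_eqF.
  rewrite th2 -powRM ?divr_ge0 ?exprn_ge0 ?ltW//.
  have -> : rho / r0 ^+ 2 * y = (r0 ^+ 2 / D)^-1.
    by rewrite /y; field; rewrite !gt_eqF.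
  have w0 : 0 < (r0 ^+ 2 / D) `^ s by rewrite powR_gt0// divr_gt0// exprn_gt0.
  rewrite powRV ?divr_ge0 ?exprn_ge0 ?ltW//.
  move: w0; move: (_ `^ s) => w w0; rewrite -thE; field.
  by rewrite !gt_eqF.
have L : ln y <= y `^ s / s.
  rewrite ler_pdivlMr// mulrC -ln_powR.
  have := @ln_le_sub1 (y `^ s) (lt_le_trans ltr01 ys1); lra.
rewrite LE -/y.
have X0 : 0 < c0 * c * r0 ^+ 2 by rewrite !mulr_gt0// exprn_gt0.
have H1 := ler_wpM2l M0 L.
pose Z := (rho / r0 ^+ 2) `^ s * (c0 * c * r0 ^+ 2).
have ZH : C * k + M / s + 1 <= Z by rewrite -ler_pdivrMr.
rewrite (_ : c0 * c * r0 ^+ 2 * _ = Z * y `^ s); last by rewrite /Z mulrA [in RHS](mulrC (_ `^ s)).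
have : (C * k + M / s + 1) * y `^ s <= Z * y `^ s by rewrite ler_wpM2r// powR_ge0.
have : C * k <= C * k * y `^ s by rewrite ler_peMr.
rewrite (_ : (C * k + M / s + 1) * y `^ s = C * k * y `^ s + M * (y `^ s / s) + y `^ s); last first.
  by field; rewrite gt_eqF.
have comb (a1 a2 a3 a4 a5 a6 : R) : a5 <= a1 -> a1 + a3 + a6 <= a4 -> a2 <= a3 -> 1 <= a6 ->
  a5 - a4 < - a2 by lra.
by move=> Ha Hb; exact: comb Ha Hb H1 ys1.
Qed.
End UpperBarrier.

Section UpperBarrierThm.
Context {R : realType}.
Implicit Types (xi : R3 R).
Variables (b : R -> R) (alpha : R) (F0 : probability (R3 R) R) (f : R -> probability (R3 R) R).
Hypotheses (hb : cross_section b) (alpha0 : 0 <= alpha).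
Hypothesis hf : boltzmann_solution b alpha F0 f.

(** The barrier is (rho/|xi|^2)^(M (t - t0)), equal to 1 at time t0 and on the inner sphere |xi|^2 =
    rho, where q <= 1 suffices. *)
Lemma upper_barrier (s K t0 T c0 r0 M : R) : 0 < s < 1 -> 0 < K ->
  b (cos theta) * theta `^ (2 + 2 * s) @[theta --> 0^'+] --> K ->
  0 <= t0 <= T -> 0 < c0 -> 0 < r0 -> 0 <= M ->
  (forall (t : R) xi, t0 <= t <= T -> norm3 xi <= r0 -> c0 * dot3 xi xi <= 1 - qF (f t) xi) ->
  exists2 rho : R, 0 < rho & forall (t : R) xi, t0 <= t <= T -> rho <= dot3 xi xi ->
    qF (f t) xi <= expR (- (M * (t - t0) * ln (dot3 xi xi / rho))).
Proof.
move=> /andP[s0 s1] K0 hbK /andP[t00 t0T] c00 r00 M0 Hc.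
have [ta taI Ht] := cross_section_near K0 hbK.
have [k k0 Hk] := collision_integral_ub hb s1 K0 taI Ht.
have [c c_0 Hlb] := collision_integral_lb hb s0 K0 taI Ht.
have ta0 : 0 < ta by case/andP: taI.
pose A := M * (T - t0).
have A0 : 0 <= A by rewrite mulr_ge0// subr_ge0.
pose C := 2 * A * expR A.
have C0 : 0 <= C by rewrite mulr_ge0 ?expR_ge0// mulr_ge0.
pose X := (C * k + M / s + 1) / (c0 * c * r0 ^+ 2).
have X0 : 0 < X.
  rewrite divr_gt0 ?mulr_gt0 ?exprn_gt0// ltr_wpDl// addr_ge0 ?divr_ge0 ?(ltW s0)//.
  by rewrite mulr_ge0 ?(ltW k0).
(* The first summand makes the gain win in [decay_total]; the second gives r0/|xi| <= ta/2 for
   |xi|^2 >= rho, as the ring estimate requires. *)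
pose rho := r0 ^+ 2 * (X `^ s^-1 + (2 / ta) ^+ 2).
have XS0 : 0 < X `^ s^-1 by exact: powR_gt0.
have rho0 : 0 < rho by rewrite mulr_gt0 ?exprn_gt0// ltr_wpDr// sqr_ge0.
have rX : X <= (rho / r0 ^+ 2) `^ s.
  have -> : X = (X `^ s^-1) `^ s by rewrite -powRrM mulVf ?powRr1// ?ltW// gt_eqF.
  apply: ge0_ler_powR; rewrite ?nnegrE ?(ltW s0) ?(ltW XS0)//.
    by rewrite divr_ge0 ?(ltW rho0) ?sqr_ge0.
  by rewrite /rho mulrAC divff ?mul1r ?lerDl ?sqr_ge0// gt_eqF// exprn_gt0.
exists rho => // t xi tI xiI.
pose p (t : R) xi := expR (- (M * (t - t0) * ln (dot3 xi xi / rho))).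
rewrite -/(p t xi).
pose r1 := Num.sqrt rho.
have r1n (y : R3 R) : (r1 <= norm3 y) = (rho <= dot3 y y) by rewrite /r1 /norm3 ler_sqrt// dot3_ge0.
(* The outer radius is the norm of the given xi: collisions never increase |xi|, so nothing beyond
   it is consulted. *)
apply: (@parabolic_maximum R b alpha F0 f hb alpha0 hf t0 T r1 (norm3 xi) p) => //; last first.
- by split => //=; rewrite r1n xiI lexx.
- move: (norm3 xi) => r2 {tI xiI}t1 {}xi [/= /andP[tt0 tT] /andP[xr1 xr2]] pbad Hm.
  have q1 := qF_le1 (f t1) xi.
  have Drho : rho <= dot3 xi xi by rewrite -r1n.
  have D0 : 0 < dot3 xi xi by exact: lt_le_trans Drho.
  have tlt : t0 < t1.
    rewrite lt_neqAle tt0 andbT; apply/negP => /eqP tE; move: pbad.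
    by rewrite /p tE subrr mulr0 mul0r oppr0 expR0 ltNge q1.
  have xi0 : xi != 0 by rewrite -norm3_gt0 /norm3 sqrtr_gt0.
  have n0 : 0 < norm3 xi by rewrite norm3_gt0.
  pose th := r0 / norm3 xi.
  have th0 : 0 < th by rewrite divr_gt0.
  have thE : dot3 xi xi * th ^+ 2 = r0 ^+ 2.
    by rewrite -norm3_sqr /th expr_div_n mulrC divfK// gt_eqF// exprn_gt0.
  have thle : th <= ta / 2.
    rewrite -(@ler_pXn2r _ 2) ?nnegrE ?(ltW th0) ?divr_ge0 ?(ltW ta0)//.
    have : (2 / ta) ^+ 2 * r0 ^+ 2 <= dot3 xi xi.
      by apply: le_trans Drho; rewrite /rho mulrC ler_wpM2l ?sqr_ge0// lerDr ltW.
    have -> : th ^+ 2 = r0 ^+ 2 / dot3 xi xi by rewrite -thE mulrC mulKf// gt_eqF.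
    rewrite ler_pdivrMr//; have -> : (2 / ta) ^+ 2 = (ta / 2) ^- 2 by rewrite -exprVn invf_div.
    by rewrite mulrC ler_pdivrMr ?exprn_gt0 ?divr_gt0// mulrC.
  split => //.
  exists (- (M * ln (dot3 xi xi / rho)) * p t1 xi).
  exists (p t1 xi * (C * k - c0 * dot3 xi xi * (c * (th ^+ 4 / th `^ (2 + 2 * s))))), th.
  have p0 : 0 < p t1 xi by exact: expR_gt0.
  split => //.
  + have d1 := is_derive_explin (- (M * ln (dot3 xi xi / rho))) t1.
    pose E0 := expR (M * t0 * ln (dot3 xi xi / rho)).
    have pE (u : R) : p u xi = E0 * expR (- (M * ln (dot3 xi xi / rho)) * u).
      by rewrite /p /E0 -expRD; congr expR; ring.
    have d2 := is_deriveZ E0 d1.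
    have -> : p^~ xi = (E0 \*: (fun u : R => expR (- (M * ln (dot3 xi xi / rho)) * u)))%R.
      by apply/funext => u; rewrite pE.
    by apply: (is_derive_eq d2); rewrite pE /GRing.scale/= mulrCA.
  + rewrite mulrC ltr_pM2r//.
    apply: (@decay_total R s r0 (dot3 xi xi) rho c0 c C k M th) => //.
    by rewrite mulr_ge0 ?(ltW k0).
  + move=> e1 e2 eps fr eI ee; have [onb inv] := fr.
    apply: (@le_trans _ _ (p t1 xi * (C * (\int[collision_measure hb eps]_(x in cap eps) ((1 - x.2) / 2)) -
      c0 * dot3 xi xi * \int[collision_measure hb eps]_(x in cap eps)
        ((1 - x.2) / 2 * \1_(`[cos (2 * th), cos th]%classic) x.2)))).
      apply: (@decay_gain R b hb (f t1) xi e1 e2 eps (p t1 xi) C c0 r0 th) => //.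
      * by rewrite (ltW p0) (ltW pbad).
      * exact: ltW.
      * exact: ltW.
      * exact: ltW.
      * by rewrite thE.
      * move=> x cx; have uI := cap_u cx; have [xx /andP[x0 x1]] := cap_height cx.
        set y := xip _ _.
        have yD : dot3 y y = dot3 xi xi * (1 - (1 - x.2) / 2).
          have [-> _] := collision_dot3 xi0 onb xx.
          by move: (dot3 xi xi) (x.2) => D z; field.
        have yn : norm3 y <= norm3 xi by exact: xip_le.
        have /andP[u0 u1] := uI.
        have v0 : 0 < 1 - (1 - x.2) / 2.
          exact: one_sub_gt0 u1.
        have yD0 : 0 < dot3 y y by rewrite yD mulr_gt0.
        have pyE : p t1 y = p t1 xi * expR (- (M * (t1 - t0) * ln (1 - (1 - x.2) / 2))).
          rewrite /p yD -expRD; congr expR.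
          have -> : dot3 xi xi * (1 - (1 - x.2) / 2) / rho = dot3 xi xi / rho * (1 - (1 - x.2) / 2) by rewrite mulrAC.
          rewrite lnM ?posrE ?divr_gt0//; move: (ln _) (ln _) => l1 l2; ring.
        have Hy : qF (f t1) y - qF (f t1) xi <= p t1 y - p t1 xi.
          have [yr|yr] := leP r1 (norm3 y).
            have sy : slab t0 T r1 r2 (t1, y) by split; rewrite /= ?tt0// yr (le_trans yn).
            exact: sub_le_subC (Hm t1 y sy).
          (* When xi^+ falls below the inner radius maximality says nothing, but there the barrier
             is at least 1. *)
          have py : 1 <= p t1 y.
            rewrite /p -expR0 ler_expR oppr_ge0 mulr_ge0_le0 ?mulr_ge0 ?subr_ge0//.
            rewrite ln_le0// ler_pdivrMr// mul1r leNgt; apply/negP => /ltW.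
            by rewrite -r1n leNgt yr.
          by apply: lerB (ltW pbad); apply: le_trans py; exact: qF_le1.
        apply: (le_trans Hy); rewrite pyE -[X in _ - X]mulr1 -mulrBr ler_pM2l//.
        apply: expR_log_bound uI; rewrite mulr_ge0 ?subr_ge0//=.
        by rewrite ler_wpM2l// lerD2r.
      * by move=> y; apply: Hc; rewrite tt0.
    rewrite ler_pM2l// lerB//; first by rewrite ler_wpM2l// Hk.
    rewrite ler_pM2l ?mulr_gt0//; apply: Hlb; first by rewrite th0.
    by rewrite ee andbT; case/andP: eI.
- move=> q [_ /= /andP[qr1 _]].
  rewrite r1n in qr1.
  have q0 : 0 < dot3 (q.2 : R3 R) q.2 / rho by rewrite divr_gt0// (lt_le_trans rho0).
  have c1 : {for q, continuous (fun q : R * (R * R * R) => ln (dot3 (q.2 : R3 R) q.2 / rho))}.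
    have h1 : {for q, continuous (fun q : R * (R * R * R) => dot3 (q.2 : R3 R) q.2 / rho)}.
      by apply: cvgM; [exact: continuous_dot3|exact: cvg_cst].
    have h2 : {for dot3 (q.2 : R3 R) q.2 / rho, continuous (@ln R)} by exact: continuous_ln.
    exact: continuous_comp h1 h2.
  apply: (@continuous_comp _ _ _ (fun q : R * (R * R * R) =>
    - (M * (q.1 - t0) * ln (dot3 (q.2 : R3 R) q.2 / rho))) expR); last exact: continuous_expR.
  apply: cvgN; apply: cvgM; last exact: c1.
  by apply: cvgM; [exact: cvg_cst|apply: cvgB; [exact: cvg_fst|exact: cvg_cst]].
Qed.

End UpperBarrierThm.

(** * Rapid decay at positive times *)

Section Smoothing.
Context {R : realType}.
Implicit Types (xi : R3 R).

Lemma qF_decay (s : R) (b : R -> R) (K alpha : R)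
    (F0 : probability (R3 R) R) (f : R -> probability (R3 R) R) (t : R) (k : nat) :
  0 < s < 1 -> cross_section b -> 0 < K ->
  b (cos theta) * theta `^ (2 + 2 * s) @[theta --> 0^'+] --> K ->
  0 <= alpha -> ~ is_dirac F0 -> boltzmann_solution b alpha F0 f -> 0 < t ->
  exists C : R, forall xi, (1 + dot3 xi xi) ^+ k * qF (f t) xi <= C.
Proof.
move=> sI hb K0 hbK alpha0 nd hf t0.
have [n n0 tr0] := qtrace_dform_gt0 nd.
have [e0 [m [k1 [e00 m0 k10 HJ]]]] := collision_moment hb sI K0 hbK.
have A0 (y : R3 R) : 0 <= qval (dform F0 n) y by apply: dform_ge0; exact: ltW.
have r00 : 0 < n^-1 by rewrite invr_gt0.
have kp0 : 0 < (4 : R)^-1 by rewrite invr_gt0.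
pose g := 4^-1 * qtrace (dform F0 n) * m / 4.
have g0 : 0 < g by rewrite divr_gt0// !mulr_gt0.
have LB (u : R) xi : 0 <= u -> norm3 xi <= n^-1 ->
    expR (- (3 * k1 * u)) * (4^-1 * qval (dform F0 n) xi + g * u * dot3 xi xi) <= 1 - qF (f u) xi.
  apply: (@lower_barrier _ b alpha F0 f hb alpha0 hf (dform F0 n) 4^-1 g k1 m e0 n^-1) => //.
  by move=> y yr; rewrite mulrC; exact: qF_quadratic.
(* On the time interval [t/2, t] the isotropic part of the lower barrier is at least this multiple
   of |xi|^2. *)
pose c0 := expR (- (3 * k1 * t)) * (g * (t / 2)).
have t20 : 0 < t / 2 by rewrite divr_gt0.
have c00 : 0 < c0 by rewrite mulr_gt0 ?expR_gt0// mulr_gt0.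
have tI : 0 <= t / 2 <= t by rewrite (ltW t20) ler_pdivrMr// ler_pMr// ler1n.
have Hc (u : R) xi : t / 2 <= u <= t -> norm3 xi <= n^-1 -> c0 * dot3 xi xi <= 1 - qF (f u) xi.
  move=> /andP[u1 u2] xir; have u0 : 0 <= u by exact: le_trans (ltW t20) u1.
  apply: le_trans (LB u xi u0 xir); rewrite /c0 -mulrA.
  apply: ler_pM; rewrite ?expR_ge0//.
  - by rewrite mulr_ge0 ?dot3_ge0// mulr_ge0 ?(ltW g0)// ltW.
  - by rewrite ler_expR lerN2 ler_wpM2l// mulr_ge0// ltW.
  - rewrite -[leLHS]add0r lerD//; first by rewrite mulr_ge0// A0.
    by rewrite ler_wpM2r ?dot3_ge0// ler_wpM2l// ltW.
(* With this rate the exponent M (t - t/2) is exactly [k] at time t. *)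
have [|rho rho0 HU] := upper_barrier hb alpha0 hf sI K0 hbK tI c00 r00 (_ : 0 <= k%:R / (t / 2)) Hc.
  by rewrite divr_ge0// ltW.
pose D0 := Num.max rho 1.
have D01 : 1 <= D0 by rewrite le_max lexx orbT.
have D0r : rho <= D0 by rewrite le_max lexx.
exists ((1 + D0) ^+ k + (2 * rho) ^+ k) => xi.
have q0 := qF_ge0 (f t) xi; have q1 := qF_le1 (f t) xi.
have d0 := dot3_ge0 xi.
have d11 : 0 <= 1 + dot3 xi xi by rewrite ler_wpDr.
have D11 : 0 <= 1 + D0 by rewrite ler_wpDr// (le_trans ler01).
have [le|lt] := leP (dot3 xi xi) D0.
  apply: (@le_trans _ _ ((1 + D0) ^+ k)).
    rewrite -[leRHS]mulr1; apply: ler_pM => //; first exact: exprn_ge0.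
    by apply: lerXn2r; rewrite ?nnegrE// lerD2l.
  by rewrite lerDl exprn_ge0// mulr_ge0// ltW.
have d1 : 0 < dot3 xi xi by apply: lt_trans lt; exact: lt_le_trans D01.
have tt : t / 2 <= t <= t by rewrite lexx andbT; case/andP: tI.
have := HU t xi tt (le_trans D0r (ltW lt)).
have -> : k%:R / (t / 2) * (t - t / 2) = k%:R.
  by rewrite (_ : t - t / 2 = t / 2); [rewrite divfK// gt_eqF|field].
have rD : 0 < dot3 xi xi / rho by rewrite divr_gt0.
rewrite -mulrN -lnV ?posrE// invf_div expRM_natl lnK ?posrE ?divr_gt0// => Hq.
apply: (@le_trans _ _ ((2 * rho) ^+ k)); last by rewrite lerDr exprn_ge0.
apply: (@le_trans _ _ ((2 * dot3 xi xi) ^+ k * (rho / dot3 xi xi) ^+ k)).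
  have d2 : 0 <= 2 * dot3 xi xi by exact: mulr_ge0.
  apply: ler_pM => //; first exact: exprn_ge0.
  apply: lerXn2r; rewrite ?nnegrE//.
  by rewrite mulr_natl mulr2n lerD2r (le_trans D01)// ltW.
rewrite -exprMn (_ : 2 * dot3 xi xi * (rho / dot3 xi xi) = 2 * rho)//.
by field; rewrite gt_eqF.
Qed.

End Smoothing.

(** * Inversion by the Poisson kernel *)

Section PoissonKernel.
Context {R : realType}.
Notation TR := (measurableTypeR R).
Notation mu := (@lebesgue_measure R).

Definition ker (e z : R) : R := e / (e ^+ 2 + z ^+ 2).

Lemma ker_den (e z : R) : 0 < e -> 0 < e ^+ 2 + z ^+ 2.
Proof. by move=> e0; rewrite ltr_pwDl ?exprn_gt0 ?sqr_ge0. Qed.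

Lemma ker_ge0 (e z : R) : 0 < e -> 0 <= ker e z.
Proof. by move=> e0; rewrite divr_ge0 ?ltW// ker_den. Qed.

Lemma ker_le (e z : R) : 0 < e -> ker e z <= e^-1.
Proof.
move=> e0; rewrite /ker ler_pdivrMr ?ker_den// mulrC ler_pdivlMr// -expr2.
by rewrite lerDl sqr_ge0.
Qed.

Lemma measurable_sqr : @measurable_fun _ _ TR TR setT (fun x => x ^+ 2).
Proof. by apply: measurable_funX; exact: measurable_id. Qed.

Lemma measurable_ker (e : R) : @measurable_fun _ _ TR TR setT (ker e).
Proof.
apply: measurable_funM => //.
apply: (measurableT_comp (@measurable_invr R)).
by apply: measurable_funD => //; exact: measurable_sqr.
Qed.

Lemma ge0_integral_half (h : TR -> \bar R) :
  measurable_fun setT h -> (forall x, (0 <= h x)%E) ->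
  (\int[mu]_x h x = \int[mu]_(x in `[0%R, +oo[) (h x + h (- x)%R))%E.
Proof.
move=> mh h0.
have mo : @measurable_fun _ _ TR TR setT (fun x => - x).
  by apply: continuous_measurable_fun => x; apply: cvgN; exact: cvg_id.
have mhn : measurable_fun setT (fun x : TR => h (- x)) by exact: (measurableT_comp mh mo).
rewrite ge0_integralD//; last 2 first.
- exact: measurable_funTS.
- exact: measurable_funTS.
rewrite -(@setvU _ (`[0%R, +oo[%classic : set TR)) setUC ge0_integral_setU//=; last 3 first.
- by apply: measurableC; exact: measurable_itv.
- by rewrite setUv.
- by apply/disj_set2P; rewrite setICr.
congr (_ + _)%E.
rewrite -integral_itv_obnd_cbnd; last exact: measurable_funTS.
rewrite integral_mkcond [RHS]integral_mkcond.
have H := @ge0_integral_affine R (-1) 0 (h \_ (~` `[0%R, +oo[)).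
rewrite -H ?oppr_eq0 ?oner_eq0//; last 2 first.
- apply/(measurable_restrictT _ _).1; last exact: measurable_funTS.
  by apply: measurableC; exact: measurable_itv.
- by move=> x; rewrite /patch; case: ifP.
apply: eq_integral => x _; rewrite normrN1 mul1e mulN1r addr0 /patch.
congr (if _ then _ else _); apply/idP/idP; rewrite !inE/= !in_itv/= !andbT.
  by move=> /negP; rewrite ?andbT oppr_ge0 -ltNge => ->.
by move=> x0; apply/negP; rewrite oppr_ge0 -ltNge.
Qed.

Lemma derive_continuous (h dh : R -> R) : (forall x : R, is_derive x 1 h (dh x)) -> continuous h.
Proof.
move=> H x; apply: differentiable_continuous; apply/derivable1_diffP.
by have [] := H x.
Qed.

Lemma is_derive_sinlin (a x : R) : is_derive x 1 (fun u : R => sin (a * u)) (a * cos (a * x)).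
Proof. by have := is_derive1_comp (is_derive_sin (a * x)) (is_derive_lin a x); rewrite mulrC. Qed.

Lemma is_derive_coslin (a x : R) : is_derive x 1 (fun u : R => cos (a * u)) (- (a * sin (a * x))).
Proof. by have := is_derive1_comp (is_derive_cos (a * x)) (is_derive_lin a x); rewrite mulrC mulrN. Qed.

Lemma expR_small (e M r x : R) : 0 < e -> 0 < M -> 0 < r -> M / (e * r) <= x ->
  M * expR (- e * x) <= r.
Proof.
move=> e0 M0 r0 xM; have er0 : 0 < e * r by exact: mulr_gt0.
have x0 : 0 < x by apply: lt_le_trans xM; rewrite divr_gt0.
rewrite mulNr expRN ler_pdivrMr ?expR_gt0//.
apply: (@le_trans _ _ (r * (e * x))).
  by rewrite (_ : r * (e * x) = x * (e * r)); [rewrite -ler_pdivrMr|ring].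
by rewrite ler_pM2l// (le_trans _ (expR_ge1Dx _))// lerDr.
Qed.

(** The summand 1 keeps the integrand nonnegative, so that Tonelli's theorem applies throughout; its
    contribution is subtracted in [poisson_amp]. *)
Lemma integral_exp_cos (e a c : R) : 0 < e ->
  (\int[mu]_x (expR (- (e * `|x|)) * (1 + cos (a * x + c)))%:E =
   (2 / e + 2 * ker e a * cos c)%:E)%E.
Proof.
move=> e0; have D0 := ker_den a e0.
have mab : @measurable_fun _ _ TR TR setT (fun x => `|x|).
  by apply: continuous_measurable_fun; exact: norm_continuous.
have mf : measurable_fun setT (fun x : TR => expR (- (e * `|x|)) * (1 + cos (a * x + c))).
  apply: measurable_funM.
    apply: (measurableT_comp (@measurable_expR R)).
    by apply: measurableT_comp => //; apply: measurable_funM.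
  apply: measurable_funD => //.
  exact: (measurableT_comp measurable_cosT (measurable_affine a c)).
rewrite ge0_integral_half; last 2 first.
- exact/measurable_EFinP.
- by move=> x; rewrite lee_fin mulr_ge0 ?expR_ge0// -lerBlDl sub0r cos_geN1.
(* A primitive of the integrand folded onto the half-line, built from the elementary primitive of
   exp(-e x) cos(a x). *)
pose F (x : R) := - (2 / e) * expR (- e * x) + 2 * cos c / (e ^+ 2 + a ^+ 2) *
   (expR (- e * x) * (- e * cos (a * x) + a * sin (a * x))).
pose G (x : R) := expR (- e * x) * (2 + 2 * cos (a * x) * cos c).
have dF (x : R) : is_derive x 1 F (G x).
  have d1 := is_derive_explin (- e) x; have d2 := is_derive_coslin a x.
  have d3 := is_derive_sinlin a x.
  have d4 := is_deriveD (is_deriveZ (- (2 / e)) d1) (is_deriveZ (2 * cos c / (e ^+ 2 + a ^+ 2))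
    (is_deriveM d1 (is_deriveD (is_deriveZ (- e) d2) (is_deriveZ a d3)))).
  apply: (is_derive_eq d4); rewrite /GRing.scale /= !fctE /=  /G.
  rewrite /GRing.scale /=.
  move: D0; move: (expR _) (cos _) (cos c) (sin _) => E C1 C2 S1 D0; field.
  by rewrite !gt_eqF.
have cF := derive_continuous dF.
have cG : continuous G.
  have c1 := derive_continuous (is_derive_explin (- e)).
  have c2 := derive_continuous (is_derive_coslin a).
  move=> x; apply: cvgM; first exact: c1.
  apply: cvgD; first exact: cvg_cst.
  by apply: cvgM; [apply: cvgM; [exact: cvg_cst|exact: c2]|exact: cvg_cst].
rewrite (eq_integral (fun x : TR => (G x)%:E)); last first.
  move=> x; rewrite inE/= in_itv/= andbT => x0.
  rewrite normrN ger0_norm// -EFinD mulrN !cosD cosN sinN /G -!(mulNr e).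
  by congr EFin; move: (expR _) (cos _) (cos c) (sin _) (sin c) => E C1 C2 S1 S2; ring.
rewrite (@ge0_continuous_FTC2y R G F 0 0).
- rewrite /F !mulr0 expR0 cos0 sin0 -EFinB; congr EFin; rewrite /ker; field.
  by rewrite !gt_eqF.
- move=> x _; rewrite mulr_ge0 ?expR_ge0//.
- by apply: continuous_subspaceT.
- pose M := 2 / e + `|2 * cos c / (e ^+ 2 + a ^+ 2)| * (e + `|a|).
  have M0 : 0 < M by rewrite ltr_wpDr ?divr_gt0// mulr_ge0// addr_ge0// ltW.
  have FM (x : R) : `|F x| <= M * expR (- e * x).
    rewrite (_ : F x = (- (2 / e) + 2 * cos c / (e ^+ 2 + a ^+ 2) *
      (- e * cos (a * x) + a * sin (a * x))) * expR (- e * x)); last first.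
      by rewrite /F; move: (expR _) (2 * _ / _) (2 / e) => *; ring.
    rewrite normrM (ger0_norm (expR_ge0 _)) ler_wpM2r ?expR_ge0//.
    rewrite (le_trans (ler_normD _ _))// lerD//; first by rewrite normrN ger0_norm// divr_ge0// ltW.
    rewrite normrM ler_wpM2l// (le_trans (ler_normD _ _))// lerD//.
      by rewrite normrM normrN (gtr0_norm e0) ler_piMr ?(ltW e0)// cos_max.
    by rewrite normrM ler_piMr// sin_max.
  apply/cvgrPdist_le => r r0; near=> x.
  have xM : M / (e * r) <= x by near: x; apply: nbhs_pinfty_ge; exact: num_real.
  by rewrite sub0r normrN (le_trans (FM x))//; exact: expR_small xM.
- by move=> x _; have [] := dF x.
- by apply: cvg_at_right_filter; exact: cF.
- by move=> x _; rewrite derive1E; have [_ ->] := dF x.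
Unshelve. all: by end_near. Qed.

Lemma integral_ker1 : (\int[mu]_x (ker 1 x)%:E = (pi : R)%:E)%E.
Proof.
rewrite ge0_integral_half; last 2 first.
- by apply/measurable_EFinP; exact: measurable_ker.
- by move=> x; rewrite lee_fin ker_ge0.
under eq_integral do rewrite /ker sqrrN expr1n mul1r -/(oneDsqr _).
have mo : measurable_fun (`[0%R, +oo[%classic : set TR) (fun x : TR => ((oneDsqr x)^-1)%:E).
  apply/measurable_EFinP; apply: measurable_funTS.
  by apply: (eq_measurable_fun (ker 1)) => [x _|]; [rewrite /ker expr1n mul1r|exact: measurable_ker].
rewrite ge0_integralD//.
by rewrite integral0y_oneDsqr -EFinD -splitr.
Qed.

Lemma ker_subst (e w : R) (u : R -> R) : 0 < e ->
  @measurable_fun _ _ TR TR setT u -> (forall x, 0 <= u x) ->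
  (\int[mu]_v (u v * ker e (v - w))%:E = \int[mu]_x (u (e * x + w) * ker 1 x)%:E)%E.
Proof.
move=> e0 mu_ u0.
have mh : measurable_fun setT (fun x : TR => (u (e * x + w) * ker 1 x)%:E).
  apply/measurable_EFinP; apply: measurable_funM; last exact: measurable_ker.
  exact: (measurableT_comp mu_ (measurable_affine e w)).
rewrite -(@ge0_integral_affine R e^-1 (- w / e) (fun x => (u (e * x + w) * ker 1 x)%:E)) ?invr_eq0 ?gt_eqF//; last first.
  by move=> x; rewrite lee_fin mulr_ge0// ker_ge0.
apply: eq_integral => v _; rewrite -EFinM; congr EFin.
rewrite gtr0_norm ?invr_gt0//.
have -> : e * (e^-1 * v + - w / e) + w = v by field; rewrite gt_eqF.
rewrite [RHS]mulrCA; congr (u v * _); rewrite /ker.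
have h0 : e ^+ 2 + (v - w) ^+ 2 != 0 by rewrite gt_eqF// ker_den.
have -> : 1 ^+ 2 + (e^-1 * v + - w / e) ^+ 2 = (e ^+ 2 + (v - w) ^+ 2) / e ^+ 2.
  by field; rewrite gt_eqF.
by move: h0; move: (_ + _) => D h0; field; rewrite h0 gt_eqF.
Qed.

(** After the substitution v = e x + w the kernel is fixed and dominates. Its mass is pi, not 1,
    which is the origin of the powers of pi below. *)
Lemma ker_approx (u : R -> R) (w : R) : continuous u -> (forall x, 0 <= u x <= 1) ->
  (\int[mu]_v (u v * ker n.+1%:R^-1 (v - w))%:E @[n --> \oo] --> (u w * pi)%:E)%E.
Proof.
move=> cu uI.
have mu_ : @measurable_fun _ _ TR TR setT u by exact: continuous_measurable_fun.
have u0 x : 0 <= u x by case/andP: (uI x).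
have e0 n : 0 < n.+1%:R^-1 :> R by rewrite invr_gt0.
rewrite (_ : (fun n : nat => _) =
    (fun n : nat => \int[mu]_x (u (n.+1%:R^-1 * x + w) * ker 1 x)%:E)%E); last first.
  by apply/funext => n; exact: ker_subst.
have -> : (u w * pi)%:E = (\int[mu]_x (u w * ker 1 x)%:E)%E.
  under eq_integral do rewrite EFinM.
  rewrite ge0_integralZl ?lee_fin ?u0//; last 2 first.
  - by apply/measurable_EFinP; exact: measurable_ker.
  - by move=> x _; rewrite lee_fin ker_ge0.
  by rewrite integral_ker1.
have mk : @measurable_fun _ _ TR TR setT (ker 1) by exact: measurable_ker.
apply: (@dominated_cvg _ TR R mu setT measurableT
  (fun n (x : TR) => (u (n.+1%:R^-1 * x + w) * ker 1 x)%:E)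
  (fun x : TR => (u w * ker 1 x)%:E) (fun x : TR => (ker 1 x)%:E)) => //.
- move=> n; apply/measurable_EFinP; apply: measurable_funM => //.
  exact: (measurableT_comp mu_ (measurable_affine _ w)).
- move=> x _; apply: cvg_EFin; first by apply: nearW.
  apply: cvgM; last exact: cvg_cst.
  have cx : (n.+1%:R^-1 * x + w : R) @[n --> \oo] --> (w : R).
    rewrite -[X in _ --> X](add0r (w : R)) -[X in X + w](mul0r (x : R)).
    apply: cvgD; last exact: cvg_cst.
    by apply: cvgM; [exact: cvg_harmonic|exact: cvg_cst].
  exact: (continuous_cvg _ (cu w) cx).
- apply/integrableP; split; first exact/measurable_EFinP.
  rewrite (eq_integral (fun x : TR => (ker 1 x)%:E)) ?integral_ker1 ?ltry// => x _.
  by rewrite gee0_abs// lee_fin ker_ge0.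
- move=> n x _; rewrite abse_EFin lee_fin normrM !ger0_norm ?u0 ?ker_ge0//.
  by rewrite ler_piMl ?ker_ge0//; case/andP: (uI (n.+1%:R^-1 * x + w)).
Qed.
End PoissonKernel.

Section PoissonKernel3.
Context {R : realType}.
Notation TR := (measurableTypeR R).
Notation mu := (@lebesgue_measure R).

Definition expA (e x : R) : R := expR (- (e * `|x|)).

Lemma measurable_expA (e : R) : @measurable_fun _ _ TR TR setT (expA e).
Proof.
apply: (measurableT_comp (@measurable_expR R)).
by apply: measurableT_comp => //; apply: measurable_funM => //.
Qed.

Lemma expA_ge0 (e x : R) : 0 <= expA e x. Proof. exact: expR_ge0. Qed.

Lemma expA_le1 (e x : R) : 0 <= e -> expA e x <= 1.
Proof. by move=> e0; rewrite /expA -expR0 ler_expR oppr_le0 mulr_ge0. Qed.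

Lemma cos1_ge0 (x : R) : 0 <= 1 + cos x.
Proof. by rewrite -lerBlDl sub0r cos_geN1. Qed.

Lemma integral_expA (e : R) : 0 < e -> (\int[mu]_x (expA e x)%:E = (2 / e)%:E)%E.
Proof.
move=> e0; have := integral_exp_cos 0 (pi / 2) e0; rewrite cos_pihalf mulr0 addr0 => <-.
by apply: eq_integral => x _; rewrite mul0r add0r cos_pihalf addr0 mulr1.
Qed.

Lemma measurable_exp_cos (e a c : R) :
  @measurable_fun _ _ TR TR setT (fun x => expA e x * (1 + cos (a * x + c))).
Proof.
apply: measurable_funM; first exact: measurable_expA.
by apply: measurable_funD => //; exact: (measurableT_comp measurable_cosT (measurable_affine a c)).
Qed.

(** Functions A + B (1 + cos) with A, B >= 0 are stable under integration in one variable, since 2/e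
    - 2 [ker e a] >= 0. Iterating over three coordinates thus stays among nonnegative integrands. *)
Lemma integral_exp_step (e a c A B : R) : 0 < e -> 0 <= A -> 0 <= B ->
  (\int[mu]_x (expA e x * (A + B * (1 + cos (a * x + c))))%:E =
   (A * (2 / e) + B * (2 / e - 2 * ker e a) + 2 * ker e a * B * (1 + cos c))%:E)%E.
Proof.
move=> e0 A0 B0.
have mE := measurable_expA e; have mC := measurable_exp_cos e a c.
transitivity (\int[mu]_x (A%:E * (expA e x)%:E + B%:E * (expA e x * (1 + cos (a * x + c)))%:E))%E.
  by apply: eq_integral => x _; rewrite -!EFinM -EFinD; congr EFin; ring.
rewrite ge0_integralD//; last 4 first.
- by move=> x _; rewrite mule_ge0 ?lee_fin// expA_ge0.
- by apply: emeasurable_funM => //; exact/measurable_EFinP.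
- by move=> x _; rewrite mule_ge0 ?lee_fin// mulr_ge0 ?expA_ge0// cos1_ge0.
- by apply: emeasurable_funM => //; exact/measurable_EFinP.
rewrite !ge0_integralZl ?lee_fin//; last 4 first.
- exact/measurable_EFinP.
- by move=> x _; rewrite lee_fin mulr_ge0 ?expA_ge0// cos1_ge0.
- exact/measurable_EFinP.
- by move=> x _; rewrite lee_fin expA_ge0.
rewrite integral_expA// integral_exp_cos// -!EFinM -EFinD; congr EFin.
by move: (ker e a) (cos c) (2 / e) => k1 c1 d; ring.
Qed.

Lemma product_sigma_finite d1 d2 (T1 : measurableType d1) (T2 : measurableType d2)
    (m1 : {sigma_finite_measure set T1 -> \bar R}) (m2 : {sigma_finite_measure set T2 -> \bar R}) :
  sigma_finite setT (m1 \x m2)%E.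
Proof.
have /sigma_finiteP[F [TF ndF Foo]] := sigma_finiteT m1.
have /sigma_finiteP[G [TG ndG Goo]] := sigma_finiteT m2.
exists (fun n => F n `*` G n).
  apply/seteqP; split => // -[x y] _.
  have [n _ Fx] : (\bigcup_i F i) x by rewrite -TF.
  have [k _ Gy] : (\bigcup_i G i) y by rewrite -TG.
  exists (maxn n k) => //; split => /=.
    by move: x Fx; apply/subsetPset/ndF/leq_maxl.
  by move: y Gy; apply/subsetPset/ndG/leq_maxr.
move=> k; have [mF Fk] := Foo k; have [mG Gk] := Goo k.
split; first exact: measurableX.
by rewrite product_measure1E// lte_mul_pinfty// ge0_fin_numE.
Qed.

(* The library's canonical sigma-finite structure on products covers products
   of subprobabilities only. *)
Definition leb2 : set (TR * TR) -> \bar R := (mu \x mu)%E.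
HB.instance Definition _ := Measure.on leb2.
HB.instance Definition _ := @Measure_isSigmaFinite.Build _ _ _ leb2 (product_sigma_finite mu mu).
Definition leb3 : set (R3 R) -> \bar R := (leb2 \x mu)%E.
HB.instance Definition _ := Measure.on leb3.
HB.instance Definition _ := @Measure_isSigmaFinite.Build _ _ _ leb3 (product_sigma_finite leb2 mu).

Lemma lebesgue3_tonelli (h : R3 R -> \bar R) : measurable_fun setT h -> (forall x, (0 <= h x)%E) ->
  (\int[lebesgue3]_x h x = \int[mu]_z \int[mu]_y \int[mu]_x h (x, y, z))%E.
Proof.
move=> mh h0; have H := @fubini_tonelli2 _ _ (TR * TR)%type TR R leb2 mu h mh h0.
apply: (eq_trans H); apply: eq_integral => z _; rewrite /fubini_G.
have mz : measurable_fun setT (fun p : TR * TR => h (p, z)).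
  by apply: (measurableT_comp mh); exact: pair2_measurable.
exact: (@fubini_tonelli2 _ _ TR TR R mu mu (fun p => h (p, z)) mz (fun p => h0 (p, z))).
Qed.

Lemma lebesgue3_prod (a1 a2 a3 : R -> R) :
  @measurable_fun _ _ TR TR setT a1 -> @measurable_fun _ _ TR TR setT a2 ->
  @measurable_fun _ _ TR TR setT a3 ->
  (forall x, 0 <= a1 x) -> (forall x, 0 <= a2 x) -> (forall x, 0 <= a3 x) ->
  (\int[lebesgue3]_x (a1 x.1.1 * a2 x.1.2 * a3 x.2)%:E =
   (\int[mu]_x (a1 x)%:E) * (\int[mu]_x (a2 x)%:E) * (\int[mu]_x (a3 x)%:E))%E.
Proof.
move=> m1 m2 m3 p1 p2 p3.
have i1 : (0 <= \int[mu]_x (a1 x)%:E)%E by apply: integral_ge0 => x _; rewrite lee_fin.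
have i2 : (0 <= \int[mu]_x (a2 x)%:E)%E by apply: integral_ge0 => x _; rewrite lee_fin.
rewrite lebesgue3_tonelli; last 2 first.
- apply/measurable_EFinP; apply: measurable_funM; first apply: measurable_funM.
  + exact: (measurableT_comp m1 (@measurable_c1 R)).
  + exact: (measurableT_comp m2 (@measurable_c2 R)).
  + exact: (measurableT_comp m3 (@measurable_c3 R)).
- by move=> x; rewrite lee_fin !mulr_ge0.
transitivity (\int[mu]_z ((\int[mu]_x (a1 x)%:E * \int[mu]_x (a2 x)%:E) * (a3 z)%:E))%E; last first.
  rewrite ge0_integralZl ?mule_ge0//; first exact/measurable_EFinP.
  by move=> x _; rewrite lee_fin.
apply: eq_integral => z _.
transitivity (\int[mu]_y ((\int[mu]_x (a1 x)%:E * (a3 z)%:E) * (a2 y)%:E))%E; last first.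
  rewrite ge0_integralZl ?mule_ge0 ?lee_fin//; [|exact/measurable_EFinP|].
  - by rewrite muleAC.
  - by move=> x _; rewrite lee_fin.
apply: eq_integral => y _.
transitivity (\int[mu]_x ((a2 y * a3 z)%:E * (a1 x)%:E))%E.
  by apply: eq_integral => x _; rewrite -EFinM; congr EFin; ring.
rewrite ge0_integralZl ?lee_fin ?mulr_ge0//; [|exact/measurable_EFinP|].
- by rewrite EFinM muleC -muleA (muleC (a3 z)%:E).
- by move=> x _; rewrite lee_fin.
Qed.

Definition expA3 (e : R) (x : R3 R) : R := expA e x.1.1 * expA e x.1.2 * expA e x.2.
Definition ker3 (e : R) (x : R3 R) : R := ker e x.1.1 * ker e x.1.2 * ker e x.2.

Lemma measurable_prod3 (a1 a2 a3 : R -> R) :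
  @measurable_fun _ _ TR TR setT a1 -> @measurable_fun _ _ TR TR setT a2 ->
  @measurable_fun _ _ TR TR setT a3 ->
  measurable_fun setT (fun x : R3 R => a1 x.1.1 * a2 x.1.2 * a3 x.2).
Proof.
move=> m1 m2 m3; apply: measurable_funM; first apply: measurable_funM.
- exact: (measurableT_comp m1 (@measurable_c1 R)).
- exact: (measurableT_comp m2 (@measurable_c2 R)).
- exact: (measurableT_comp m3 (@measurable_c3 R)).
Qed.

Lemma measurable_expA3 (e : R) : measurable_fun setT (expA3 e).
Proof. by apply: measurable_prod3; exact: measurable_expA. Qed.

Lemma measurable_ker3 (e : R) : measurable_fun setT (ker3 e).
Proof. by apply: measurable_prod3; exact: measurable_ker. Qed.

Lemma expA3_ge0 (e : R) (x : R3 R) : 0 <= expA3 e x.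
Proof. by rewrite !mulr_ge0 ?expA_ge0. Qed.

Lemma expA3_le1 (e : R) (x : R3 R) : 0 <= e -> expA3 e x <= 1.
Proof. by move=> e0; rewrite !mulr_ile1 ?mulr_ge0 ?expA_ge0 ?expA_le1. Qed.

Lemma ker3_ge0 (e : R) (x : R3 R) : 0 < e -> 0 <= ker3 e x.
Proof. by move=> e0; apply: mulr_ge0; [apply: mulr_ge0|]; exact: ker_ge0. Qed.

Lemma integral_expA3 (e : R) : 0 < e -> (\int[lebesgue3]_x (expA3 e x)%:E = ((2 / e) ^+ 3)%:E)%E.
Proof.
move=> e0; rewrite lebesgue3_prod; try exact: measurable_expA; try exact: expA_ge0.
by rewrite !integral_expA// -!EFinM; congr EFin; ring.
Qed.

Lemma integral_exp_cos3 (e : R) (v : R3 R) : 0 < e ->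
  (\int[lebesgue3]_x (expA3 e x * (1 + cos (dot3 v x)))%:E =
   ((2 / e) ^+ 3 + 8 * ker3 e v)%:E)%E.
Proof.
move=> e0.
have k0 (a : R) : 0 <= 2 * ker e a by rewrite mulr_ge0// ker_ge0.
have k1 (a : R) : 0 <= 2 / e - 2 * ker e a.
  by rewrite subr_ge0 ler_wpM2l// ker_le.
have e2 : 0 <= 2 / e by rewrite divr_ge0// ltW.
rewrite lebesgue3_tonelli; last 2 first.
- apply/measurable_EFinP; apply: measurable_funM; first exact: measurable_expA3.
  by apply: measurable_funD => //; exact: (measurableT_comp measurable_cosT (measurable_dot3 v)).
- by move=> x; rewrite lee_fin mulr_ge0 ?expA3_ge0// cos1_ge0.
(* The coefficients after one and two integrations, starting from A = 0 and B = 1. *)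
pose A1 := 0 * (2 / e) + 1 * (2 / e - 2 * ker e v.1.1).
pose B1 := 2 * ker e v.1.1 * 1.
pose A2 := A1 * (2 / e) + B1 * (2 / e - 2 * ker e v.1.2).
pose B2 := 2 * ker e v.1.2 * B1.
have A10 : 0 <= A1 by rewrite /A1 mul0r add0r mul1r.
have B10 : 0 <= B1 by rewrite /B1 mulr1.
have A20 : 0 <= A2 by rewrite addr_ge0// mulr_ge0.
have B20 : 0 <= B2 by rewrite mulr_ge0.
transitivity (\int[mu]_z (expA e z * (A2 + B2 * (1 + cos (v.2 * z + 0))))%:E)%E; last first.
  rewrite integral_exp_step// cos0; congr EFin; rewrite /A2 /B2 /A1 /B1 /ker3.
  by move: (ker e _) (ker e _) (ker e _) (2 / e) => p q r d; ring.
apply: eq_integral => z _.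
transitivity (\int[mu]_y ((expA e z)%:E * (expA e y * (A1 + B1 * (1 + cos (v.1.2 * y + v.2 * z))))%:E))%E; last first.
  rewrite ge0_integralZl ?lee_fin ?expA_ge0//.
  - by rewrite integral_exp_step// addr0.
  - apply/measurable_EFinP; apply: measurable_funM; first exact: measurable_expA.
    apply: measurable_funD => //; apply: measurable_funM => //; apply: measurable_funD => //.
    exact: (measurableT_comp measurable_cosT (measurable_affine _ _)).
  - by move=> y _; rewrite lee_fin mulr_ge0 ?expA_ge0// addr_ge0// mulr_ge0// cos1_ge0.
apply: eq_integral => y _.
transitivity (\int[mu]_x ((expA e z * expA e y)%:E *
    (expA e x * (0 + 1 * (1 + cos (v.1.1 * x + (v.1.2 * y + v.2 * z)))))%:E))%E.
  apply: eq_integral => x _; rewrite -EFinM /expA3 /dot3/=; congr EFin.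
  by rewrite -addrA; ring.
rewrite ge0_integralZl ?lee_fin ?mulr_ge0 ?expA_ge0//.
- rewrite integral_exp_step// -!EFinM.
  congr EFin; exact: esym (mulrA _ _ _).
- apply/measurable_EFinP; apply: measurable_funM; first exact: measurable_expA.
  apply: measurable_funD => //; apply: measurable_funM => //; apply: measurable_funD => //.
  exact: (measurableT_comp measurable_cosT (measurable_affine _ _)).
- by move=> x _; rewrite lee_fin mulr_ge0 ?expA_ge0// add0r mul1r cos1_ge0.
Qed.

End PoissonKernel3.

Section Inversion.
Context {R : realType}.
Notation TR := (measurableTypeR R).
Notation mu := (@lebesgue_measure R).
Variable P : probability (R3 R) R.
Implicit Types (v w xi : R3 R).

(** The real part of e^(i v.xi) psi(xi). The imaginary part is odd in xi and does not contribute to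
    the inversion integral. *)
Definition amp v xi : R := cos (dot3 v xi) * cosF P xi + sin (dot3 v xi) * sinF P xi.

Lemma measurable_amp v : measurable_fun setT (amp v).
Proof.
have m := measurable_dot3 v.
apply: measurable_funD; apply: measurable_funM.
- exact: (measurableT_comp measurable_cosT m).
- exact: measurable_cosF.
- exact: (measurableT_comp measurable_sinT m).
- exact: measurable_sinF.
Qed.

(** Makes [ker3 1], whose integral is explicit, a dominating function for the frequency
    integrals. *)
Lemma ker3_lower xi : (1 + dot3 xi xi) ^- 3 <= ker3 1 xi.
Proof.
rewrite /ker3 /ker !expr1n !mul1r -!invfM.
have [a0 [b0 c0]] : 0 <= xi.1.1 ^+ 2 /\ 0 <= xi.1.2 ^+ 2 /\ 0 <= xi.2 ^+ 2 by rewrite !sqr_ge0.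
rewrite /dot3 -!expr2; move: a0 b0 c0.
move: (xi.1.1 ^+ 2 : R) (xi.1.2 ^+ 2 : R) (xi.2 ^+ 2 : R) => a b c a0 b0 c0.
have s0 : 0 <= a + b + c by rewrite !addr_ge0.
rewrite lef_pV2 ?posrE ?exprn_gt0 ?mulr_gt0 ?ltr_pwDl//.
rewrite !exprS expr0 mulr1 mulrA.
apply: ler_pM; [by rewrite mulr_ge0 ?addr_ge0|by rewrite addr_ge0| |by lra].
by apply: ler_pM; rewrite ?addr_ge0//; lra.
Qed.

Lemma integral_ker31 : (\int[lebesgue3]_x (ker3 1 x)%:E = (pi ^+ 3 : R)%:E)%E.
Proof.
rewrite lebesgue3_prod; try exact: measurable_ker; try by move=> x; exact: ker_ge0.
by rewrite !integral_ker1 -!EFinM; congr EFin; ring.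
Qed.

Lemma lebesgue3_dominated (h : R3 R -> R) (M : R) : measurable_fun setT h ->
  (forall x, `|h x| <= M * ker3 1 x) -> lebesgue3.-integrable setT (EFin \o h).
Proof.
move=> mh hM.
apply: (@le_integrable _ _ R lebesgue3 setT measurableT _ (fun x => (M * ker3 1 x)%:E)).
- exact/measurable_EFinP.
- move=> x _; rewrite /= lee_fin; apply: (le_trans (hM x)); exact: ler_norm.
- rewrite (_ : (fun x => _) = (fun x => M%:E * (ker3 1 x)%:E)%E); last by apply/funext => x; rewrite EFinM.
  apply: integrableZl => //; apply/integrableP; split.
    by apply/measurable_EFinP; exact: measurable_ker3.
  rewrite (eq_integral (fun x : R3 R => (ker3 1 x)%:E)) ?integral_ker31 ?ltry// => x _.
  by rewrite gee0_abs// lee_fin ker3_ge0.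
Qed.

Hypothesis decay : forall k : nat, exists C : R, forall xi, (1 + dot3 xi xi) ^+ k * qF P xi <= C.

Lemma decay_ker3 (k : nat) : exists2 C : R, 0 <= C & forall xi,
  (1 + dot3 xi xi) ^+ k * qF P xi <= C * ker3 1 xi.
Proof.
have [C HC] := decay (k + 3).
have d0 xi : 0 < 1 + dot3 xi xi by rewrite ltr_pwDl// dot3_ge0.
have C0 : 0 <= C.
  by apply: le_trans (HC 0); rewrite mulr_ge0 ?qF_ge0// exprn_ge0// ltW.
exists C => // xi; apply: (@le_trans _ _ (C * (1 + dot3 xi xi) ^- 3)).
  by rewrite ler_pdivlMr ?exprn_gt0// mulrAC -exprD.
by rewrite ler_wpM2l// ker3_lower.
Qed.

Lemma amp_bound : exists2 M : R, 0 <= M & forall v xi, `|amp v xi| <= M * ker3 1 xi.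
Proof.
(* The modulus is the square root of q, so power 6 for q gives power 3, that of [ker3_lower]. *)
have [C HC] := decay 6.
have d0 xi : 0 < 1 + dot3 xi xi by rewrite ltr_pwDl// dot3_ge0.
have C0 : 0 <= C.
  by apply: le_trans (HC 0); rewrite mulr_ge0 ?qF_ge0// exprn_ge0// ltW.
have B xi (c : R) : c ^+ 2 <= qF P xi -> `|c| <= Num.sqrt C * ker3 1 xi.
  move=> cq; apply: (@le_trans _ _ (Num.sqrt C * (1 + dot3 xi xi) ^- 3)); last first.
    by rewrite ler_wpM2l ?sqrtr_ge0// ker3_lower.
  rewrite -sqrtr_sqr ler_pdivlMr ?exprn_gt0//.
  rewrite -(@ger0_norm _ ((1 + dot3 xi xi) ^+ 3)) ?exprn_ge0 ?(ltW (d0 xi))// -sqrtr_sqr -sqrtrM ?sqr_ge0//.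
  rewrite ler_sqrt// -exprM mulrC; apply: le_trans (HC xi).
  by rewrite ler_wpM2l// exprn_ge0// ltW.
exists (2 * Num.sqrt C) => [|v xi]; first by rewrite mulr_ge0 ?sqrtr_ge0.
have B1 : `|cosF P xi| <= Num.sqrt C * ker3 1 xi by apply: B; rewrite /qF lerDl sqr_ge0.
have B2 : `|sinF P xi| <= Num.sqrt C * ker3 1 xi by apply: B; rewrite /qF lerDr sqr_ge0.
rewrite /amp (le_trans (ler_normD _ _))// !normrM -mulrA mulr_natl mulr2n lerD//.
  by apply: le_trans B1; rewrite ler_piMl// cos_max.
by apply: le_trans B2; rewrite ler_piMl// sin_max.
Qed.

Lemma measurable_dot_diff v : measurable_fun setT (fun p : R3 R * R3 R => dot3 (v - p.1) p.2).
Proof.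
have [[m1 m2] m3] := (@measurable_c1 R, @measurable_c2 R, @measurable_c3 R).
have f1 (h : R3 R -> TR) : measurable_fun setT h -> measurable_fun setT (fun p : R3 R * R3 R => h p.1).
  by move=> mh; apply: (measurableT_comp mh); exact: measurable_fst.
have f2 (h : R3 R -> TR) : measurable_fun setT h -> measurable_fun setT (fun p : R3 R * R3 R => h p.2).
  by move=> mh; apply: (measurableT_comp mh); exact: measurable_snd.
apply: measurable_funD; first apply: measurable_funD; apply: measurable_funM.
- by apply: measurable_funB => //; exact: f1 m1.
- exact: f2 m1.
- by apply: measurable_funB => //; exact: f1 m2.
- exact: f2 m2.
- by apply: measurable_funB => //; exact: f1 m3.
- exact: f2 m3.
Qed.

Lemma measurable_subl v : @measurable_fun _ _ (R3 R) (R3 R) setT (fun w => v - w).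
Proof.
rewrite (_ : (fun _ => _) = (fun w : R3 R => (v.1.1 - w.1.1, v.1.2 - w.1.2, v.2 - w.2)))//.
by apply: measurable_triple; apply: measurable_funB => //;
  [exact: measurable_c1|exact: measurable_c2].
Qed.

Lemma integral_cos_diff v xi (c : R) : 0 <= c ->
  (\int[P]_w (c * (1 + cos (dot3 (v - w) xi)))%:E = (c * (1 + amp v xi))%:E)%E.
Proof.
move=> c0; have mT := @measurableT _ (R3 R).
have iC := integrable_cosF P xi mT; have iS := integrable_sinF P xi mT.
have jC := integrableZl mT (cos (dot3 v xi)) iC; have jS := integrableZl mT (sin (dot3 v xi)) iS.
have E1 : \int[P]_w (cos (dot3 v xi) * cos (dot3 w xi) + sin (dot3 v xi) * sin (dot3 w xi)) = amp v xi.
  by rewrite (RintegralD mT jC jS) (RintegralZl _ mT iC) (RintegralZl _ mT iS).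
have jD := integrableD mT jC jS.
have i1 : P.-integrable setT (EFin \o (fun=> 1 : R)).
  by apply: (@probability_integrable _ _ _ _ 1) => // w _; rewrite normr1.
have j1 := integrableD mT i1 jD.
have -> : (c * (1 + amp v xi))%:E = (\int[P]_w (c * (1 + (cos (dot3 v xi) * cos (dot3 w xi) +
    sin (dot3 v xi) * sin (dot3 w xi)))))%:E.
  rewrite (RintegralZl c mT j1) (RintegralD mT i1 jD) E1.
  by rewrite Rintegral_cst//= probability_setT mul1r.
rewrite /Rintegral fineK; last by apply: integrable_fin_num => //; exact: (integrableZl mT c j1).
apply: eq_integral => w _; congr (_ * (1 + _))%:E.
rewrite (_ : dot3 (v - w) xi = dot3 v xi - dot3 w xi); last by rewrite /dot3/=; ring.
by rewrite cosB.
Qed.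

(** Both sides are the double integral of expA3(xi) (1 + cos((v - w).xi)), over w for [P] and over
    xi for Lebesgue measure, in the two orders. *)
Lemma poisson_smoothing (e : R) v : 0 < e ->
  (((2 / e) ^+ 3)%:E + 8%:E * \int[P]_w (ker3 e (v - w))%:E =
   \int[lebesgue3]_xi (expA3 e xi * (1 + amp v xi))%:E)%E.
Proof.
move=> e0.
pose h (p : R3 R * R3 R) : \bar R := (expA3 e p.2 * (1 + cos (dot3 (v - p.1) p.2)))%:E.
have mh : measurable_fun setT h.
  apply/measurable_EFinP; apply: measurable_funM.
    by apply: (measurableT_comp (measurable_expA3 e)); exact: measurable_snd.
  by apply: measurable_funD => //; exact: (measurableT_comp measurable_cosT (measurable_dot_diff v)).
have h0 p : (0 <= h p)%E by rewrite lee_fin mulr_ge0 ?expA3_ge0// cos1_ge0.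
have F := @fubini_tonelli _ _ (R3 R) (R3 R) R P leb3 h mh h0.
transitivity (\int[P]_w \int[leb3]_xi h (w, xi))%E; last first.
  apply: (eq_trans F); apply: eq_integral => xi _.
  by rewrite /h/= integral_cos_diff// expA3_ge0.
have mk : measurable_fun setT (fun w : R3 R => (ker3 e (v - w))%:E).
  apply/measurable_EFinP; apply: (measurableT_comp (measurable_ker3 e)).
  exact: measurable_subl.
transitivity (\int[P]_w (((2 / e) ^+ 3)%:E + 8%:E * (ker3 e (v - w))%:E))%E; last first.
  apply: eq_integral => w _; rewrite -EFinM -EFinD -integral_exp_cos3//.
rewrite ge0_integralD//; last 3 first.
- by move=> w _; rewrite lee_fin exprn_ge0// divr_ge0// ltW.
- by move=> w _; rewrite mule_ge0 ?lee_fin ?ker3_ge0.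
- exact: emeasurable_funM.
congr (_ + _)%E; first by rewrite integral_cst//= probability_setT mule1.
rewrite ge0_integralZl ?lee_fin//.
by move=> w _; rewrite lee_fin ker3_ge0.
Qed.

Lemma expA3_integrable (e : R) : 0 < e -> lebesgue3.-integrable setT (EFin \o expA3 e).
Proof.
move=> e0; apply/integrableP; split; first by apply/measurable_EFinP; exact: measurable_expA3.
rewrite (eq_integral (fun x : R3 R => (expA3 e x)%:E)) ?integral_expA3 ?ltry// => x _.
by rewrite [LHS]abse_EFin ger0_norm ?expA3_ge0.
Qed.

Lemma measurable_expA3_amp (e : R) v : measurable_fun setT (fun xi => expA3 e xi * amp v xi).
Proof. by apply: measurable_funM; [exact: measurable_expA3|exact: measurable_amp]. Qed.

Lemma poisson_amp (e : R) v : 0 < e ->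
  (8%:E * \int[P]_w (ker3 e (v - w))%:E = \int[lebesgue3]_xi (expA3 e xi * amp v xi)%:E)%E.
Proof.
move=> e0; have [M M0 HM] := amp_bound.
have iA := expA3_integrable e0.
have iB : lebesgue3.-integrable setT (EFin \o (fun xi => expA3 e xi * amp v xi)).
  apply: (@lebesgue3_dominated _ M); first exact: measurable_expA3_amp.
  move=> xi; rewrite normrM (ger0_norm (expA3_ge0 _ _)); apply: le_trans (HM v xi).
  by rewrite ler_piMl// expA3_le1// ltW.
have := poisson_smoothing v e0.
have -> : (\int[lebesgue3]_xi (expA3 e xi * (1 + amp v xi))%:E =
    \int[lebesgue3]_xi (expA3 e xi)%:E + \int[lebesgue3]_xi (expA3 e xi * amp v xi)%:E)%E.
  rewrite -(integralD measurableT iA iB); apply: eq_integral => xi _.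
  by rewrite /= -EFinD mulrDr mulr1.
rewrite integral_expA3// => /(congr1 (fun z => z - ((2 / e) ^+ 3)%:E)%E).
by rewrite ![(_%:E + _)%E]addeC !addeK.
Qed.

(** The density is this function divided by pi^3, which restores the usual factor (2 pi)^-3; here
    pi^3 is the mass of the Poisson kernel. *)
Definition inv_fourier v : R := 8^-1 * \int[lebesgue3]_xi amp v xi.

Lemma poisson_integral v (e : R) : 0 < e -> (\int[P]_w (ker3 e (v - w))%:E =
  8^-1%:E * \int[lebesgue3]_xi (expA3 e xi * amp v xi)%:E)%E.
Proof. by move=> e0; rewrite -poisson_amp// muleA -EFinM mulVf// mul1e. Qed.

Lemma poisson_cvg v :
  (\int[P]_w (ker3 n.+1%:R^-1 (v - w))%:E @[n --> \oo] --> (inv_fourier v)%:E)%E.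
Proof.
have [M M0 HM] := amp_bound.
have e0 n : 0 < n.+1%:R^-1 :> R by rewrite invr_gt0.
rewrite (_ : (fun n : nat => _) = (fun n : nat =>
   8^-1%:E * \int[lebesgue3]_xi (expA3 n.+1%:R^-1 xi * amp v xi)%:E)%E); last first.
  by apply/funext => n; exact: poisson_integral.
have ia : lebesgue3.-integrable setT (EFin \o amp v).
  by apply: (@lebesgue3_dominated _ M) => //; exact: measurable_amp.
have -> : (inv_fourier v)%:E = (8^-1%:E * \int[lebesgue3]_xi (amp v xi)%:E)%E.
  rewrite /inv_fourier EFinM /Rintegral fineK//.
  by apply: integrable_fin_num.
apply: cvgeZl => //.
apply: (@dominated_cvg _ (R3 R) R lebesgue3 setT measurableT
  (fun n xi => (expA3 n.+1%:R^-1 xi * amp v xi)%:E) (fun xi => (amp v xi)%:E)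
  (fun xi => (M * ker3 1 xi)%:E)) => //.
- by move=> n; apply/measurable_EFinP; exact: measurable_expA3_amp.
- move=> xi _; apply: cvg_EFin; first by apply: nearW.
  rewrite -[X in _ --> X]mul1r; apply: cvgM; last exact: cvg_cst.
  have c1 (x : R) : expA n.+1%:R^-1 x @[n --> \oo] --> (1 : R).
    have E1 : (1 : R) = expR (- (0 * `|x|)) by rewrite mul0r oppr0 expR0.
    rewrite [X in _ --> X]E1.
    have h : - (n.+1%:R^-1 * `|x|) @[n --> \oo] --> (- (0 * `|x|) : R).
      by apply: cvgN; apply: cvgM; [exact: cvg_harmonic|exact: cvg_cst].
    exact: (continuous_cvg _ (@continuous_expR R _) h).
  have E2 : (1 : R) = 1 * 1 * 1 by rewrite !mulr1.
  rewrite [X in _ --> X]E2 /expA3.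
  by apply: cvgM; first apply: cvgM; exact: c1.
- apply: (@lebesgue3_dominated (fun xi => M * ker3 1 xi) M).
    by apply: measurable_funM => //; exact: measurable_ker3.
  by move=> xi; rewrite ger0_norm// mulr_ge0// ker3_ge0.
- move=> n xi _; rewrite abse_EFin lee_fin normrM (ger0_norm (expA3_ge0 _ _)).
  by apply: le_trans (HM v xi); rewrite ler_piMl// expA3_le1// ltW.
Qed.

(** The bound is uniform in [e]. It dominates the convergence in [test_integral], and in the limit
    it bounds the density, whence its square integrability. *)
Lemma poisson_bound : exists2 B : R, 0 <= B & forall e v, 0 < e ->
  (\int[P]_w (ker3 e (v - w))%:E <= B%:E)%E.
Proof.
have [M M0 HM] := amp_bound.
exists (M * pi ^+ 3); first by rewrite mulr_ge0 ?exprn_ge0 ?pi_ge0.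
move=> e v e0.
have I0 : (0 <= \int[P]_w (ker3 e (v - w))%:E)%E.
  by apply: integral_ge0 => w _; rewrite lee_fin ker3_ge0.
apply: (@le_trans _ _ (8%:E * \int[P]_w (ker3 e (v - w))%:E)%E).
  by rewrite -[leLHS]mul1e lee_wpmul2r// lee_fin ler1n.
rewrite poisson_amp// EFinM -integral_ker31.
rewrite -ge0_integralZl ?lee_fin//; last 2 first.
- by apply/measurable_EFinP; exact: measurable_ker3.
- by move=> w _; rewrite lee_fin ker3_ge0.
have mA : measurable_fun setT (fun xi => (expA3 e xi * amp v xi)%:E).
  by apply/measurable_EFinP; exact: measurable_expA3_amp.
apply: le_trans (le_trans (lee_abs _) (le_abse_integral lebesgue3 measurableT mA)) _.
apply: ge0_le_integral => //.
- exact: measurableT_comp.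
- by apply: emeasurable_funM => //; apply/measurable_EFinP; exact: measurable_ker3.
- move=> xi _; rewrite -EFinM abse_EFin lee_fin normrM (ger0_norm (expA3_ge0 _ _)).
  by apply: le_trans (HM v xi); rewrite ler_piMl// expA3_le1// ltW.
Qed.

Lemma measurable_poisson (e : R) : 0 < e ->
  measurable_fun setT (fun v => \int[P]_w (ker3 e (v - w))%:E)%E.
Proof.
move=> e0; pose h (p : R3 R * R3 R) : \bar R := (ker3 e (p.1 - p.2))%:E.
have mh : measurable_fun setT h.
  by apply/measurable_EFinP; exact: (measurableT_comp (measurable_ker3 e) measurable_diff).
apply: (@measurable_fun_fubini_tonelli_F _ _ (R3 R) (R3 R) R P h mh).
by move=> p; rewrite lee_fin ker3_ge0.
Qed.

Lemma inv_fourier_ge0 v : 0 <= inv_fourier v.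
Proof.
have H := @cvge_to_ge _ _ _ R _ 0%E _ (@poisson_cvg v).
rewrite -lee_fin; apply: H; apply: nearW => n.
by apply: integral_ge0 => w _; rewrite lee_fin ker3_ge0.
Qed.

Lemma inv_fourier_bounded : exists2 B : R, 0 <= B & forall v, inv_fourier v <= B.
Proof.
have [B B0 HB] := poisson_bound; exists B => // v.
have H := @cvge_to_le _ _ _ R _ B%:E _ (@poisson_cvg v).
rewrite -lee_fin; apply: H; apply: nearW => n.
by apply: HB; rewrite invr_gt0.
Qed.

Lemma measurable_inv_fourier : measurable_fun setT inv_fourier.
Proof.
apply/measurable_EFinP; apply: (@emeasurable_fun_cvg _ _ _ _
  (fun n v => \int[P]_w (ker3 n.+1%:R^-1 (v - w))%:E)%E).
- by move=> n; apply: measurable_poisson; rewrite invr_gt0.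
- by move=> v _; exact: poisson_cvg.
Qed.

End Inversion.

(** * Identification of the density by test functions *)

Section TestIntegrals.
Context {R : realType}.
Notation TR := (measurableTypeR R).
Notation mu := (@lebesgue_measure R).
Variable P : probability (R3 R) R.
Implicit Types (v w xi : R3 R).
Hypothesis decay : forall k : nat, exists C : R, forall xi, (1 + dot3 xi xi) ^+ k * qF P xi <= C.

Variables u1 u2 u3 : R -> R.
Hypotheses (cu1 : continuous u1) (cu2 : continuous u2) (cu3 : continuous u3).
Hypotheses (uI1 : forall x, 0 <= u1 x <= 1) (uI2 : forall x, 0 <= u2 x <= 1)
  (uI3 : forall x, 0 <= u3 x <= 1).
Hypotheses (iu1 : (\int[mu]_x (u1 x)%:E < +oo)%E) (iu2 : (\int[mu]_x (u2 x)%:E < +oo)%E)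
  (iu3 : (\int[mu]_x (u3 x)%:E < +oo)%E).

Let h (v : R3 R) : R := u1 v.1.1 * u2 v.1.2 * u3 v.2.

Let mu1 : @measurable_fun _ _ TR TR setT u1. Proof. exact: continuous_measurable_fun. Qed.
Let mu2 : @measurable_fun _ _ TR TR setT u2. Proof. exact: continuous_measurable_fun. Qed.
Let mu3 : @measurable_fun _ _ TR TR setT u3. Proof. exact: continuous_measurable_fun. Qed.
Let u10 x : 0 <= u1 x. Proof. by case/andP: (uI1 x). Qed.
Let u20 x : 0 <= u2 x. Proof. by case/andP: (uI2 x). Qed.
Let u30 x : 0 <= u3 x. Proof. by case/andP: (uI3 x). Qed.
Let mh : measurable_fun setT h. Proof. exact: measurable_prod3. Qed.
Let h0 v : 0 <= h v. Proof. by rewrite !mulr_ge0. Qed.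

Let smooth (u : R -> R) (e z : R) : \bar R := (\int[mu]_x (u x * ker e (x - z))%:E)%E.

Let smooth_ge0 u e z : (forall x, 0 <= u x) -> 0 < e -> (0 <= smooth u e z)%E.
Proof. by move=> u0 e0; apply: integral_ge0 => x _; rewrite lee_fin mulr_ge0// ker_ge0. Qed.

Let smooth_le u e z : @measurable_fun _ _ TR TR setT u -> (forall x, 0 <= u x <= 1) -> 0 < e ->
  (smooth u e z <= (pi : R)%:E)%E.
Proof.
move=> m uI e0; have u0 x : 0 <= u x by case/andP: (uI x).
rewrite /smooth ker_subst// -integral_ker1; apply: ge0_le_integral => //.
- by move=> x _; rewrite lee_fin mulr_ge0// ker_ge0.
- apply/measurable_EFinP; apply: measurable_funM; last exact: measurable_ker.
  exact: (measurableT_comp m (measurable_affine e z)).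
- by apply/measurable_EFinP; exact: measurable_ker.
- by move=> x _; rewrite lee_fin ler_piMl ?ker_ge0//; case/andP: (uI (e * x + z)).
Qed.

Lemma test_tonelli (e : R) : 0 < e ->
  measurable_fun setT (fun w : R3 R => smooth u1 e w.1.1 * smooth u2 e w.1.2 * smooth u3 e w.2)%E /\
  (\int[lebesgue3]_v ((h v)%:E * \int[P]_w (ker3 e (v - w))%:E) =
   \int[P]_w (smooth u1 e w.1.1 * smooth u2 e w.1.2 * smooth u3 e w.2))%E.
Proof.
move=> e0; pose F (p : R3 R * R3 R) : \bar R := (h p.1 * ker3 e (p.1 - p.2))%:E.
have mF : measurable_fun setT F.
  apply/measurable_EFinP; apply: measurable_funM.
    by apply: (measurableT_comp mh); exact: measurable_fst.
  exact: (measurableT_comp (measurable_ker3 e) measurable_diff).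
have F0 p : (0 <= F p)%E by rewrite lee_fin mulr_ge0// ker3_ge0.
have mk (w : R) : @measurable_fun _ _ TR TR setT (fun x => ker e (x - w)).
  have := measurableT_comp (measurable_ker e) (measurable_affine 1 (- w)).
  by apply: eq_measurable_fun => x _ /=; rewrite mul1r.
have E w : (\int[leb3]_v F (v, w) = smooth u1 e w.1.1 * smooth u2 e w.1.2 * smooth u3 e w.2)%E.
  transitivity (\int[lebesgue3]_v ((u1 v.1.1 * ker e (v.1.1 - w.1.1)) *
     (u2 v.1.2 * ker e (v.1.2 - w.1.2)) * (u3 v.2 * ker e (v.2 - w.2)))%:E)%E.
    apply: eq_integral => v _; congr EFin; rewrite /h /ker3/=.
    by move: (ker _ _) (ker _ _) (ker _ _) => *; ring.
  apply: (@lebesgue3_prod R (fun x => u1 x * ker e (x - w.1.1)) (fun x => u2 x * ker e (x - w.1.2))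
    (fun x => u3 x * ker e (x - w.2)));
    try (by apply: measurable_funM => //; exact: mk);
    by move=> x; apply: mulr_ge0 => //; exact: ker_ge0.
split.
  have := @measurable_fun_fubini_tonelli_G _ _ (R3 R) (R3 R) R leb3 F mF F0.
  by apply: eq_measurable_fun => w _; rewrite /fubini_G E.
have FT := @fubini_tonelli _ _ (R3 R) (R3 R) R leb3 P F mF F0.
transitivity (\int[leb3]_v \int[P]_w F (v, w))%E.
  apply: eq_integral => v _; rewrite -ge0_integralZl ?lee_fin//.
  - apply/measurable_EFinP; apply: (measurableT_comp (measurable_ker3 e)).
    exact: measurable_subl.
  - by move=> w _; rewrite lee_fin ker3_ge0.
by apply: (eq_trans FT); apply: eq_integral => w _; exact: E.
Qed.

Let ker_cvg (u : R -> R) z : continuous u -> (forall x, 0 <= u x <= 1) ->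
  smooth u n.+1%:R^-1 z @[n --> \oo] --> (u z * pi)%:E.
Proof. by move=> cu uI; exact: ker_approx. Qed.

(** The smoothed measure is tested in two ways. [L1] uses its pointwise convergence to
    [inv_fourier]; [L2] moves the kernel onto the test function by Tonelli's theorem, where it acts
    as an approximate identity of mass pi in each variable. *)
Lemma test_integral :
  (\int[lebesgue3]_v (h v * inv_fourier P v)%:E = (pi ^+ 3 : R)%:E * \int[P]_w (h w)%:E)%E.
Proof.
have e0 n : 0 < n.+1%:R^-1 :> R by rewrite invr_gt0.
have [B B0 HB] := poisson_bound decay.
have L1 : (\int[lebesgue3]_v ((h v)%:E * \int[P]_w (ker3 n.+1%:R^-1 (v - w))%:E) @[n --> \oo]
   --> \int[lebesgue3]_v (h v * inv_fourier P v)%:E)%E.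
  apply: (@dominated_cvg _ (R3 R) R lebesgue3 setT measurableT
    (fun n v => (h v)%:E * \int[P]_w (ker3 n.+1%:R^-1 (v - w))%:E)%E
    (fun v => (h v * inv_fourier P v)%:E) (fun v => (B * h v)%:E)); [| |by []| |].
  - by move=> n; apply: emeasurable_funM; [exact/measurable_EFinP|exact: measurable_poisson].
  - move=> v _; have hf : (h v)%:E \is a fin_num by [].
    exact: (cvgeZl hf (@poisson_cvg R P decay v)).
  - rewrite (_ : (fun v => _) = (fun v => B%:E * (h v)%:E)%E); last by apply/funext => v; rewrite EFinM.
    apply: integrableZl => //; apply/integrableP; split; first exact/measurable_EFinP.
    rewrite (eq_integral (fun v : R3 R => (h v)%:E)); last first.
      by move=> v _; rewrite abse_EFin ger0_norm.
    rewrite lebesgue3_prod// lte_mul_pinfty ?mule_ge0//; try by apply: integral_ge0 => x _; rewrite lee_fin.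
    + by rewrite fin_numM// ge0_fin_numE//; apply: integral_ge0 => x _; rewrite lee_fin.
  - move=> n v _.
    have I0 : (0 <= \int[P]_w (ker3 n.+1%:R^-1 (v - w))%:E)%E.
      by apply: integral_ge0 => w _; rewrite lee_fin ker3_ge0.
    rewrite gee0_abs ?mule_ge0 ?lee_fin// (EFinM B) muleC lee_wpmul2r ?lee_fin//.
    exact: HB.
have L2 : (\int[lebesgue3]_v ((h v)%:E * \int[P]_w (ker3 n.+1%:R^-1 (v - w))%:E) @[n --> \oo]
   --> \int[P]_w (pi ^+ 3 * h w)%:E)%E.
  rewrite (_ : (fun n : nat => _) = (fun n : nat => \int[P]_w (smooth u1 n.+1%:R^-1 w.1.1 *
     smooth u2 n.+1%:R^-1 w.1.2 * smooth u3 n.+1%:R^-1 w.2))%E); last first.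
    by apply/funext => n; have [_ ->] := test_tonelli (e0 n).
  apply: (@dominated_cvg _ (R3 R) R P setT measurableT
    (fun n w => smooth u1 n.+1%:R^-1 w.1.1 * smooth u2 n.+1%:R^-1 w.1.2 * smooth u3 n.+1%:R^-1 w.2)%E
    (fun w => (pi ^+ 3 * h w)%:E) (fun=> (pi ^+ 3)%:E)); [| |by []| |].
  - by move=> n; have [] := test_tonelli (e0 n).
  - move=> w _.
    rewrite (_ : (pi ^+ 3 * h w)%:E = (u1 w.1.1 * pi)%:E * (u2 w.1.2 * pi)%:E * (u3 w.2 * pi)%:E)%E; last first.
      by rewrite -!EFinM /h; congr EFin; ring.
    by apply: cvgeM => //; [apply: cvgeM => //|]; exact: ker_cvg.
  - by apply: finite_measure_integrable_cst.
  - move=> n w _; have s1 := smooth_ge0 w.1.1 u10 (e0 n).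
    have s2 := smooth_ge0 w.1.2 u20 (e0 n); have s3 := smooth_ge0 w.2 u30 (e0 n).
    rewrite gee0_abs ?mule_ge0// (_ : (pi ^+ 3)%:E = (pi : R)%:E * (pi : R)%:E * (pi : R)%:E)%E; last first.
      by rewrite -!EFinM; congr EFin; ring.
    by apply: lee_pmul; rewrite ?mule_ge0//; [apply: lee_pmul => //|]; exact: smooth_le.
have -> : (\int[lebesgue3]_v (h v * inv_fourier P v)%:E = \int[P]_w (pi ^+ 3 * h w)%:E)%E.
  exact: (cvg_unique _ L1 L2).
rewrite -ge0_integralZl ?lee_fin ?exprn_ge0 ?pi_ge0//.
- exact/measurable_EFinP.
- by move=> w _; rewrite lee_fin.
Qed.

End TestIntegrals.

(** * Smoothness of the density *)

Section RayTests.
Context {R : realType}.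
Notation TR := (measurableTypeR R).
Notation mu := (@lebesgue_measure R).

(* The function max(0, min(1, z)), in a form whose continuity is immediate. *)
Definition clamp (z : R) : R := (`|z| - `|z - 1| + 1) / 2.

Lemma clamp_le0 (z : R) : z <= 0 -> clamp z = 0.
Proof.
by move=> z0; rewrite /clamp ler0_norm// ler0_norm ?subr_le0 ?(le_trans z0)//; field.
Qed.

Lemma clamp_ge1 (z : R) : 1 <= z -> clamp z = 1.
Proof.
by move=> z1; rewrite /clamp ger0_norm ?(le_trans ler01)// ger0_norm ?subr_ge0//; field.
Qed.

Lemma clamp_mid (z : R) : 0 <= z <= 1 -> clamp z = z.
Proof.
by move=> /andP[z0 z1]; rewrite /clamp ger0_norm// ler0_norm ?subr_le0//; field.
Qed.

Lemma clamp_itv (z : R) : 0 <= clamp z <= 1.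
Proof.
have [z0|z0] := leP z 0; first by rewrite clamp_le0// lexx ler01.
have [z1|z1] := leP 1 z; first by rewrite clamp_ge1// lexx ler01.
by rewrite clamp_mid (ltW z0) (ltW z1).
Qed.

Lemma clamp_mono (y z : R) : y <= z -> clamp y <= clamp z.
Proof.
move=> yz; have /andP[a0 a1] := clamp_itv y; have /andP[b0 b1] := clamp_itv z.
have [y0|y0] := leP y 0; first by rewrite (clamp_le0 y0).
have [z1|z1] := leP 1 z; first by rewrite (clamp_ge1 z1).
have z0 := lt_le_trans y0 yz; have y1 := le_lt_trans yz z1.
by rewrite !clamp_mid ?(ltW y0) ?(ltW z0) ?(ltW y1) ?(ltW z1).
Qed.

Lemma continuous_clamp : continuous clamp.
Proof.
move=> z; apply: cvgM; last exact: cvg_cst.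
apply: cvgD; last exact: cvg_cst.
apply: cvgB; first by apply: cvg_norm; exact: cvg_id.
by apply: cvg_norm; apply: cvgB; [exact: cvg_id|exact: cvg_cst].
Qed.

(** Continuous, of bounded support and increasing with n to the indicator of the open ray below y:
    the first factor steepens at y, the second recedes towards -oo. *)
Definition ray_test (y : R) (n : nat) (x : R) : R := clamp (n%:R * (y - x)) * clamp (x + n%:R).

Lemma ray_test_itv y n x : 0 <= ray_test y n x <= 1.
Proof.
have /andP[a0 a1] := clamp_itv (n%:R * (y - x)); have /andP[b0 b1] := clamp_itv (x + n%:R).
by rewrite mulr_ge0//= mulr_ile1.
Qed.

Lemma ray_test_ge0 y n x : 0 <= ray_test y n x.
Proof. by case/andP: (ray_test_itv y n x). Qed.

Lemma ray_test_out y n x : y <= x -> ray_test y n x = 0.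
Proof. by move=> yx; rewrite /ray_test clamp_le0 ?mul0r// mulr_ge0_le0// subr_le0. Qed.

Lemma ray_test_mono y x m n : (m <= n)%N -> ray_test y m x <= ray_test y n x.
Proof.
move=> mn; have mn' : m%:R <= n%:R :> R by rewrite ler_nat.
have [yx|xy] := leP y x; first by rewrite !ray_test_out.
have /andP[a0 _] := clamp_itv (m%:R * (y - x)); have /andP[b0 _] := clamp_itv (x + m%:R).
apply: ler_pM => //; apply: clamp_mono; last by rewrite lerD2l.
by rewrite ler_wpM2r// subr_ge0 ltW.
Qed.

Lemma continuous_ray_test y n : continuous (ray_test y n).
Proof.
move=> x; apply: cvgM.
  apply: (@continuous_comp _ _ _ (fun x : R => n%:R * (y - x)) clamp); last exact: continuous_clamp.
  by apply: cvgM; [exact: cvg_cst|apply: cvgB; [exact: cvg_cst|exact: cvg_id]].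
apply: (@continuous_comp _ _ _ (fun x : R => x + n%:R) clamp); last exact: continuous_clamp.
by apply: cvgD; [exact: cvg_id|exact: cvg_cst].
Qed.

Lemma measurable_ray_test y n : @measurable_fun _ _ TR TR setT (ray_test y n).
Proof. by apply: continuous_measurable_fun; exact: continuous_ray_test. Qed.

Lemma ray_test_cvg y x :
  ray_test y n x @[n --> \oo] --> (\1_(`]-oo, y[%classic : set R) x : R).
Proof.
have [yx|xy] := leP y x.
  rewrite indicE memNset ?in_itv/=; last by rewrite in_itv/= ltNge yx.
  rewrite (_ : (fun n => _) = (fun=> 0)); first exact: cvg_cst.
  by apply/funext => n; rewrite ray_test_out.
rewrite indicE mem_set ?in_itv//=.
have yx0 : 0 < y - x by rewrite subr_gt0.
apply: (@cvg_near_cst _ _ _ _ _ eventually_filter).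
near=> n.
have n1 : (y - x)^-1 <= n%:R by near: n; exact: nbhs_infty_ger.
have n2 : 1 - x <= n%:R by near: n; exact: nbhs_infty_ger.
apply/eqP; rewrite /ray_test !clamp_ge1 ?mulr1//.
  by rewrite addrC -lerBlDr.
by rewrite -ler_pdivrMr// mul1r.
Unshelve. all: by end_near. Qed.

Lemma ray_test_integral y n : (\int[mu]_x (ray_test y n x)%:E < +oo)%E.
Proof.
apply: (@le_lt_trans _ _ (\int[mu]_x (\1_(`[- n%:R, y]%classic : set TR) x)%:E)%E).
  apply: ge0_le_integral => //.
  - by move=> x _; rewrite lee_fin ray_test_ge0.
  - by apply/measurable_EFinP; exact: measurable_ray_test.
  - by apply/measurable_EFinP; apply: measurable_indic; exact: measurable_itv.
  move=> x _; rewrite lee_fin indicE; case: (boolP (_ \in _)) => [_|].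
    by case/andP: (ray_test_itv y n x).
  rewrite notin_setE/= in_itv/= => /negP; rewrite negb_and -!ltNge => /orP[xn|yx].
    by rewrite /ray_test (clamp_le0 (_ : x + n%:R <= 0)) ?mulr0//; lra.
  by rewrite ray_test_out// ltW.
rewrite integral_indic// setIT.
suff H : (@lebesgue_measure R [set` `[- n%:R, y]%R] < +oo)%E by exact: H.
by rewrite lebesgue_measure_itv/=; case: ifP => _; rewrite ?ltry// -EFinD ltry.
Qed.

End RayTests.

Section RayUnique.
Context {R : realType}.
Notation TR := (measurableTypeR R).

(** Serves to vary one coordinate at a time: [phi] is that coordinate, and [E] a condition on the
    others. *)
Lemma measure_ray_unique_on d (T : measurableType d) (m1 m2 : {measure set T -> \bar R})
    (phi : T -> TR) (E : set T) : measurable_fun setT phi -> measurable E ->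
  (m1 setT < +oo)%E ->
  (forall b : R, m1 (phi @^-1` `]-oo, b[%classic `&` E) = m2 (phi @^-1` `]-oo, b[%classic `&` E)) ->
  forall A, measurable A -> m1 (phi @^-1` A `&` E) = m2 (phi @^-1` A `&` E).
Proof.
move=> mphi mE m1oo H A mA.
pose p1 := pushforward (mrestr m1 mE) phi; pose p2 := pushforward (mrestr m2 mE) phi.
apply: (@measure_ray_unique R p1 p2) => //.
rewrite /p1 /pushforward /mrestr; apply: le_lt_trans m1oo.
by apply: le_measure => //; rewrite inE//; apply: measurableI => //; rewrite preimage_setT.
Qed.

(** Rays are replaced by Borel sets one coordinate after another; the resulting boxes determine the
    measure first in the plane of the first two coordinates, then in space. *)
Lemma measure_ray3_unique (m1 m2 : {measure set (R3 R) -> \bar R}) :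
  (m1 setT < +oo)%E ->
  (forall a b c : R, m1 ([set` `]-oo, a[%R] `*` [set` `]-oo, b[%R] `*` [set` `]-oo, c[%R]) =
    m2 ([set` `]-oo, a[%R] `*` [set` `]-oo, b[%R] `*` [set` `]-oo, c[%R])) ->
  forall A, measurable A -> m1 A = m2 A.
Proof.
move=> m1oo H.
have [[n1 n2] n3] := (@measurable_c1 R, @measurable_c2 R, @measurable_c3 R).
have mray (a : R) : measurable (`]-oo, a[%classic : set TR) by exact: measurable_itv.
have pre (phi : R3 R -> TR) B : measurable_fun setT phi -> measurable B -> measurable (phi @^-1` B).
  by move=> mphi mB; rewrite -[X in measurable X]setTI; exact: mphi.
have E1 (A B C : set TR) : A `*` B `*` C = (fun x : R3 R => x.1.1) @^-1` A `&`
    ((fun x : R3 R => x.1.2) @^-1` B `&` (fun x : R3 R => x.2) @^-1` C).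
  by apply/seteqP; split => x /= [] => [[? ?] ?|? [? ?]].
have E2 (A B C : set TR) : A `*` B `*` C = (fun x : R3 R => x.1.2) @^-1` B `&`
    ((fun x : R3 R => x.1.1) @^-1` A `&` (fun x : R3 R => x.2) @^-1` C).
  by apply/seteqP; split => x /= [] => [[? ?] ?|? [? ?]].
have E3 (A B C : set TR) : A `*` B `*` C = (fun x : R3 R => x.2) @^-1` C `&`
    ((fun x : R3 R => x.1.1) @^-1` A `&` (fun x : R3 R => x.1.2) @^-1` B).
  by apply/seteqP; split => x /= [] => [[? ?] ?|? [? ?]].
have S1 (a b : R) C : measurable C ->
    m1 (`]-oo, a[%classic `*` `]-oo, b[%classic `*` C) = m2 (`]-oo, a[%classic `*` `]-oo, b[%classic `*` C).
  move=> mC; rewrite E3; apply: measure_ray_unique_on => //.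
    by apply: measurableI; apply: pre.
  by move=> c; rewrite -E3; exact: H.
have S2 (a : R) B C : measurable B -> measurable C ->
    m1 (`]-oo, a[%classic `*` B `*` C) = m2 (`]-oo, a[%classic `*` B `*` C).
  move=> mB mC; rewrite E2; apply: measure_ray_unique_on => //.
    by apply: measurableI; apply: pre.
  by move=> c; rewrite -E2; exact: S1.
have S3 A B C : measurable A -> measurable B -> measurable C ->
    m1 (A `*` B `*` C) = m2 (A `*` B `*` C).
  move=> mA mB mC; rewrite E1; apply: measure_ray_unique_on => //.
    by apply: measurableI; apply: pre.
  by move=> c; rewrite -E1; exact: S2.
apply: measure_rect_unique => // A C mA mC.
have mE : measurable ((fun x : R3 R => x.2) @^-1` C) by exact: pre.
have mf : measurable_fun setT (fun x : R3 R => x.1) by exact: measurable_fst.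
pose p1 := pushforward (mrestr m1 mE) (fun x : R3 R => x.1).
pose p2 := pushforward (mrestr m2 mE) (fun x : R3 R => x.1).
have EP (X : set (TR * TR)) : X `*` C = (fun x : R3 R => x.1) @^-1` X `&` (fun x : R3 R => x.2) @^-1` C.
  by apply/seteqP; split => x /= [].
rewrite EP; apply: (@measure_rect_unique _ _ _ _ R p1 p2) => //.
- rewrite /p1 /pushforward /mrestr; apply: le_lt_trans m1oo.
  by apply: le_measure => //; rewrite inE//; apply: measurableI => //; rewrite preimage_setT.
- by move=> X Y mX mY; have := S3 X Y C mX mY mC; rewrite EP.
Qed.

End RayUnique.

Lemma nondecreasing_integral_cvg (R : realType) d (T : measurableType d) (m : {measure set T -> \bar R})
    (F : nat -> T -> \bar R) (f : T -> \bar R) :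
  (forall n, measurable_fun setT (F n)) -> (forall n x, (0 <= F n x)%E) ->
  (forall x n k, (n <= k)%N -> (F n x <= F k x)%E) ->
  (forall x, F ^~ x @ \oo --> f x) ->
  (\int[m]_x F n x @[n --> \oo] --> \int[m]_x f x)%E.
Proof.
move=> mF F0 ndF Ff.
rewrite (eq_integral (fun x => limn (F ^~ x))); last first.
  by move=> x _; apply/esym/cvg_lim => //; exact: Ff.
apply: cvg_monotone_convergence => //.
- by move=> x _ n k nk; exact: ndF.
Qed.

Section Density.
Context {R : realType}.
Notation TR := (measurableTypeR R).
Notation mu := (@lebesgue_measure R).
Variable P : probability (R3 R) R.
Implicit Types (v w xi : R3 R).
Hypothesis decay : forall k : nat, exists C : R, forall xi, (1 + dot3 xi xi) ^+ k * qF P xi <= C.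

Let g v : R := inv_fourier P v / pi ^+ 3.

Let pi30 : 0 < pi ^+ 3 :> R. Proof. by rewrite exprn_gt0// pi_gt0. Qed.
Let g0 v : 0 <= g v. Proof. by rewrite divr_ge0 ?(ltW pi30)// inv_fourier_ge0. Qed.
Let mg : measurable_fun setT g.
Proof. by apply: measurable_funM => //; exact: measurable_inv_fourier. Qed.
Let mid : measurable_fun setT (@idfun (R3 R)). Proof. exact: measurable_id. Qed.
Let nu : {measure set (R3 R) -> \bar R} := wpush lebesgue3 mg g0 mid.

(** Both measures of the octant are limits, by monotone convergence, of integrals of products of ray
    tests, and [test_integral] compares these. *)
Lemma density_ray (a b c : R) :
  P ([set` `]-oo, a[%R] `*` [set` `]-oo, b[%R] `*` [set` `]-oo, c[%R]) =
  nu ([set` `]-oo, a[%R] `*` [set` `]-oo, b[%R] `*` [set` `]-oo, c[%R]).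
Proof.
set A : set (R3 R) := _ `*` _.
have mray (y : R) : measurable (`]-oo, y[%classic : set TR) by exact: measurable_itv.
have mA : measurable A by apply: measurableX => //; exact: measurableX.
pose h n v : R := ray_test a n v.1.1 * ray_test b n v.1.2 * ray_test c n v.2.
have mh n : measurable_fun setT (h n) by apply: measurable_prod3; exact: measurable_ray_test.
have h0 n v : 0 <= h n v by apply: mulr_ge0; [apply: mulr_ge0|]; exact: ray_test_ge0.
have ndh v m n : (m <= n)%N -> h m v <= h n v.
  move=> mn; apply: ler_pM; [by apply: mulr_ge0; exact: ray_test_ge0|exact: ray_test_ge0| |exact: ray_test_mono].
  by apply: ler_pM; rewrite ?ray_test_ge0//; exact: ray_test_mono.
have ch v : h n v @[n --> \oo] --> (\1_A v : R).
  have -> : (\1_A v : R) = \1_(`]-oo, a[%classic : set R) v.1.1 * \1_(`]-oo, b[%classic : set R) v.1.2 *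
      \1_(`]-oo, c[%classic : set R) v.2.
    rewrite !indicE -!natrM !mulnb; congr (_ %:R); congr nat_of_bool.
    apply/idP/idP => [/set_mem[[k1 k2] k3]|/andP[/andP[/set_mem k1 /set_mem k2] /set_mem k3]].
      by apply/andP; split; [apply/andP; split|]; exact: mem_set.
    exact: mem_set.
  by apply: cvgM; first apply: cvgM; exact: ray_test_cvg.
have LP : (\int[P]_w (h n w)%:E @[n --> \oo] --> P A)%E.
  rewrite (_ : P A = \int[P]_w (\1_A w)%:E)%E; last by rewrite integral_indic// setIT.
  apply: nondecreasing_integral_cvg.
  - by move=> n; exact/measurable_EFinP.
  - by move=> n x; rewrite lee_fin.
  - by move=> x n k nk; rewrite lee_fin ndh.
  - by move=> x; apply: cvg_EFin; [exact: nearW|exact: ch].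
have mI : measurable_fun setT (inv_fourier P) by exact: measurable_inv_fourier.
have I0 v : 0 <= inv_fourier P v by exact: inv_fourier_ge0.
have LG : (\int[lebesgue3]_v (h n v * inv_fourier P v)%:E @[n --> \oo] -->
    \int[lebesgue3]_v (\1_A v * inv_fourier P v)%:E)%E.
  apply: nondecreasing_integral_cvg.
  - by move=> n; apply/measurable_EFinP; exact: measurable_funM.
  - by move=> n x; rewrite lee_fin mulr_ge0.
  - by move=> x n k nk; rewrite lee_fin ler_wpM2r// ndh.
  - move=> x; apply: cvg_EFin; first exact: nearW.
    by apply: cvgM; [exact: ch|exact: cvg_cst].
have E : (\int[lebesgue3]_v (\1_A v * inv_fourier P v)%:E = (pi ^+ 3 : R)%:E * P A)%E.
  apply: (cvg_unique _ LG) => //.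
  rewrite (_ : (fun n : nat => _) = (fun n : nat => (pi ^+ 3 : R)%:E * \int[P]_w (h n w)%:E)%E).
    by apply: cvgeZl.
  apply/funext => n.
  apply: (test_integral decay) => //; try exact: continuous_ray_test;
    try exact: ray_test_itv; exact: ray_test_integral.
have -> : nu A = ((pi ^+ 3)^-1%:E * \int[lebesgue3]_v (\1_A v * inv_fourier P v)%:E)%E.
  rewrite -ge0_integralZl ?lee_fin ?invr_ge0 ?(ltW pi30)//.
  - by apply: eq_integral => v _; rewrite -!EFinM /g; congr EFin; ring.
  - by apply/measurable_EFinP; apply: measurable_funM => //; exact: measurable_indic.
  - by move=> v _; rewrite lee_fin mulr_ge0.
by rewrite E muleA -EFinM mulVf ?mul1e// gt_eqF.
Qed.

Lemma density_measure A : measurable A -> P A = nu A.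
Proof.
apply: measure_ray3_unique; last exact: density_ray.
by apply: le_lt_trans (probability_le1 P measurableT) _; exact: ltry.
Qed.

Lemma density_is_density : is_density P g.
Proof.
split => // A mA; rewrite density_measure//.
transitivity (\int[lebesgue3]_x ((g x)%:E * (\1_A x)%:E))%E; first by [].
rewrite [RHS]integral_mkcond; apply: eq_integral => x _.
by rewrite patchE indicE; case: ifPn => _; rewrite ?mule1 ?mule0.
Qed.

Lemma density_integral (f : R3 R -> R) : measurable_fun setT f ->
  \int[P]_v f v = \int[lebesgue3]_v (g v * f v).
Proof.
move=> mf; rewrite /Rintegral; congr fine.
transitivity (\int[nu]_v (f v)%:E)%E.
  by apply: eq_measure_integral => A mA _; exact: density_measure.
have H := @integral_wpush _ _ _ _ R lebesgue3 g idfun mg g0 mid (EFin \o f).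
by apply: (eq_trans (H _)); [exact/measurable_EFinP|apply: eq_integral => v _; rewrite EFinM].
Qed.

Lemma fourier_density xi : fourier g xi = charf P xi.
Proof.
rewrite /fourier /charf; congr (_ -i* _)%C.
  by apply/esym; apply: density_integral; exact: measurable_cos_dot3.
by apply/esym; apply: density_integral; exact: measurable_sin_dot3.
Qed.

Lemma density_sobolev k : sobolev k g.
Proof.
have [_ _ dA] := density_is_density.
have I1 : (\int[lebesgue3]_v (g v)%:E = 1)%E by rewrite -(dA _ (@measurableT _ (R3 R))) probability_setT.
have [B B0 HB] := inv_fourier_bounded decay.
split.
- apply/integrableP; split; first exact/measurable_EFinP.
  rewrite (eq_integral (fun v : R3 R => (g v)%:E)) ?I1 ?ltry// => v _.
  by rewrite [LHS]abse_EFin ger0_norm.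
(* The density is bounded and has integral 1, so its square is integrable. *)
- apply: (@le_lt_trans _ _ (\int[lebesgue3]_v ((B / pi ^+ 3)%:E * (g v)%:E))%E).
    apply: ge0_le_integral => //.
    + by move=> v _; rewrite lee_fin sqr_ge0.
    + by apply/measurable_EFinP; exact: measurable_funX.
    + by apply: emeasurable_funM => //; exact/measurable_EFinP.
    + move=> v _; rewrite -EFinM lee_fin expr2 ler_wpM2r//.
      by rewrite /g ler_wpM2r// invr_ge0 ltW.
  rewrite ge0_integralZl ?lee_fin//.
  - by rewrite I1 mule1 ltry.
  - exact/measurable_EFinP.
  - by move=> v _; rewrite lee_fin.
  - by rewrite divr_ge0// ltW.
(* The Fourier transform of [g] is [charf P], so the weighted integrand is dominated by a multiple
   of [ker3 1]. *)
- have [C C0 HC] := decay_ker3 decay k.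
  have nE xi : (1 + norm3 xi ^+ 2) ^+ k * ComplexField.Normc.normc (fourier g xi) ^+ 2 =
      (1 + dot3 xi xi) ^+ k * qF P xi.
    rewrite norm3_sqr fourier_density; congr (_ * _).
    rewrite /ComplexField.Normc.normc /charf/= -!/(cosF _ _) -!/(sinF _ _) sqr_sqrtr ?addr_ge0 ?sqr_ge0//.
    by rewrite /qF sqrrN.
  apply: (@le_lt_trans _ _ (\int[lebesgue3]_xi (C%:E * (ker3 1 xi)%:E))%E).
    apply: ge0_le_integral => //.
    + by move=> xi _; rewrite nE lee_fin mulr_ge0 ?qF_ge0// exprn_ge0// addr_ge0// dot3_ge0.
    + under eq_fun do rewrite nE.
      apply/measurable_EFinP; apply: measurable_funM; last exact: measurable_qF.
      by apply: measurable_funX; apply: measurable_funD => //; exact: measurable_dot33.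
    + by apply: emeasurable_funM => //; apply/measurable_EFinP; exact: measurable_ker3.
    + by move=> xi _; rewrite nE -EFinM lee_fin.
  rewrite ge0_integralZl ?lee_fin//.
  - by rewrite integral_ker31 -EFinM ltry.
  - by apply/measurable_EFinP; exact: measurable_ker3.
  - by move=> xi _; rewrite lee_fin ker3_ge0.
Qed.

Lemma decay_in_Hoo : in_Hoo P.
Proof. by exists g; [exact: density_is_density|exact: density_sobolev]. Qed.

End Density.

Theorem theorem1p3 (R : realType) (s : R) (b : R -> R) (K alpha : R)
    (F0 : probability (R3 R) R) (f : R -> probability (R3 R) R)
    (hs : 0 < s < 1)
    (hb : cross_section b)
    (hK : 0 < K)
    (hbK : b (cos theta) * theta `^ (2 + 2 * s) @[theta --> 0^'+] --> K)
    (halpha : 2 * s < alpha <= 2)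
    (hF0 : tildeP alpha F0)
    (hdirac : ~ is_dirac F0)
    (hf : boltzmann_solution b alpha F0 f) :
  (exists2 T : R, 0 < T & forall t, 0 < t <= T -> in_Hoo (f t)) /\
  (P_ 2 F0 -> forall t, 0 < t -> in_Hoo (f t)) /\
  (P_ 1 F0 -> s < 2^-1 -> forall t, 0 < t -> in_Hoo (f t)).
Proof.
have alpha0 : 0 <= alpha.
  by move: halpha hs => /andP[h1 _] /andP[s0 _]; rewrite (le_trans _ (ltW h1))// mulr_ge0// ltW.
have smooth t : 0 < t -> in_Hoo (f t).
  move=> t0; apply: decay_in_Hoo => k.
  exact: (qF_decay k hs hb hK hbK alpha0 hdirac hf t0).
(* [smooth] covers every positive time, so any positive [T] serves. *)
split; first by exists 1 => // t /andP[t0 _]; exact: smooth.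
by split => [_|_ _]; exact: smooth.
Qed.
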